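(* Let $S\subset\mathbf{R}\setminus\{0\}$ be finite. Then there exist two constants $c_S,c'_S>0$ (depending only on $S$) such that the following holds. For every finite symmetric set $A\subset\mathbf{Z}\setminus\{0\}$ of size $n=|A|$, and every choice of coefficients $s_a\in S$ ($a\in A$) satisfying $s_a=s_{-a}$ for all $a\in A$, we have that $$\min_{x\in\mathbf{R}}\sum_{a\in A}s_a e(ax)\leqslant -c'_S\, n^{c_S}.$$
   Context: $e(x)=e^{2\pi i x}$ for $x\in\mathbf{R}$. A set $A\subset\mathbf{Z}$ is symmetric if $A=-A$, where $-A=\{-a:a\in A\}$; since $s_a=s_{-a}$, the sum above is real-valued. *)

(* Defs.v *)
From HB Require Import structures.
From mathcomp Require Import all_boot all_order all_algebra finmap.
From mathcomp Require Import all_classical all_reals all_analysis.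
From mathcomp Require Import complex.

Set Implicit Arguments.
Unset Strict Implicit.
Unset Printing Implicit Defensive.

Import Order.TTheory GRing.Theory Num.Theory.

Local Open Scope ring_scope.
Local Open Scope complex_scope.

(* e(x) = exp(2 pi i x), through Euler's formula: MathComp-Analysis has no
   complex exponential. *)
Definition e (R : realType) (x : R) : R[i] :=
  cos (2 * pi * x) +i* sin (2 * pi * x).

Definition symmetric_set (A : {fset int}) : Prop :=
  A = [fset - a | a in A]%fset.

(* The value is kept in R[i], whose order means equal imaginary parts and ordered
   real parts; in particular, z <= r%:C forces z to be real.
   Only the values of [s] on [A] matter. *)
Definition trig_sum (R : realType) (A : {fset int}) (s : int -> R) (x : R) :
    R[i] :=
  \sum_(a <- A) (s a)%:C * e (a%:~R * x).

(* Main.v *)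
Require Import Defs.
From HB Require Import structures.
From mathcomp Require Import all_boot all_order all_algebra.
From mathcomp Require Import complex ring lra zify.

(** Let [f x] be the sum of [s a * cos (2 pi a x)] over [A], and suppose that
    [f >= - Kp].  The theorem says that [Kp] is at least a fixed power of the
    number of frequencies.

    Since [f + Kp >= 0], its Fourier coefficients are positive definite.  Sampled
    at the [N]-th roots of unity, they are the inner products of explicit real
    vectors (lemma [dot_wave]): the vector of [a] against that of [b] gives [Kp]
    if [a = b], and [s (a - b)] or 0 otherwise, according as [a - b] lies in [A]
    or not, up to scaling and as long as nothing wraps around modulo [N].
    Squaring the coefficients (which squares the Gram matrix entrywise) gives a
    positive definite [phi] with [phi 0 <= K], where [K] is of order [Kp ^+ 2],
    and with all other values in [0 :: V], where [V] is a finite subset of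
    an interval [[m, 1]] with [m > 0].  The claim becomes that [A], on which
    [phi >= m], has at most polynomially many elements in [K].  Assume that it
    has more.

    Spectrum.  Let [M] be the Gram matrix restricted to [n] points.  Its entries
    off the diagonal are roots of a fixed polynomial, so that entrywise
    multiplication by [M] acts almost like a bounded operator on the sum of the
    first entrywise powers of [M].  A part of [M] with few eigenvalues has low
    rank, and so do its entrywise powers; comparing traces along these powers
    shows that the small eigenvalues carry a negligible share of the trace of
    the square of [M] (theorem [low_spectrum]).  The number [n] need only exceed
    a power of [K].

    Density.  Among the subsets of [A] take one that maximises
    [density ^+ 2 * size], where the density of [Y] is the mean of [phi] over the
    differences of [Y].  If the density were tiny, so would be the trace of the
    cube of [M], which bounds the large eigenvalues; the small ones being
    negligible, the trace of the square could not be as large as it is.  Hence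
    some [Y] of polynomial proportion has density bounded below
    (lemma [dense_subset]).

    Stability.  Passing to denser subsets as long as possible ([increment]) and
    discarding atypical points ([homogenize]), one may assume that the vectors of
    all large subsets of [Y] have nearly the same average [u].  Together with
    the spectral information this makes [phi] have small variance on the
    differences of [Y] ([second_moment]).

    A walk.  For a translation [z], let [psi z] be the mean of [phi] over the
    differences of [Y] translated by [z].  Small variance at [z = 0] forces the mean
    of [phi ^+ 2] over the translated differences to be close to [psi z ^+ 2],
    for all [z] ([moment_transfer]).  As [phi ^+ 2 >= m * phi], this mean is at
    least [m * psi z], so that [psi] has no small positive values.  Now nonzero
    values of [phi] at differences of [Y] occur only at points of [A]; thus many
    pairs share few differences, and there is a nonzero [x = t - t'] such that
    [Y] meets its translate by [x] in a large set ([popular_translate]).  By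
    stability, translation by [x] hardly moves [u], so [psi] changes little
    between [x *+ k] and [x *+ k.+1]; it starts at the density of [Y] and cannot
    jump over the gap, hence is positive at all multiples of [x]
    ([walk_homogeneous], [bounded_walk]).  In the integers this is absurd:
    for a suitable [k] the point [x *+ k] is far from everything built out of [A]
    ([cos_sum_bound]). *)

Set Implicit Arguments.
Unset Strict Implicit.
Unset Printing Implicit Defensive.

Import Order.TTheory GRing.Theory Num.Theory.

Local Open Scope ring_scope.

(** * Spectral theorem for real symmetric matrices *)

Section Spectral.
Context {R : rcfType}.

(** The matrix is diagonalised over [R[i]]. Its eigenvalues are real, so the
    real and imaginary parts of a complex eigenvector are both eigenvectors or
    zero. *)
Lemma real_eigenvector n (A : 'M[R]_n) : A^T = A -> A != 0 ->
  exists (l : R) (v : 'rV[R]_n), [/\ l != 0, v != 0 & v *m A = l *: v].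
Proof.
move=> symA nzA.
pose rc := real_complex R.
pose B : 'M[R[i]]_n := map_mx rc A.
have rcB i j : B i j = (A i j)%:C%C by rewrite mxE.
have Breal : B \is a realmx.
  by apply/mxOverP => i j; rewrite rcB complex_real.
have Bsym : B \is symmetricmx.
  apply/is_hermitianmxP; rewrite expr0 scale1r map_mx_id //.
  by apply/matrixP => i j; rewrite !mxE -[in LHS]symA mxE.
have Bherm := realsym_hermsym Bsym Breal.
have Dreal := hermitian_spectral_diag_real Bherm.
have /orthomx_spectralP eqB := hermitian_normalmx Bherm.
set P := spectralmx B in eqB; set D := spectral_diag B in eqB Dreal.
have Punit : P \in unitmx := spectral_unit B.
have nzB : B != 0.
  apply: contra_neq nzA => B0; apply/matrixP => i j.
  have /matrixP/(_ i j) := B0; rewrite rcB !mxE.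
  by move/(congr1 (@complex.Re R)).
have [k Dk] : exists k, D 0 k != 0.
  apply/existsP; apply: contraNT nzB => /existsPn D0.
  rewrite eqB (_ : diag_mx D = 0) ?mulmx0 ?mul0mx //.
  apply/matrixP => i j; rewrite !mxE; have /negPn/eqP-> := D0 i.
  by rewrite mul0rn.
have PB : P *m B = diag_mx D *m P.
  by rewrite {1}eqB mulmxA mulmxA mulmxV // mul1mx.
have rowPB : row k P *m B = D 0 k *: row k P.
  rewrite -row_mul PB; apply/rowP => j; rewrite !mxE (bigD1 k) //= !mxE eqxx.
  rewrite big1 ?addr0 ?mulr1n // => i ik.
  by rewrite !mxE eq_sym (negPf ik) mulr0n mul0r.
have Dk_real : D 0 k \is Num.real by have /mxOverP := Dreal; apply.
have ImDk : complex.Im (D 0 k) = 0.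
  move: Dk_real; rewrite realE; case: (D 0 k) => a b.
  by rewrite !lecE /= => /orP[] /andP[/eqP].
have nzP : row k P != 0.
  apply/eqP => rk0; have : row k (P *m invmx P) = 0 by rewrite row_mul rk0 mul0mx.
  rewrite mulmxV // => /rowP/(_ k); rewrite !mxE eqxx => /eqP.
  by rewrite oner_eq0.
have Dkc : D 0 k = (complex.Re (D 0 k))%:C%C.
  by case: (D 0 k) ImDk => a b /= ->.
have comp j : \sum_i P k i * (A i j)%:C%C = (complex.Re (D 0 k))%:C%C * P k j.
  have /rowP/(_ j) := rowPB; rewrite !mxE -Dkc => <-.
  by apply: eq_bigr => i _; rewrite rcB !mxE.
have nzl : complex.Re (D 0 k) != 0.
  by apply: contra_neq Dk => l0; rewrite Dkc l0.
pose v1 : 'rV[R]_n := \row_i complex.Re (P k i).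
pose v2 : 'rV[R]_n := \row_i complex.Im (P k i).
have e1 : v1 *m A = complex.Re (D 0 k) *: v1.
  apply/rowP => j; rewrite !mxE; have := congr1 (@complex.Re R) (comp j).
  rewrite raddf_sum /=; case: (P k j) => a b /=; rewrite mul0r subr0 => <-.
  by apply: eq_bigr => i _; rewrite !mxE; case: (P k i) => c d /=; ring.
have e2 : v2 *m A = complex.Re (D 0 k) *: v2.
  apply/rowP => j; rewrite !mxE; have := congr1 (@complex.Im R) (comp j).
  rewrite raddf_sum /=; case: (P k j) => a b /=; rewrite mul0r addr0 => <-.
  by apply: eq_bigr => i _; rewrite !mxE; case: (P k i) => c d /=; ring.
exists (complex.Re (D 0 k)).
have [v10|nz1] := eqVneq v1 0; last by exists v1.
exists v2; split=> //; apply: contra_neq nzP => v20.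
apply/rowP => i; have /rowP/(_ i) := v10; have /rowP/(_ i) := v20.
by rewrite !mxE; case: (P k i) => a b /= -> ->.
Qed.

Lemma dot_rV_ge0 n (v : 'rV[R]_n) : 0 <= (v *m v^T) 0 0 ?= iff (v == 0).
Proof.
split; first by rewrite mxE sumr_ge0 // => i _; rewrite mxE -expr2 sqr_ge0.
rewrite eq_sym; apply/eqP/eqP => [|->]; last by rewrite mul0mx mxE.
rewrite mxE => /eqP; rewrite psumr_eq0; last first.
  by move=> i _; rewrite mxE -expr2 sqr_ge0.
move=> /allP v0; apply/rowP => i; have := v0 i (mem_index_enum i).
by rewrite !mxE -expr2 sqrf_eq0 => /eqP.
Qed.

Lemma unit_eigenvector n (A : 'M[R]_n) : A^T = A -> A != 0 ->
  exists (l : R) (v : 'rV[R]_n), [/\ l != 0, v *m v^T = 1%:M & v *m A = l *: v].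
Proof.
move=> symA /(real_eigenvector symA) [l [v [l0 v0 vA]]].
have v_gt0 : 0 < (v *m v^T) 0 0.
  by rewrite lt_neqAle (dot_rV_ge0 v).2 (dot_rV_ge0 v).1 v0.
exists l, ((Num.sqrt ((v *m v^T) 0 0))^-1 *: v); split=> //; last first.
  by rewrite -scalemxAl vA scalerA mulrC -scalerA.
rewrite linearZ /= -scalemxAl -scalemxAr scalerA -invfM -expr2.
rewrite sqr_sqrtr ?ltW //; apply/matrixP => i j.
by rewrite !ord1 [in LHS]mxE mulVf ?gt_eqF // mxE eqxx.
Qed.

(** Induction on the rank: subtracting [l *: v^T *m v] for a unit eigenvector
    [v] takes [v] out of the row space. Bounding the number of terms by the rank
    is what makes low-rank kernels visible in their spectrum. *)
Lemma spectral_sym n (A : 'M[R]_n) : A^T = A ->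
  exists (r : nat) (l : 'I_r -> R) (f : 'I_r -> 'rV[R]_n),
    [/\ (r <= \rank A)%N, forall i j, f i *m (f j)^T = (i == j)%:R%:M,
        forall i, l i != 0 & A = \sum_i l i *: ((f i)^T *m f i)].
Proof.
have [k] := ubnP (\rank A); elim: k A => // k IH A rkA symA.
have [->|nzA] := eqVneq A 0.
  exists 0%N, (fun=> 0), (fun=> 0); split=> //; first by case.
    by case.
  by rewrite big_ord0.
have [l [v [nzl vv vA]]] := unit_eigenvector symA nzA.
pose A' := A - l *: (v^T *m v).
have symA' : A'^T = A'.
  by rewrite /A' linearB linearZ /= trmx_mul trmxK symA.
have Av : A *m v^T = l *: v^T by rewrite -[A]symA -trmx_mul vA linearZ.
have A'v : A' *m v^T = 0.
  by rewrite mulmxBl Av -scalemxAl -mulmxA vv mulmx1 subrr.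
have A'E : A' = (1%:M - v^T *m v) *m A.
  by rewrite mulmxBl mul1mx -mulmxA vA -scalemxAr.
have sA'A : (A' <= A)%MS by rewrite A'E submxMl.
have rkA' : (\rank A' < \rank A)%N.
  rewrite ltn_neqAle (mxrank_leqif_sup sA'A).1 andbT.
  rewrite (mxrank_leqif_sup sA'A).2; apply/negP => sAA'.
  have /submxP[w vE] : (v <= A')%MS.
    apply: submx_trans sAA'; apply/submxP; exists (l^-1 *: v).
    by rewrite -scalemxAl vA scalerA mulVf // scale1r.
  move: vv; rewrite {1}vE -mulmxA A'v mulmx0 => /matrixP/(_ 0 0).
  by rewrite !mxE eqxx => /eqP; rewrite eq_sym oner_eq0.
have [r [l' [f' [rr orth nzl' A'sum]]]] := IH A' (leq_trans rkA' rkA) symA'.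
have f'v i : f' i *m v^T = 0.
  have : f' i *m A' = l' i *: f' i.
    rewrite A'sum mulmx_sumr (bigD1 i) //= -scalemxAr mulmxA orth eqxx mul1mx.
    rewrite big1 ?addr0 // => j ji.
    by rewrite -scalemxAr mulmxA orth eq_sym (negPf ji) mul_scalar_mx scale0r scaler0.
  move/(congr1 (mulmx^~ v^T)); rewrite -mulmxA A'v mulmx0 -scalemxAl => /esym/eqP.
  by rewrite scaler_eq0 (negPf (nzl' i)) => /eqP.
exists r.+1, (fun i => oapp l' l (unlift ord0 i)),
  (fun i => oapp f' v (unlift ord0 i)); split.
- exact: leq_ltn_trans rr rkA'.
- move=> i j; case: (unliftP ord0 i) => [i' ->|->];
    case: (unliftP ord0 j) => [j' ->|->] /=.
  + by rewrite orth (inj_eq lift_inj).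
  + by rewrite f'v; apply/matrixP => a b; rewrite !mxE mul0rn.
  + rewrite -[v]trmxK -trmx_mul f'v.
    by apply/matrixP => a b; rewrite !mxE mul0rn.
  + by rewrite vv.
- by move=> i; case: (unlift ord0 i) => [i'|] /=.
- rewrite big_ord_recl unlift_none /=.
  under eq_bigr do rewrite liftK /=.
  by rewrite -A'sum /A' addrC subrK.
Qed.

End Spectral.

(** * Kernels on a finite type: forms, spectra and traces *)

Section Kernels.
Context {R : rcfType} {T : finType}.
Implicit Types (g : T -> R) (M N P Q : T -> T -> R) (c : R).

Definition dot {I : finType} (u v : I -> R) : R := \sum_i u i * v i.
Definition qf M g : R := \sum_x \sum_y g x * g y * M x y.
Definition psd M : Prop := forall g, 0 <= qf M g.
Definition le_qf M N : Prop := forall g, qf M g <= qf N g.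
Definition had M N : T -> T -> R := fun x y => M x y * N x y.
Definition hpow M j : T -> T -> R := fun x y => M x y ^+ j.
Definition scalarK c : T -> T -> R := fun x y => c * (x == y)%:R.
Definition addK M N : T -> T -> R := fun x y => M x y + N x y.

Lemma eq_qf M N g : (forall x y, M x y = N x y) -> qf M g = qf N g.
Proof. by move=> MN; apply: eq_bigr => x _; apply: eq_bigr => y _; rewrite MN. Qed.

Lemma qf_sum (J : finType) (p : pred J) (F : J -> T -> T -> R) g :
  qf (fun x y => \sum_(j | p j) F j x y) g = \sum_(j | p j) qf (F j) g.
Proof.
rewrite /qf [RHS]exchange_big /=; apply: eq_bigr => x _.
rewrite [RHS]exchange_big /=; apply: eq_bigr => y _; exact: mulr_sumr.
Qed.

Lemma qfD M N g : qf (addK M N) g = qf M g + qf N g.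
Proof.
rewrite /qf -big_split; apply: eq_bigr => x _ /=.
by rewrite -big_split; apply: eq_bigr => y _ /=; rewrite mulrDr.
Qed.

Lemma qfZ c M g : qf (fun x y => c * M x y) g = c * qf M g.
Proof.
rewrite /qf mulr_sumr; apply: eq_bigr => x _; rewrite mulr_sumr.
by apply: eq_bigr => y _; ring.
Qed.

Lemma qf_scalarK c g : qf (scalarK c) g = c * dot g g.
Proof.
rewrite /qf /dot mulr_sumr; apply: eq_bigr => x _.
rewrite (bigD1 x) //= big1 /scalarK => [|y yx]; last first.
  by rewrite eq_sym (negPf yx) !mulr0.
by rewrite eqxx /=; ring.
Qed.

Lemma qf_rank1 (f : T -> R) g : qf (fun x y => f x * f y) g = dot g f ^+ 2.
Proof.
rewrite expr2 /dot mulr_suml; apply: eq_bigr => x _; rewrite mulr_sumr.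
by apply: eq_bigr => y _; ring.
Qed.

Lemma le_qf_trans M N P : le_qf M N -> le_qf N P -> le_qf M P.
Proof. by move=> MN NP g; apply: le_trans (MN g) (NP g). Qed.

Lemma dot_ge0 g : 0 <= dot g g.
Proof. by apply: sumr_ge0 => x _; rewrite -expr2 sqr_ge0. Qed.

Definition spectral M r (l : 'I_r -> R) (f : 'I_r -> T -> R) : Prop :=
  (forall i j, dot (f i) (f j) = (i == j)%:R) /\
  (forall x y, M x y = \sum_i l i * (f i x * f i y)).

(** A sum of [k] squares of linear forms: this bundles positivity with the bound
    on the rank. *)
Definition rank_le M (k : nat) : Prop :=
  exists (J : finType) (C : J -> T -> R),
    (#|J| <= k)%N /\ forall x y, M x y = \sum_t C t x * C t y.

(** The matrix of [M] in an enumeration of [T], diagonalised by [spectral_sym].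
    *)
Lemma spectral_kernel M : (forall x y, M x y = M y x) ->
  exists r l f, @spectral M r l f /\ forall k, rank_le M k -> (r <= k)%N.
Proof.
move=> symM.
pose A : 'M[R]_#|T| := \matrix_(i, j) M (enum_val i) (enum_val j).
have symA : A^T = A by apply/matrixP => i j; rewrite !mxE symM.
have [r [l [f [rA orth _ AE]]]] := spectral_sym symA.
exists r, l, (fun i x => f i 0 (enum_rank x)); split; first split.
- move=> i j; have /matrixP/(_ 0 0) := orth i j; rewrite !mxE eqxx mulr1n => <-.
  rewrite /dot (reindex (@enum_val T predT)) /=; last first.
    by exists enum_rank => x _; rewrite ?enum_valK ?enum_rankK.
  by apply: eq_bigr => k _; rewrite mxE enum_valK.
- move=> x y; have /matrixP/(_ (enum_rank x) (enum_rank y)) := AE.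
  rewrite mxE !enum_rankK => ->; rewrite summxE; apply: eq_bigr => i _.
  by rewrite !mxE big_ord1 !mxE.
- move=> k [J [C [Jk ME]]]; apply: leq_trans rA (leq_trans _ Jk).
  pose D : 'M[R]_(#|J|, #|T|) := \matrix_(i, j) C (enum_val i) (enum_val j).
  suff -> : A = D^T *m D by apply: leq_trans (mxrankM_maxr _ _) (rank_leq_row _).
  apply/matrixP => i j; rewrite !mxE ME (reindex (@enum_val J predT)) /=.
    by apply: eq_bigr => a _; rewrite !mxE.
  by exists enum_rank => a _; rewrite ?enum_valK ?enum_rankK.
Qed.

Section SpectralFacts.
Variables (M : T -> T -> R) (r : nat) (l : 'I_r -> R) (f : 'I_r -> T -> R).
Hypothesis specM : spectral M l f.

Lemma spectral_eigen i x : \sum_y M x y * f i y = l i * f i x.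
Proof.
have [orth ME] := specM.
under eq_bigr => y _ do rewrite ME mulr_suml.
rewrite exchange_big /= (bigD1 i) //= [X in _ + X]big1 ?addr0 => [|j ji].
  transitivity (l i * f i x * dot (f i) (f i)); last by rewrite orth eqxx mulr1.
  by rewrite /dot mulr_sumr; apply: eq_bigr => y _; ring.
transitivity (l j * f j x * dot (f j) (f i)); last first.
  by rewrite orth (negPf ji) mulr0.
by rewrite /dot mulr_sumr; apply: eq_bigr => y _; ring.
Qed.

Lemma spectral_qf i : qf M (f i) = l i.
Proof.
have [orth _] := specM.
transitivity (\sum_x f i x * (l i * f i x)).
  apply: eq_bigr => x _; rewrite -spectral_eigen mulr_sumr.
  by apply: eq_bigr => y _; ring.
transitivity (l i * dot (f i) (f i)); last by rewrite orth eqxx mulr1.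
by rewrite /dot mulr_sumr; apply: eq_bigr => x _; ring.
Qed.

Lemma spectral_ge0 i : psd M -> 0 <= l i.
Proof. by move=> /(_ (f i)); rewrite spectral_qf. Qed.

Lemma spectral_sqr x y : \sum_z M x z * M z y = \sum_i l i ^+ 2 * (f i x * f i y).
Proof.
have [orth ME] := specM.
under eq_bigr => z _ do rewrite [M z y]ME mulr_sumr.
rewrite exchange_big /=; apply: eq_bigr => i _.
transitivity ((\sum_z M x z * f i z) * (l i * f i y)).
  by rewrite mulr_suml; apply: eq_bigr => z _; ring.
by rewrite spectral_eigen; ring.
Qed.

(** Each [f i] is a unit vector, so it contributes [h i] to the trace of a
    kernel written in terms of the squares of the [f i]. *)
Lemma spectral_partial_trace (p : pred 'I_r) (h : 'I_r -> R) :
  \sum_x \sum_(i | p i) h i * (f i x * f i x) = \sum_(i | p i) h i.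
Proof.
have [orth _] := specM.
rewrite exchange_big; apply: eq_bigr => i _ /=.
rewrite -mulr_sumr -/(dot (f i) (f i)) orth eqxx.
by rewrite mulr1.
Qed.

Lemma spectral_trace : \sum_x M x x = \sum_i l i.
Proof.
have [_ ME] := specM; rewrite -(spectral_partial_trace predT).
by apply: eq_bigr => x _; rewrite ME.
Qed.

Lemma spectral_trace2 : (forall x y, M x y = M y x) ->
  \sum_x \sum_y M x y ^+ 2 = \sum_i l i ^+ 2.
Proof.
move=> symM; rewrite -(spectral_partial_trace predT (fun i => l i ^+ 2)).
apply: eq_bigr => x _; rewrite -spectral_sqr; apply: eq_bigr => y _.
by rewrite expr2 [M y x]symM.
Qed.

Lemma spectral_trace3 :
  \sum_w \sum_x \sum_y M w x * M x y * M y w = \sum_i l i ^+ 3.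
Proof.
have [orth ME] := specM.
rewrite -(spectral_partial_trace predT (fun i => l i ^+ 3)).
apply: eq_bigr => w _.
transitivity (\sum_x M w x * \sum_i l i ^+ 2 * (f i x * f i w)).
  apply: eq_bigr => x _; rewrite -spectral_sqr mulr_sumr.
  by apply: eq_bigr => y _; ring.
under eq_bigr => x _ do rewrite mulr_sumr.
rewrite exchange_big; apply: eq_bigr => i _ /=.
transitivity ((\sum_x M w x * f i x) * (l i ^+ 2 * f i w)).
  by rewrite mulr_suml; apply: eq_bigr => x _; ring.
by rewrite spectral_eigen; ring.
Qed.

(** The right side minus the left side is the squared norm of [g] minus its
    projection on the [f i]. *)
Lemma bessel g : \sum_i dot (f i) g ^+ 2 <= dot g g.
Proof.
have [orth _] := specM.
pose h x := g x - \sum_i dot (f i) g * f i x.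
rewrite -subr_ge0.
suff <- : dot h h = dot g g - \sum_i dot (f i) g ^+ 2 by exact: dot_ge0.
have fh i : dot (f i) h = 0.
  transitivity (dot (f i) g - \sum_j dot (f j) g * dot (f i) (f j)).
    rewrite {1}/dot; under eq_bigr => x _ do rewrite mulrBr mulr_sumr.
    rewrite sumrB; congr (_ - _); rewrite exchange_big; apply: eq_bigr => j _ /=.
    by rewrite /dot mulr_sumr; apply: eq_bigr => x _; ring.
  rewrite (bigD1 i) //= orth eqxx mulr1 big1 ?addr0 ?subrr // => j ji.
  by rewrite orth eq_sym (negPf ji) mulr0.
have dotC (u v : T -> R) : dot u v = dot v u.
  by apply: eq_bigr => x _; rewrite mulrC.
transitivity (dot g h - \sum_i dot (f i) g * dot (f i) h).
  rewrite {1}/dot; under eq_bigr => x _ do rewrite {1}/h mulrBl mulr_suml.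
  rewrite sumrB; congr (_ - _); rewrite exchange_big; apply: eq_bigr => j _ /=.
  by rewrite /dot mulr_sumr; apply: eq_bigr => x _; ring.
rewrite [X in _ - X]big1 => [|i _]; last by rewrite fh mulr0.
rewrite subr0 {1}/dot; under eq_bigr => x _ do rewrite mulrBr mulr_sumr.
rewrite sumrB; congr (_ - _); rewrite exchange_big; apply: eq_bigr => j _ /=.
by rewrite expr2 {3}/dot mulr_sumr; apply: eq_bigr => x _; ring.
Qed.

End SpectralFacts.

(** In terms of the eigenvalues [m j] and eigenvectors [h j] of [M], the left
    side is the sum of [m j * \sum_i dot (f i) (h j) ^+ 2], and Bessel bounds
    each inner sum by 1. *)
Lemma qf_trace_le M N r (l : 'I_r -> R) (f : 'I_r -> T -> R) :
  spectral N l f -> psd M -> (forall x y, M x y = M y x) ->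
  \sum_i qf M (f i) <= \sum_x M x x.
Proof.
move=> specN psdM symM; have [s [m [h [specM _]]]] := spectral_kernel symM.
rewrite (spectral_trace specM).
have -> : \sum_i qf M (f i) = \sum_j m j * \sum_i dot (f i) (h j) ^+ 2.
  under [RHS]eq_bigr => j _ do rewrite mulr_sumr.
  rewrite [RHS]exchange_big; apply: eq_bigr => i _ /=.
  have [_ ME] := specM; rewrite (eq_qf _ ME) qf_sum; apply: eq_bigr => j _.
  by rewrite qfZ qf_rank1.
apply: ler_sum => j _; rewrite -[leRHS]mulr1 ler_wpM2l ?(spectral_ge0 specM) //.
apply: le_trans (bessel specN _) _.
by have [-> _] := specM; rewrite eqxx.
Qed.

(** The trace of [N] is the sum of the values of its form at its at most [k]
    unit eigenvectors; each of them costs at most [c] when [N] is replaced by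
    [P]. *)
Lemma trace_rank_le N P c k : (forall x y, P x y = P y x) -> psd P ->
  rank_le N k -> le_qf N (addK P (scalarK c)) -> 0 <= c ->
  \sum_x N x x <= \sum_x P x x + c * k%:R.
Proof.
move=> symP psdP rkN leN c0.
have symN x y : N x y = N y x.
  have [J [C [_ NE]]] := rkN; rewrite !NE; apply: eq_bigr => t _.
  by rewrite mulrC.
have [r [l [f [specN rN]]]] := spectral_kernel symN.
rewrite (spectral_trace specN).
apply: (@le_trans _ _ (\sum_i (qf P (f i) + c))).
  apply: ler_sum => i _; rewrite -(spectral_qf specN).
  apply: le_trans (leN _) _; rewrite qfD qf_scalarK.
  by have [-> _] := specN; rewrite eqxx mulr1.
rewrite big_split lerD ?(qf_trace_le specN) //.
rewrite sumr_const card_ord -[c *+ r]mulr_natr ler_wpM2l // ler_nat.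
exact: rN.
Qed.

End Kernels.

(** * Entrywise powers of a spectral part *)

Section Hadamard.
Context {R : rcfType} {T : finType}.
Implicit Types (g : T -> R) (M N P Q : T -> T -> R) (c : R).

(** Multiplying [Q] entrywise by the rank one kernel of [h] amounts to
    substituting [g * h] for [g] in its form. This is the Schur product theorem,
    in the form that keeps track of the individual eigenvectors. *)
Lemma qf_had_sum r (p : pred 'I_r) (l : 'I_r -> R) (f : 'I_r -> T -> R) Q g :
  qf (had (fun x y => \sum_(i | p i) l i * (f i x * f i y)) Q) g =
  \sum_(i | p i) l i * qf Q (fun x => g x * f i x).
Proof.
transitivity (\sum_(i | p i) qf (fun x y => l i * (f i x * f i y * Q x y)) g).
  rewrite -qf_sum; apply: eq_qf => x y; rewrite /had mulr_suml.
  by apply: eq_bigr => i _; ring.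
apply: eq_bigr => i _; rewrite qfZ; congr (_ * _).
by apply: eq_bigr => x _; apply: eq_bigr => y _; ring.
Qed.

Lemma rank_le_had M N a b :
  rank_le M a -> rank_le N b -> rank_le (had M N) (a * b)%N.
Proof.
move=> [J [C [Ja ME]]] [J' [C' [Jb NE]]].
exists (J * J')%type, (fun t x => C t.1 x * C' t.2 x); split.
  by rewrite card_prod leq_mul.
move=> x y; rewrite /had ME NE big_distrlr /= pair_bigA /=.
by apply: eq_bigr => t _; ring.
Qed.

Lemma rank_le_hpow M a j : rank_le M a -> rank_le (hpow M j) (a ^ j).
Proof.
move=> rkM; elim: j => [|j IH].
  exists unit, (fun _ _ => 1); split; first by rewrite card_unit.
  by move=> x y; rewrite big_const card_unit /= addr0 mulr1 /hpow expr0.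
have [J [C [Ja NE]]] := rank_le_had rkM IH.
exists J, C; split; first by rewrite expnS.
by move=> x y; rewrite -NE /hpow exprS.
Qed.

(** The part [B] of [M] on a set [p] of eigenvectors is compared with [M]
    through the kernel [Phi], the sum of the entrywise powers [M, ..., M ^+ q].
    By a recurrence between the powers, [Phi] is nearly stable under entrywise
    multiplication by [M]. *)
Section Ladder.
Variables (M : T -> T -> R) (r : nat) (l : 'I_r -> R) (f : 'I_r -> T -> R).
Hypotheses (specM : spectral M l f) (psdM : psd M).
Hypothesis symM : forall x y, M x y = M y x.
Variable p : pred 'I_r.

Definition spectral_part : T -> T -> R :=
  fun x y => \sum_(i | p i) l i * (f i x * f i y).
Local Notation B := spectral_part.

Let l0 i : 0 <= l i. Proof. exact: (spectral_ge0 specM). Qed.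

Lemma had_mono Q Q' : le_qf Q Q' -> le_qf (had B Q) (had B Q').
Proof.
move=> QQ' g; rewrite !qf_had_sum; apply: ler_sum => i _.
by rewrite ler_wpM2l // QQ'.
Qed.

Lemma had_spectral_part_le Q : psd Q -> le_qf (had B Q) (had M Q).
Proof.
move=> psdQ g; have [_ ME] := specM.
rewrite (@eq_qf _ _ (had M Q) (had (fun x y => \sum_i l i * (f i x * f i y)) Q)).
  rewrite !qf_had_sum big_mkcond; apply: ler_sum => i _.
  by case: ifP => // _; rewrite mulr_ge0 // psdQ.
by move=> x y; rewrite /had ME.
Qed.

Lemma psd_had Q : psd Q -> psd (had M Q).
Proof.
move=> psdQ g; have [_ ME] := specM.
rewrite (@eq_qf _ _ (had M Q) (had (fun x y => \sum_i l i * (f i x * f i y)) Q)).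
  by rewrite qf_had_sum; apply: sumr_ge0 => i _; rewrite mulr_ge0 // psdQ.
by move=> x y; rewrite /had ME.
Qed.

Lemma psd_had_part Q : psd Q -> psd (had B Q).
Proof.
move=> psdQ g; rewrite qf_had_sum; apply: sumr_ge0 => i _.
by rewrite mulr_ge0 // psdQ.
Qed.

Lemma psd_ones : psd (hpow M 0).
Proof.
move=> g; rewrite (@eq_qf _ _ _ (fun x y => 1 * 1)) ?qf_rank1 ?sqr_ge0 // => x y.
by rewrite /hpow expr0 mulr1.
Qed.

Lemma psd_hpow j : psd (hpow M j).
Proof.
elim: j => [|j IH]; first exact: psd_ones.
move=> g; rewrite (@eq_qf _ _ _ (had M (hpow M j))) ?psd_had // => x y.
by rewrite /had /hpow exprS.
Qed.

Lemma psd_hpow_part j : psd (hpow B j).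
Proof.
elim: j => [|j IH]; first exact: psd_ones.
move=> g; rewrite (@eq_qf _ _ _ (had B (hpow B j))) ?psd_had_part // => x y.
by rewrite /had /hpow exprS.
Qed.

(** Entrywise multiplication by a multiple of the identity sees only the
    diagonal of [Q]. *)
Lemma qf_had_scalarK k c Q g : (forall x, Q x x <= k) -> 0 <= c ->
  qf (had Q (scalarK c)) g <= qf (scalarK (k * c)) g.
Proof.
move=> Qk c0; apply: ler_sum => x _.
rewrite (bigD1 x) // [leRHS](bigD1 x) //= !big1 => [|y yx|y yx]; last first.
- by rewrite /had /scalarK eq_sym (negPf yx) !mulr0.
- by rewrite /scalarK eq_sym (negPf yx) !mulr0.
rewrite !addr0 /had /scalarK eqxx !mulr1 ler_wpM2l ?ler_wpM2r //.
by rewrite -expr2 sqr_ge0.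
Qed.

Lemma rank_le_part : rank_le B #|p|.
Proof.
exists 'I_#|p|,
  (fun t x => Num.sqrt (l (enum_val t)) * f (enum_val t) x).
split; first by rewrite card_ord.
move=> x y; rewrite /B big_enum_val; apply: eq_bigr => i _.
by rewrite -{1}[l (enum_val i)]sqr_sqrtr //; ring.
Qed.

Variables (q : nat) (cf : nat -> R) (K kap : R).
Hypothesis q0 : (0 < q)%N.
Hypothesis K1 : 1 <= K.
Hypothesis MK : forall x, M x x <= K.
Hypothesis offdiag : forall x y, x != y ->
  M x y ^+ q.+1 = \sum_(i < q) cf i * M x y ^+ i.+1.

Definition power_kernel : T -> T -> R := fun x y => \sum_(i < q) M x y ^+ i.+1.
Local Notation Phi := power_kernel.

(** The cost, in terms of [Phi], of one use of the recurrence. *)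
Definition ladder_const : R := 1 + \sum_(i < q) `|cf i|.
Local Notation L := ladder_const.

Lemma ladder_const_ge1 : 1 <= L.
Proof. by rewrite lerDl sumr_ge0. Qed.

Let M0 x : 0 <= M x x.
Proof.
have [_ ->] := specM; apply: sumr_ge0 => i _.
by rewrite mulr_ge0 // -expr2 sqr_ge0.
Qed.

Lemma psd_power_kernel : psd Phi.
Proof.
move=> g; rewrite qf_sum; apply: sumr_ge0 => i _; exact: psd_hpow.
Qed.

Lemma power_kernel_ge : le_qf M Phi.
Proof.
move=> g; rewrite qf_sum -(prednK q0) big_ord_recl /= lerDl.
by apply: sumr_ge0 => i _; exact: psd_hpow.
Qed.

(** Of the entries of [M * Phi], only the powers [q.+1] are not among those of
    [Phi], and the recurrence rewrites them, except on the diagonal, where the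
    entries of [M] may be as large as [K]: there the error is a multiple of the
    identity. *)
Lemma power_kernel_step :
  le_qf (had M Phi) (addK (fun x y => L * Phi x y) (scalarK (L * K ^+ q.+1))).
Proof.
have K0 : 0 <= K by apply: le_trans K1; rewrite ler01.
pose E x y : R := (x == y)%:R * (M x x ^+ q.+1 - \sum_(i < q) cf i * M x x ^+ i.+1).
have top x y : M x y ^+ q.+1 = \sum_(i < q) cf i * M x y ^+ i.+1 + E x y.
  rewrite /E; have [<-|xy] := eqVneq x y; first by rewrite mul1r; ring.
  by rewrite mul0r addr0 offdiag.
have hadE x y : had M Phi x y =
    addK (addK (fun x y => \sum_(i < q | (0 < i)%N) hpow M i.+1 x y)
               (fun x y => \sum_(i < q) cf i * hpow M i.+1 x y)) E x y.
  rewrite /addK /hpow -addrA -top /had /Phi mulr_sumr.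
  transitivity (\sum_(i < q) M x y ^+ i.+2).
    by apply: eq_bigr => i _; rewrite -exprS.
  rewrite -(prednK q0) big_ord_recr /= [in RHS]big_mkcond big_ord_recl /= add0r.
  by [].
have KiK i : (i <= q.+1)%N -> K ^+ i <= K ^+ q.+1 by move=> iq; rewrite ler_weXn2l.
have MiK x i : (i <= q.+1)%N -> M x x ^+ i <= K ^+ q.+1.
  by move=> iq; apply: le_trans (KiK _ iq); rewrite lerXn2r ?nnegrE.
have Ele x : E x x <= L * K ^+ q.+1.
  rewrite /E eqxx mul1r /L mulrDl mul1r; apply: lerD; first exact: MiK.
  rewrite -sumrN mulr_suml; apply: ler_sum => i _.
  apply: le_trans (ler_norm _) _; rewrite normrN normrM ler_wpM2l //.
  by rewrite normrX ger0_norm // MiK // ltnS ltnW.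
move=> g; rewrite (eq_qf _ hadE) !qfD qfZ.
apply: lerD.
  rewrite /L mulrDl mul1r !qf_sum; apply: lerD.
    rewrite big_mkcond; apply: ler_sum => i _.
    by case: ifP => _ //; exact: psd_hpow.
  rewrite mulr_suml; apply: ler_sum => i _; rewrite qfZ.
  apply: le_trans (_ : `|cf i| * qf (hpow M i.+1) g <= _).
    by rewrite ler_wpM2r ?psd_hpow // ler_norm.
  rewrite ler_wpM2l // (bigD1 i) //= lerDl.
  by apply: sumr_ge0 => j _; exact: psd_hpow.
rewrite qf_scalarK /qf /dot mulr_sumr; apply: ler_sum => x _.
rewrite (bigD1 x) //= big1 ?addr0 => [|y yx].
  by rewrite mulrC ler_wpM2r // -expr2 sqr_ge0.
by rewrite /E eq_sym (negPf yx) mul0r mulr0.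
Qed.

Hypothesis Bk : forall x, B x x <= kap.
Hypothesis Lk : L <= kap.

Let kap1 : 1 <= kap. Proof. exact: le_trans ladder_const_ge1 Lk. Qed.
Let kap0 : 0 <= kap. Proof. exact: le_trans ler01 kap1. Qed.
Let L0 : 0 <= L. Proof. exact: le_trans ler01 ladder_const_ge1. Qed.
Let K0 : 0 <= K. Proof. exact: le_trans ler01 K1. Qed.
Local Notation c1 := (L * K ^+ q.+1).
Let c10 : 0 <= c1. Proof. by rewrite mulr_ge0 // exprn_ge0. Qed.

(** [power_kernel_step] is iterated along [B <= M]. An error on the diagonal is
    multiplied by at most [kap], the bound for the diagonal of [B], at each
    step. *)
Lemma ladder j : le_qf (had (hpow B j) Phi)
  (addK (fun x y => L ^+ j * Phi x y) (scalarK (j%:R * (c1 * kap ^+ j)))).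
Proof.
elim: j => [|j IH] g.
  by rewrite qfD qf_scalarK !mul0r addr0 expr0 qfZ mul1r.
rewrite (@eq_qf _ _ _ (had B (had (hpow B j) Phi))); last first.
  by move=> x y; rewrite /had /hpow exprS mulrA.
apply: le_trans (had_mono IH g) _.
set c := j%:R * _.
have c0 : 0 <= c by rewrite !mulr_ge0 // exprn_ge0.
rewrite (@eq_qf _ _ _ (addK (fun x y => L ^+ j * had B Phi x y)
  (had B (scalarK c)))); last by move=> x y; rewrite /had /addK; ring.
rewrite !qfD !qf_scalarK !qfZ.
have h1 := had_spectral_part_le psd_power_kernel g.
have h2 := power_kernel_step g.
rewrite qfD qfZ qf_scalarK in h2.
have h3 := qf_had_scalarK g Bk c0; rewrite qf_scalarK in h3.
have := ler_wpM2l (exprn_ge0 j L0) (le_trans h1 h2).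
move/lerD => /(_ _ _ h3) /le_trans; apply.
have hL : L ^+ j * c1 <= c1 * kap ^+ j.+1.
  rewrite mulrC ler_wpM2l //; apply: le_trans (_ : kap ^+ j <= _).
    by rewrite lerXn2r ?nnegrE.
  by rewrite ler_weXn2l.
rewrite -subr_ge0 /c -natr1.
set D := dot g g; set P := qf Phi g.
have -> : L ^+ j.+1 * P + (j%:R + 1) * (c1 * kap ^+ j.+1) * D -
   (L ^+ j * (L * P + c1 * D) + kap * (j%:R * (c1 * kap ^+ j)) * D) =
   (c1 * kap ^+ j.+1 - L ^+ j * c1) * D by rewrite !exprS; ring.
by rewrite mulr_ge0 ?subr_ge0 //; exact: dot_ge0.
Qed.

(** From [B <= M <= Phi], by entrywise multiplication with powers of [B]. *)
Lemma hpow_part_ge j : le_qf (hpow B j.+1) (had (hpow B j) Phi).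
Proof.
have mono i Q Q' : le_qf Q Q' -> le_qf (had (hpow B i) Q) (had (hpow B i) Q').
  elim: i Q Q' => [|i IH] Q Q' QQ' g.
    rewrite !(@eq_qf _ _ (had (hpow B 0) _) _ g (fun x y => mul1r _)).
    exact: QQ'.
  have E P x y : had (hpow B i.+1) P x y = had (hpow B i) (had B P) x y.
    by rewrite /had /hpow exprSr mulrA.
  by rewrite !(eq_qf _ (E _)); apply: IH => h; exact: had_mono.
apply: le_qf_trans (mono j _ _ power_kernel_ge) => g.
rewrite (@eq_qf _ _ _ (had B (hpow B j))); last first.
  by move=> x y; rewrite /had /hpow exprS.
rewrite (@eq_qf _ _ (had _ M) (had M (hpow B j))); last first.
  by move=> x y; rewrite /had mulrC.
exact: had_spectral_part_le (psd_hpow_part _) g.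
Qed.

(** The power [j.+1] of [B] has rank at most [#|p| ^ j.+1], so [trace_rank_le]
    charges the errors on the diagonal only that many times. The main term grows
    like [L ^+ j], however large the diagonal of [B] may be. *)
Lemma ladder_trace j : \sum_x B x x ^+ j.+1 <=
  L ^+ j * (\sum_x Phi x x) + j%:R * (c1 * kap ^+ j) * (#|p| ^ j.+1)%:R.
Proof.
rewrite mulr_sumr.
apply: (trace_rank_le (N := hpow B j.+1) (P := fun x y => L ^+ j * Phi x y)).
- move=> x y; congr (_ * _); apply: eq_bigr => i _.
  by rewrite symM.
- by move=> g; rewrite qfZ mulr_ge0 ?exprn_ge0 //; exact: psd_power_kernel.
- exact: rank_le_hpow rank_le_part.
- exact: le_qf_trans (@hpow_part_ge j) (@ladder j).
- by rewrite mulr_ge0 // mulr_ge0 // exprn_ge0.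
Qed.

End Ladder.
End Hadamard.

(** * Small eigenvalues of a kernel with finitely many values *)

Section Window.
Context {R : rcfType}.

(** All these [x] are roots of the monic polynomial
    ['X * \prod_(v <- V) ('X - v%:P)]. *)
Lemma values_recurrence (V : seq R) : exists cf : nat -> R,
  forall x, x \in 0 :: V ->
    x ^+ (size V).+1 = \sum_(i < size V) cf i * x ^+ i.+1.
Proof.
pose p := \prod_(v <- V) ('X - v%:P).
exists (fun i => - p`_i) => x; rewrite inE => /orP[/eqP->|xV].
  rewrite expr0n /= big1 // => i _; by rewrite expr0n /= mulr0.
have : p.[x] = 0 by apply/eqP; rewrite -/(root p x) /p root_prod_XsubC.
have sp : size p = (size V).+1 by rewrite /p size_prod_XsubC.
have lp : p`_(size V) = 1.
  by have /monicP := monic_prod_XsubC V predT id; rewrite lead_coefE -/p sp.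
rewrite horner_coef sp big_ord_recr /= lp mul1r => p0.
have {}p0 : x ^+ size V = - \sum_(i < size V) p`_i * x ^+ i.
  by apply/eqP; rewrite -addr_eq0 addrC p0.
rewrite exprS p0 mulrN -mulNr mulr_sumr; apply: eq_bigr => i _.
by rewrite exprS; ring.
Qed.

(** A power function lies above its tangent at [t]. *)
Lemma tangent_exp (b t : R) j : 0 <= b -> 0 <= t ->
  t ^+ j.+1 + j.+1%:R * t ^+ j * (b - t) <= b ^+ j.+1.
Proof.
move=> b0 t0; elim: j => [|j IH]; first by rewrite !expr1 expr0; lra.
rewrite [b ^+ _]exprS; apply: le_trans (ler_wpM2l b0 IH).
rewrite -subr_ge0 -[j.+2%:R]natr1 !exprS; set s := t ^+ j; set m := j.+1%:R.
have -> : b * (t * s + m * s * (b - t)) -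
   (t * (t * s) + (m + 1) * (t * s) * (b - t)) = m * s * (b - t) ^+ 2 by ring.
apply: mulr_ge0 (sqr_ge0 _); apply: mulr_ge0; first exact: ler0n.
exact: exprn_ge0.
Qed.

Lemma power_mean (I : finType) (Y : {set I}) (b : I -> R) t j :
  (forall i, 0 <= b i) -> 0 <= t -> #|Y|%:R * t <= \sum_(i in Y) b i ->
  #|Y|%:R * t ^+ j.+1 <= \sum_(i in Y) b i ^+ j.+1.
Proof.
move=> b0 t0 tb.
apply: (@le_trans _ _ (\sum_(i in Y) (t ^+ j.+1 + j.+1%:R * t ^+ j * (b i - t)))).
  rewrite big_split /= sumr_const -mulr_sumr sumrB sumr_const.
  rewrite -[t ^+ _ *+ _]mulr_natl -[t *+ _]mulr_natl lerDl.
  by rewrite mulr_ge0 ?subr_ge0 // mulr_ge0 ?exprn_ge0.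
by apply: ler_sum => i _; exact: tangent_exp.
Qed.

Context {T : finType}.
Variables (V : seq R) (M : T -> T -> R) (K : R) (Y : {set T}).
Variables (r : nat) (l : 'I_r -> R) (f : 'I_r -> T -> R).
Hypothesis V01 : forall v, v \in V -> 0 <= v <= 1.
Hypothesis V1 : (0 < size V)%N.
Variable cf : nat -> R.
Hypothesis cfP : forall x, x \in 0 :: V ->
    x ^+ (size V).+1 = \sum_(i < size V) cf i * x ^+ i.+1.
Hypotheses (symM : forall x y, M x y = M y x) (psdM : psd M).
Hypothesis specM : spectral M l f.
Hypothesis K1 : 1 <= K.
Hypothesis MY : forall x y, ~~ ((x \in Y) && (y \in Y)) -> M x y = 0.
Hypothesis MK : forall x, M x x <= K.
Hypothesis MV : forall x y, x != y -> M x y \in 0 :: V.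

Local Notation q := (size V).
Local Notation n := (#|Y|%:R : R).
Local Notation L := (@ladder_const R q cf).

Let l0 i : 0 <= l i. Proof. exact: (spectral_ge0 specM). Qed.

Let K0 : 0 <= K. Proof. exact: le_trans ler01 K1. Qed.

Let Md x : 0 <= M x x.
Proof.
have [_ ->] := specM; apply: sumr_ge0 => i _.
by rewrite mulr_ge0 // -expr2 sqr_ge0.
Qed.

Lemma offdiag01 x y : x != y -> 0 <= M x y <= 1.
Proof.
by move=> /MV; rewrite inE => /orP[/eqP->|/V01 //]; rewrite lexx ler01.
Qed.

(** Off the diagonal the entries are at most 1, and the diagonal one is absorbed
    by [K ^+ 2 <= n]. *)
Lemma row_sq x : K ^+ 2 <= n -> \sum_y M x y ^+ 2 <= 2 * n.
Proof.
move=> Kn; rewrite (bigD1 x) //= mulrDl mul1r; apply: lerD.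
  by apply: le_trans Kn; rewrite lerXn2r ?nnegrE.
apply: (@le_trans _ _ (\sum_(y in Y) 1)); last by rewrite sumr_const.
rewrite big_mkcond [leRHS]big_mkcond; apply: ler_sum => y _ /=.
case: ifP => [yx|_]; last by case: ifP; rewrite ?ler01.
case: ifP => [_|yY]; last by rewrite MY ?yY ?andbF // expr0n.
have /andP[a b] : 0 <= M x y <= 1 by apply: offdiag01; rewrite eq_sym.
by rewrite exprn_ile1.
Qed.

Lemma trace_sq : K ^+ 2 <= n -> \sum_i l i ^+ 2 <= 2 * n ^+ 2.
Proof.
move=> Kn; rewrite -(spectral_trace2 specM symM).
apply: (@le_trans _ _ (\sum_(x in Y) 2 * n)).
  rewrite [leRHS]big_mkcond; apply: ler_sum => x _.
  case: ifP => [_|xY]; first exact: row_sq.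
  by rewrite big1 // => y _; rewrite MY ?xY // expr0n.
by rewrite sumr_const -[leLHS]mulr_natl expr2 mulrCA.
Qed.

Variable C : nat.
Hypothesis nbig : C%:R * K ^+ C <= n.
(* Here 53 (q + 1) is what the error term [K ^+ q.+1 * a ^+ 52] of [window_mass]
   amounts to, as [a] is of order [K ^+ q.+1]; [wc2] is for its constant. *)
Hypothesis wc1 : (53 * q.+1 <= C)%N.
Hypothesis wc2 : (4 * (2 * q) ^ 52 <= C)%N.

Let qC : (q <= C)%N.
Proof. by clear -wc1; lia. Qed.
Let qC53 : (q.+1 + q.+1 * 52 <= C)%N.
Proof. by clear -wc1; lia. Qed.

Let natq_ge1 : 1 <= q%:R :> R. Proof. by rewrite ler1n. Qed.

Let Kpow a : (a <= C)%N -> K ^+ a <= n.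
Proof.
move=> aC; apply: le_trans nbig; apply: le_trans (_ : K ^+ C <= _).
  by rewrite ler_weXn2l.
rewrite ler_peMl ?exprn_ge0 // ler1n; have := wc1; lia.
Qed.

Let K2n : K ^+ 2 <= n. Proof. by apply: Kpow; have := wc1; lia. Qed.
Let n1 : 1 <= n. Proof. by have := @Kpow 0; rewrite expr0; apply. Qed.
Let n0 : 0 < n. Proof. exact: lt_le_trans ltr01 n1. Qed.

(** Suppose that the eigenvalues in the window carry more, and let [B] be their
    part of [M]. Being larger than [n / w ^+ 16], they are at most [2 * w ^+ 32]
    in number and the diagonal of [B] is at most [2 * w ^+ 16]; being at most
    [n / w ^+ 8], they have a sum of at least [n * w ^+ 2]. So the mean of the
    diagonal of [B] is [w ^+ 2] or more, and the trace of the power [j.+1] grows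
    at least like [n * w ^+ (2 * j.+1)]; in [ladder_trace] the main term grows
    like [w ^+ j] only. They cross when [w ^+ j] reaches the order of [K ^+ q],
    and there the error terms are still polynomial in [K], hence dominated by
    [n]. *)
Lemma window_mass w : 2 <= w -> L <= w -> w ^+ 2 <= K ->
  \sum_(i | (n / w ^+ 16 < l i) && (l i <= n / w ^+ 8)) l i ^+ 2
    < n ^+ 2 / w ^+ 6.
Proof.
move=> w2 Lw wK; rewrite ltNge; apply/negP => mass.
pose p : pred 'I_r := fun i => (n / w ^+ 16 < l i) && (l i <= n / w ^+ 8).
pose B := spectral_part l f p.
have w1 : 1 <= w by apply: le_trans w2; rewrite ler1n.
have w0 : 0 < w by apply: lt_le_trans w1.
have w0' := ltW w0.
have wj0 j : 0 < w ^+ j by rewrite exprn_gt0.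
have wj0' j : 0 <= w ^+ j := ltW (wj0 j).
pose kap : R := 2 * w ^+ 16.
have B0 x : 0 <= B x x.
  by apply: sumr_ge0 => i _; rewrite mulr_ge0 // -expr2 sqr_ge0.
have Bk x : B x x <= kap.
  apply: (@le_trans _ _ (\sum_i (w ^+ 16 / n) * (l i ^+ 2 * (f i x * f i x)))).
    rewrite /B /spectral_part big_mkcond; apply: ler_sum => i _.
    have ff : 0 <= f i x * f i x by rewrite -expr2 sqr_ge0.
    case: ifP => [/andP[lw _]|_]; last first.
      by apply: mulr_ge0; [rewrite divr_ge0 | rewrite mulr_ge0 ?sqr_ge0].
    rewrite [leRHS]mulrA ler_wpM2r // expr2 mulrA -[leLHS]mul1r ler_wpM2r //.
    by rewrite -ler_pdivrMl ?divr_gt0 // mulr1 invf_div ltW.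
  rewrite -mulr_sumr -(spectral_sqr specM).
  have -> : \sum_z M x z * M z x = \sum_z M x z ^+ 2.
    by apply: eq_bigr => z _; rewrite expr2 [M z x]symM.
  rewrite /kap mulrAC ler_pdivrMr // mulrC.
  by apply: le_trans (ler_wpM2r (ltW (wj0 16%N)) (row_sq x K2n)) _; rewrite mulrAC.
have Lk : L <= kap.
  apply: le_trans Lw _; rewrite /kap; apply: le_trans (_ : w ^+ 16 <= _).
    by rewrite -{1}[w]expr1 ler_weXn2l.
  by rewrite ler_peMl // ler1n.
have cardp : #|p|%:R <= 2 * w ^+ 32.
  have h : #|p|%:R * (n / w ^+ 16) ^+ 2 <= 2 * n ^+ 2.
    apply: le_trans (trace_sq K2n); rewrite mulr_natl -sumr_const.
    rewrite [leLHS]big_mkcond; apply: ler_sum => i _.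
    case: ifP => [/andP[lw _]|_]; last exact: sqr_ge0.
    by rewrite lerXn2r ?nnegrE ?divr_ge0 // ltW.
  rewrite expr_div_n -exprM mulrA ler_pdivrMr // in h.
  rewrite -(ler_pM2r (exprn_gt0 2 n0)); apply: le_trans h _.
  by rewrite mulrAC.
have BY x : x \notin Y -> B x x = 0.
  move=> xY; have Mx0 : M x x = 0 by rewrite MY // (negPf xY).
  apply/eqP; rewrite eq_le B0 andbT -Mx0; have [_ ->] := specM.
  rewrite [leLHS]big_mkcond; apply: ler_sum => i _.
  by case: ifP => // _; rewrite mulr_ge0 // -expr2 sqr_ge0.
have trB : n * w ^+ 2 <= \sum_(x in Y) B x x.
  have -> : \sum_(x in Y) B x x = \sum_x B x x.
    by rewrite [LHS]big_mkcond; apply: eq_bigr => x _; case: ifPn => // /BY.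
  rewrite /B /spectral_part (spectral_partial_trace specM).
  have : n ^+ 2 / w ^+ 6 <= n / w ^+ 8 * \sum_(i | p i) l i.
    apply: le_trans mass _; rewrite mulr_sumr; apply: ler_sum => i /andP[_ li].
    by rewrite expr2 ler_wpM2r.
  rewrite -ler_pdivrMl ?divr_gt0 // invf_div.
  suff -> : w ^+ 8 / n * (n ^+ 2 / w ^+ 6) = n * w ^+ 2 by [].
  by field; rewrite !gt_eqF.
(* The first exponent at which the power of [w] beats the main term of the ladder. *)
have [j jbig jmin] : exists2 j, (2 * q%:R) * K ^+ q < w ^+ j.+1 &
    w ^+ j <= (2 * q%:R) * K ^+ q.
  have ex : exists j, (2 * q%:R) * K ^+ q < w ^+ j.
    exists #|Y|; apply: (@le_lt_trans _ _ n).
      apply: le_trans nbig; apply: ler_pM; rewrite ?mulr_ge0 ?exprn_ge0 //.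
        rewrite -natrM ler_nat; apply: leq_trans wc1.
        by rewrite leq_mul.
      by rewrite ler_weXn2l.
    apply: (@lt_le_trans _ _ (2 ^+ #|Y|)); last first.
      by rewrite lerXn2r ?nnegrE // ltW.
    by rewrite -natrX ltr_nat ltn_expl.
  case: (ex_minnP ex) => [[|j] jb jm].
    move: jb; rewrite expr0 => /lt_le_trans/(_ (_ : 1 <= 2 * q%:R * K ^+ q)).
    rewrite ltxx => H; exfalso; apply: notF; apply: H.
    apply: le_trans (_ : q%:R <= _); first by [].
    rewrite mulrAC -[leLHS]mul1r ler_wpM2r //.
    apply: le_trans (_ : 2 <= _); first by rewrite ler1n.
    by rewrite ler_peMr // exprn_ege1.
  exists j => //; rewrite leNgt; apply/negP => /jm; by rewrite ltnn.
pose a := w ^+ j.+1.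
have a1 : 1 <= a by rewrite exprn_ege1.
have a0 : 0 < a by apply: lt_le_trans a1.
have aK : a <= (2 * q%:R) * K ^+ q.+1.
  rewrite /a exprSr [K ^+ _]exprSr mulrA; apply: ler_pM => //.
  apply: le_trans wK; by rewrite ltW // -{1}[w]expr1 ltr_eXn2l //; lra.
have lad := ladder_trace specM psdM symM V1 K1 MK
  (fun x y xy => cfP (MV xy)) Bk Lk (p := p) j.
have lower : n * a ^+ 2 <= \sum_x B x x ^+ j.+1.
  have -> : \sum_x B x x ^+ j.+1 = \sum_(x in Y) B x x ^+ j.+1.
    rewrite [RHS]big_mkcond; apply: eq_bigr => x _; case: ifPn => // /BY ->.
    by rewrite expr0n.
  rewrite /a -exprM mulnC exprM; exact: power_mean.
have PhiK : \sum_x power_kernel M q x x <= n * (q%:R * K ^+ q).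
  apply: (@le_trans _ _ (\sum_(x in Y) (q%:R * K ^+ q))); last first.
    by rewrite sumr_const -[leLHS]mulr_natl.
  rewrite [leRHS]big_mkcond; apply: ler_sum => x _; case: ifPn => xY; last first.
    rewrite /power_kernel big1 // => i _; rewrite MY ?(negPf xY) //.
    by rewrite expr0n.
  apply: (@le_trans _ _ (\sum_(i < q) K ^+ q)); last first.
    by rewrite sumr_const card_ord -[leLHS]mulr_natl.
  apply: ler_sum => i _; apply: le_trans (_ : K ^+ i.+1 <= _).
    by rewrite lerXn2r ?nnegrE.
  by rewrite ler_weXn2l.
have Lj : L ^+ j <= a.
  apply: le_trans (_ : w ^+ j <= _).
    rewrite lerXn2r ?nnegrE //; apply: le_trans (@ladder_const_ge1 _ _ _) => //.
  by rewrite /a ler_weXn2l.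
have ge1 : 0 <= L by apply: le_trans (@ladder_const_ge1 _ q cf).
have first_term : L ^+ j * (\sum_x power_kernel M q x x) < n * a ^+ 2 / 2.
  apply: le_lt_trans (_ : a * (n * (q%:R * K ^+ q)) < _).
    apply: ler_pM => //; first by rewrite exprn_ge0.
    apply: sumr_ge0 => x _; apply: sumr_ge0 => i _; exact: exprn_ge0.
  have := ltr_pM2l (mulr_gt0 n0 a0); move=> /(_ (2 * q%:R * K ^+ q) a).
  rewrite jbig => /esym h; have : n * a * (2 * q%:R * K ^+ q) < n * a * a by [].
  by rewrite ltr_pdivlMr //; congr (_ < _); ring.
(* The exponent 52 is 1 + 1 + 17 + 33, for the factors [j], [L], [kap ^+ j]
   and the rank. *)
have second_term : j%:R * (L * K ^+ q.+1 * kap ^+ j) * (#|p| ^ j.+1)%:R <=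
    K ^+ q.+1 * a ^+ 52.
  have j1 : j%:R <= a.
    apply: le_trans (_ : 2 ^+ j.+1 <= _); last by rewrite lerXn2r ?nnegrE // ltW.
    by rewrite -natrX ler_nat ltnW // ltnW // ltn_expl.
  have L1 : L <= a.
    by apply: le_trans Lw _; rewrite /a -{1}[w]expr1 ler_weXn2l.
  have k1 : kap ^+ j <= a ^+ 17.
    apply: le_trans (_ : (w ^+ 17) ^+ j <= _).
      rewrite lerXn2r ?nnegrE ?mulr_ge0 ?exprn_ge0 //.
      by rewrite /kap [w ^+ 17]exprS ler_wpM2r // exprn_ge0.
    by rewrite /a -!exprM mulnC ler_weXn2l // leq_mul2r leqnSn orbT.
  have p1 : (#|p| ^ j.+1)%:R <= a ^+ 33.
    rewrite natrX; apply: le_trans (_ : (w ^+ 33) ^+ j.+1 <= _).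
      rewrite lerXn2r ?nnegrE ?exprn_ge0 //; apply: le_trans cardp _.
      by rewrite [w ^+ 33]exprS ler_wpM2r // exprn_ge0.
    by rewrite /a -!exprM mulnC.
  have -> : K ^+ q.+1 * a ^+ 52 = a * (a * K ^+ q.+1 * a ^+ 17) * a ^+ 33.
    by ring.
  have := exprn_ge0 q.+1 K0; have := exprn_ge0 j (le_trans (ltW (wj0 16%N)) _ : 0 <= kap).
  move=> kj0 Kq0.
  have {}kj0 : 0 <= kap ^+ j by rewrite exprn_ge0 // /kap mulr_ge0 ?exprn_ge0.
  apply: ler_pM => //; first by rewrite !mulr_ge0.
  by apply: ler_pM; rewrite ?mulr_ge0 //; apply: ler_pM; rewrite ?mulr_ge0 //; exact: ler_wpM2r.
have second_small : K ^+ q.+1 * a ^+ 52 <= n / 4.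
  apply: (@le_trans _ _ (K ^+ q.+1 * (2 * q%:R * K ^+ q.+1) ^+ 52)).
    rewrite ler_wpM2l ?exprn_ge0 // lerXn2r ?nnegrE //; first exact: ltW.
    by rewrite !mulr_ge0 ?exprn_ge0.
  rewrite ler_pdivlMr //; apply: le_trans nbig.
  rewrite exprMn mulrCA -exprM -exprD mulrAC; apply: ler_pM.
  - by rewrite mulr_ge0 // exprn_ge0 // mulr_ge0.
  - by rewrite exprn_ge0.
  - by rewrite -natrM -natrX -natrM ler_nat mulnC wc2.
  - by rewrite ler_weXn2l.
have na : n <= n * a ^+ 2 by rewrite ler_peMr ?exprn_ege1.
move: (le_trans lower lad) first_term second_term second_small na n0; rewrite -/kap.
set X1 := L ^+ j * _; set X2 := j%:R * _ * _; set X3 := n * a ^+ 2; set X4 := K ^+ _ * _.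
lra.
Qed.

Lemma trace_le : \sum_i l i <= n * K.
Proof.
rewrite -(spectral_trace specM).
apply: (@le_trans _ _ (\sum_(x in Y) K)).
  rewrite [leRHS]big_mkcond; apply: ler_sum => x _; case: ifPn => // xY.
  by rewrite MY // (negPf xY).
by rewrite sumr_const -[leLHS]mulr_natl.
Qed.

(** The windows at [w, w ^+ 2, w ^+ 4, ...] are adjacent, as
    [(w ^+ 2) ^+ 8 = w ^+ 16], and their masses decrease geometrically. Once
    [w ^+ 2] exceeds [K], what remains is bounded by the largest eigenvalue
    times the trace. *)
Lemma low_mass_rec N w : 2 <= w -> L <= w -> K < w ^+ (2 * 2 ^ N) ->
  \sum_(i | l i <= n / w ^+ 8) l i ^+ 2 <= 2 * n ^+ 2 / w ^+ 6.
Proof.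
elim: N w => [|N IH] w w2 Lw KN.
all: have w1 : 1 <= w by apply: le_trans w2; rewrite ler1n.
all: have w0 : 0 < w by apply: lt_le_trans w1.
all: have wj0 j : 0 < w ^+ j by rewrite exprn_gt0.
all: have n20 : 0 <= n ^+ 2 / w ^+ 6 by rewrite divr_ge0 ?exprn_ge0 ?ltW.
all: have tail : K < w ^+ 2 ->
  \sum_(i | l i <= n / w ^+ 8) l i ^+ 2 <= 2 * n ^+ 2 / w ^+ 6.
1, 3:
  move=> Kw; apply: (@le_trans _ _ (n / w ^+ 8 * (n * K)));
  [ apply: le_trans (ler_wpM2l (divr_ge0 (ltW n0) (ltW (wj0 8%N))) trace_le);
    rewrite mulr_sumr big_mkcond; apply: ler_sum => i _;
    case: ifP => [li|_];
      [by rewrite expr2 ler_wpM2r | by rewrite mulr_ge0 // divr_ge0 // ltW]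
  | apply: (@le_trans _ _ (n / w ^+ 8 * (n * w ^+ 2)));
      [ by rewrite ler_wpM2l ?divr_ge0 ?(ltW (wj0 _)) // ler_wpM2l // ltW
      | rewrite (_ : n / w ^+ 8 * (n * w ^+ 2) = n ^+ 2 / w ^+ 6);
          [by rewrite -mulrA; lra | by field; rewrite gt_eqF] ] ].
- by apply: tail; move: KN; rewrite muln1.
- have [/tail //|wK] := ltP K (w ^+ 2).
have w2w : w <= w ^+ 2 by rewrite -{1}[w]expr1 ler_weXn2l.
have := IH (w ^+ 2) (le_trans w2 w2w) (le_trans Lw w2w).
rewrite -!exprM -expnS => /(_ KN) rec.
rewrite -[(2 * 8)%N]/16%N -[(2 * 6)%N]/12%N in rec.
have win := window_mass w2 Lw wK.
rewrite (bigID (fun i => n / w ^+ 16 < l i)) /=.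
have -> : \sum_(i | (l i <= n / w ^+ 8) && (n / w ^+ 16 < l i)) l i ^+ 2 =
    \sum_(i | (n / w ^+ 16 < l i) && (l i <= n / w ^+ 8)) l i ^+ 2.
  by apply: eq_bigl => i; rewrite andbC.
have -> : \sum_(i | (l i <= n / w ^+ 8) && ~~ (n / w ^+ 16 < l i)) l i ^+ 2 =
    \sum_(i | l i <= n / w ^+ 16) l i ^+ 2.
  apply: eq_bigl => i; rewrite -leNgt andb_idl // => /le_trans; apply.
  by rewrite ler_pM2l // lef_pV2 ?posrE // ler_weXn2l.
have hh : 2 * n ^+ 2 / w ^+ 12 <= n ^+ 2 / w ^+ 6.
  rewrite -subr_ge0.
  have -> : n ^+ 2 / w ^+ 6 - 2 * n ^+ 2 / w ^+ 12 =
            n ^+ 2 / w ^+ 6 * ((w ^+ 6 - 2) / w ^+ 6).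
    by field; rewrite gt_eqF.
  rewrite mulr_ge0 // divr_ge0 ?(ltW (wj0 _)) // subr_ge0.
  by apply: le_trans w2 _; rewrite -{1}[w]expr1 ler_weXn2l.
by move: win rec hh; rewrite /= -!mulrA; lra.
Qed.

End Window.

(** The constants depend on the finite set [V] of values only, and the size
    required of the support [Y] is polynomial in [K]. *)
Theorem low_spectrum (R : rcfType) (V : seq R) :
  (forall v, v \in V -> 0 <= v <= 1) ->
  exists (w0 : R) (C : nat), [/\ 1 <= w0, (0 < C)%N &
  forall (T : finType) (M : T -> T -> R) (K : R) (Y : {set T})
    r (l : 'I_r -> R) (f : 'I_r -> T -> R),
    (forall x y, M x y = M y x) -> psd M -> spectral M l f -> 1 <= K ->
    (forall x y, ~~ ((x \in Y) && (y \in Y)) -> M x y = 0) ->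
    (forall x, M x x <= K) ->
    (forall x y, x != y -> M x y \in 0 :: V) ->
    C%:R * K ^+ C <= #|Y|%:R ->
    forall w, w0 <= w ->
    \sum_(i | l i <= #|Y|%:R / w ^+ 8) l i ^+ 2 <= 2 * #|Y|%:R ^+ 2 / w ^+ 6].
Proof.
move=> V01; pose V' := 1 :: V.
have V'01 v : v \in V' -> 0 <= v <= 1.
  by rewrite inE => /orP[/eqP->|/V01 //]; rewrite ler01 lexx.
have [cf cfP] := values_recurrence V'.
have [C wc1 wc2] : exists2 C, (53 * (size V').+1 <= C)%N &
    (4 * (2 * size V') ^ 52 <= C)%N.
  exists (53 * (size V').+1 + 4 * (2 * size V') ^ 52)%N; first exact: leq_addr.
  exact: leq_addl.
(* Adjoining 1 to [V] makes it nonempty. *)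
exists (Num.max 2 (ladder_const (size V') cf)), C; split.
- by rewrite le_max ler1n.
- by apply: leq_trans wc1; rewrite muln_gt0.
move=> T M K Y r l f symM psdM specM K1 MY MK MV nbig w.
rewrite ge_max => /andP[w2 Lw].
have w1 : 1 <= w by apply: le_trans w2; rewrite ler1n.
have MV' x y : x != y -> M x y \in 0 :: V'.
  by move=> /MV; rewrite !inE => /orP[->|->]; rewrite ?orbT.
apply: (low_mass_rec V'01 _ cfP symM psdM specM K1 MY MK MV' nbig wc1 wc2
  (N := #|Y|)) => //.
apply: (@le_lt_trans _ _ #|Y|%:R).
  apply: le_trans nbig; apply: (@le_trans _ _ (K ^+ C)).
    rewrite -{1}[K]expr1 ler_weXn2l //.
    by apply: leq_trans wc1; rewrite muln_gt0.
  rewrite ler_peMl ?exprn_ge0 ?(le_trans ler01) // ler1n.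
  by apply: leq_trans wc1; rewrite muln_gt0.
apply: (@lt_le_trans _ _ (2 ^+ #|Y|)).
  by rewrite -natrX ltr_nat ltn_expl.
apply: (@le_trans _ _ (w ^+ #|Y|)).
  by rewrite lerXn2r ?nnegrE // (le_trans ler01).
rewrite ler_weXn2l //; apply: leq_trans (ltnW (ltn_expl _ (ltnSn 1))) _.
by rewrite leq_pmull.
Qed.

(** * A subset of bounded density *)

Section Dot.
Context {R : rcfType} {I : finType}.
Implicit Types u v : I -> R.

Lemma dotC u v : dot u v = dot v u.
Proof. by apply: eq_bigr => i _; rewrite mulrC. Qed.

Lemma eq_dot u v u' v' : u =1 u' -> v =1 v' -> dot u v = dot u' v'.
Proof. by move=> uu vv; apply: eq_bigr => i _; rewrite uu vv. Qed.

Lemma dotDl u u' v : dot (fun i => u i + u' i) v = dot u v + dot u' v.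
Proof. by rewrite -big_split; apply: eq_bigr => i _ /=; rewrite mulrDl. Qed.

Lemma dotZl a u v : dot (fun i => a * u i) v = a * dot u v.
Proof. by rewrite /dot mulr_sumr; apply: eq_bigr => i _; rewrite mulrA. Qed.

Lemma dotDr u v v' : dot u (fun i => v i + v' i) = dot u v + dot u v'.
Proof. by rewrite dotC dotDl ![dot _ u]dotC. Qed.

Lemma dotZr a u v : dot u (fun i => a * v i) = a * dot u v.
Proof. by rewrite dotC dotZl dotC. Qed.

Lemma dot_suml (J : finType) (p : pred J) (F : J -> I -> R) v :
  dot (fun i => \sum_(j | p j) F j i) v = \sum_(j | p j) dot (F j) v.
Proof.
rewrite /dot exchange_big /=; apply: eq_bigr => i _; exact: mulr_suml.
Qed.

Lemma dot_sumr (J : finType) (p : pred J) (F : J -> I -> R) v :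
  dot v (fun i => \sum_(j | p j) F j i) = \sum_(j | p j) dot v (F j).
Proof. by rewrite dotC dot_suml; apply: eq_bigr => j _; rewrite dotC. Qed.

Lemma dot_comb u v t : dot (fun i => u i + t * v i) (fun i => u i + t * v i) =
  dot u u + 2 * t * dot u v + t ^+ 2 * dot v v.
Proof. by rewrite dotDl !dotDr !dotZl !dotZr [dot v u]dotC; ring. Qed.

Lemma cauchy_schwarz u v : dot u v ^+ 2 <= dot u u * dot v v.
Proof.
have [v0|v0] := eqVneq (dot v v) 0.
  have [uv|uv] := eqVneq (dot u v) 0; first by rewrite uv v0 expr0n mulr0.
  have := dot_ge0 (fun i => u i + (- (dot u u + 1) / (2 * dot u v)) * v i).
  rewrite dot_comb v0 mulr0 addr0.
  have -> : 2 * (- (dot u u + 1) / (2 * dot u v)) * dot u v = - (dot u u + 1).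
    by field.
  by rewrite opprD addrA subrr add0r ler0N1.
have vp : 0 < dot v v by rewrite lt_neqAle eq_sym v0 dot_ge0.
have := dot_ge0 (fun i => u i + (- dot u v / dot v v) * v i).
rewrite dot_comb.
have -> : dot u u + 2 * (- dot u v / dot v v) * dot u v +
   (- dot u v / dot v v) ^+ 2 * dot v v = (dot u u * dot v v - dot u v ^+ 2) / dot v v.
  by field.
by rewrite pmulr_lge0 ?invr_gt0 // subr_ge0.
Qed.

End Dot.

(** The index [t] stands for the point [pt t] of the group [G], and [phi] is a
    positive definite function on [G], with Gram vectors [X]. *)
Section Config.
Context {R : rcfType} {T I : finType} {G : zmodType}.
Variables (X : G -> I -> R) (phi : G -> R) (pt : T -> G).
Hypothesis XX : forall a b, dot (X a) (X b) = phi (a - b).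
Implicit Types Y W : {set T}.

Definition vsum Y (z : G) : I -> R := fun i => \sum_(y in Y) X (pt y + z) i.
Definition energy Y W : R := \sum_(y in Y) \sum_(w in W) phi (pt y - pt w).
Definition density Y : R := energy Y Y / #|Y|%:R ^+ 2.

Lemma phiN a : phi (- a) = phi a.
Proof.
by have := XX 0 a; rewrite dotC XX sub0r subr0 => ->.
Qed.

Lemma dot_vsum Y W z z' : dot (vsum Y z) (vsum W z') =
  \sum_(y in Y) \sum_(w in W) phi (pt y - pt w + (z - z')).
Proof.
rewrite /vsum dot_suml; apply: eq_bigr => y _; rewrite dot_sumr.
by apply: eq_bigr => w _; rewrite XX opprD addrACA.
Qed.

Lemma dot_vsum0 Y W z : dot (vsum Y z) (vsum W z) = energy Y W.
Proof.
by rewrite dot_vsum; apply: eq_bigr => y _; apply: eq_bigr => w _; rewrite subrr addr0.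
Qed.

Lemma energy_ge0 Y : 0 <= energy Y Y.
Proof. by rewrite -(dot_vsum0 _ _ 0) dot_ge0. Qed.

Lemma energy_CS Y W : energy Y W ^+ 2 <= energy Y Y * energy W W.
Proof. by rewrite -!(dot_vsum0 _ _ 0) cauchy_schwarz. Qed.

Lemma density_ge0 Y : 0 <= density Y.
Proof. by rewrite divr_ge0 ?energy_ge0 ?sqr_ge0. Qed.

Lemma energyE Y : energy Y Y = density Y * #|Y|%:R ^+ 2.
Proof.
have [->|Y0] := eqVneq Y set0; first by rewrite /energy big_set0 cards0 expr0n mulr0.
rewrite /density mulfVK // expf_neq0 // pnatr_eq0 -lt0n card_gt0 //.
Qed.

Definition kernel_on Y : T -> T -> R :=
  fun x y => if (x \in Y) && (y \in Y) then phi (pt x - pt y) else 0.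

Lemma kernel_on_sym Y x y : kernel_on Y x y = kernel_on Y y x.
Proof. by rewrite /kernel_on andbC -opprB phiN. Qed.

Lemma kernel_on_qf Y g :
  qf (kernel_on Y) g = dot (fun i => \sum_(y in Y) g y * X (pt y) i)
                           (fun i => \sum_(y in Y) g y * X (pt y) i).
Proof.
rewrite dot_suml [RHS]big_mkcond; apply: eq_bigr => x _ /=.
case: ifPn => xY; last first.
  by rewrite big1 // => y _; rewrite /kernel_on (negPf xY) mulr0.
rewrite dot_sumr [RHS]big_mkcond; apply: eq_bigr => y _ /=.
rewrite /kernel_on xY /=; case: ifP => _; last by rewrite mulr0.
by rewrite dotZl dotZr XX; ring.
Qed.

Lemma kernel_on_psd Y : psd (kernel_on Y).
Proof. by move=> g; rewrite kernel_on_qf dot_ge0. Qed.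

Lemma sum_kernel_on Y (h : R -> R) : h 0 = 0 ->
  \sum_x \sum_y h (kernel_on Y x y) =
  \sum_(x in Y) \sum_(y in Y) h (phi (pt x - pt y)).
Proof.
move=> h0; rewrite [RHS]big_mkcond; apply: eq_bigr => x _.
case: ifPn => xY; last by rewrite big1 // => y _; rewrite /kernel_on (negPf xY).
rewrite [RHS]big_mkcond; apply: eq_bigr => y _; rewrite /kernel_on xY /=.
by case: ifP.
Qed.

Variables (K : R) (V : seq R) (m : R).
Hypotheses (m0 : 0 < m) (m1 : m <= 1).
Hypothesis Vm : forall v, v \in V -> m <= v <= 1.
Hypotheses (K1 : 1 <= K) (phi0 : phi 0 <= K).
Hypothesis phiV : forall t t', t != t' -> phi (pt t - pt t') \in 0 :: V.
Hypothesis phi_m : forall t, m <= phi (pt t).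

Let K0 : 0 < K. Proof. exact: lt_le_trans ltr01 K1. Qed.

Lemma phi0_ge0 : 0 <= phi 0.
Proof. by have := dot_ge0 (X 0); rewrite XX subrr. Qed.

Lemma phi_offdiag t t' : t != t' -> 0 <= phi (pt t - pt t') <= 1.
Proof.
move=> /phiV; rewrite inE => /orP[/eqP->|/Vm /andP[a ->]]; first by rewrite lexx ler01.
by rewrite andbT (le_trans (ltW m0)).
Qed.

Lemma phi_pt_ge0 t t' : 0 <= phi (pt t - pt t').
Proof.
have [->|/phi_offdiag /andP[] //] := eqVneq t t'.
by rewrite subrr phi0_ge0.
Qed.

Lemma phi0_ge (t : T) : m <= phi 0.
Proof.
have := cauchy_schwarz (X (pt t)) (X 0); rewrite !XX !subrr subr0 -expr2.
have p0 : 0 <= phi (pt t) by rewrite (le_trans (ltW m0)).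
by rewrite ler_pXn2r ?nnegrE ?phi0_ge0 //; exact: le_trans.
Qed.

Lemma phi_sq_ge t t' : m * phi (pt t - pt t') <= phi (pt t - pt t') ^+ 2.
Proof.
have h v : v = 0 \/ m <= v -> m * v <= v ^+ 2.
  move=> [->|mv]; first by rewrite mulr0 expr0n.
  by rewrite expr2 ler_wpM2r // (le_trans (ltW m0)).
apply: h; have [->|/phiV] := eqVneq t t'; first by right; rewrite subrr phi0_ge.
by rewrite inE => /orP[/eqP->|/Vm/andP[? _]]; [left|right].
Qed.

Lemma energy_le Y : energy Y Y <= #|Y|%:R ^+ 2 + K * #|Y|%:R.
Proof.
apply: (@le_trans _ _ (\sum_(y in Y) (#|Y|%:R + K))); last first.
  by rewrite sumr_const -[leLHS]mulr_natl mulrDr expr2 mulrC [K * _]mulrC [_ * K]mulrC; lra.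
apply: ler_sum => y yY; rewrite (bigD1 y) //= subrr addrC; apply: lerD => //.
apply: (@le_trans _ _ (\sum_(w in Y | w != y) 1)).
  by apply: ler_sum => w /andP[_]; rewrite eq_sym => /phi_offdiag/andP[].
rewrite sumr_const ler_nat; apply: subset_leq_card; apply/subsetP => x.
by rewrite unfold_in /= => /andP[].
Qed.

Lemma density_le Y : (0 < #|Y|)%N -> density Y <= 1 + K / #|Y|%:R.
Proof.
move=> Y0; have n0 : 0 < #|Y|%:R :> R by rewrite ltr0n.
rewrite /density ler_pdivrMr ?exprn_gt0 //; apply: le_trans (energy_le Y) _.
rewrite mulrDl mul1r expr2 mulrA mulfVK ?gt_eqF //.
Qed.

(** By Cauchy-Schwarz between [X 0] and the sum of all [X (pt t)], since each
    inner product is [phi (pt t) >= m]. *)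
Lemma energy_setT : m ^+ 2 / K * #|T|%:R ^+ 2 <= energy [set: T] [set: T].
Proof.
have := cauchy_schwarz (X 0) (vsum [set: T] 0).
rewrite dot_vsum0 XX subrr {1}/vsum dot_sumr.
set s := \sum_(j in _) _ => sE.
have ms : m * #|T|%:R <= s.
  rewrite mulrC mulr_natl -cardsT -sumr_const; apply: ler_sum => t _.
  by rewrite XX addr0 sub0r phiN.
rewrite mulrAC ler_pdivrMr // -exprMn.
apply: le_trans (_ : s ^+ 2 <= _).
  by rewrite lerXn2r ?nnegrE ?mulr_ge0 ?(le_trans _ ms) // ?mulr_ge0 // ltW.
by apply: le_trans sE _; rewrite mulrC ler_wpM2l ?energy_ge0.
Qed.

(** Maximising the density alone would only give small sets; the factor [#|Y|]
    keeps an extremal [Y] large, while the square makes [Y] dense. *)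
Lemma extremal_set (Y0 : {set T}) : Y0 != set0 -> exists Y : {set T},
  [/\ Y != set0, density Y0 ^+ 2 * #|Y0|%:R <= density Y ^+ 2 * #|Y|%:R &
   forall W, W != set0 -> density W ^+ 2 * #|W|%:R <= density Y ^+ 2 * #|Y|%:R].
Proof.
move=> nz; pose F (Y : {set T}) := density Y ^+ 2 * #|Y|%:R.
case: (@Order.TotalTheory.arg_maxP _ _ _ Y0 (fun Y => Y != set0) F nz) => Y Yn Ymax.
exists Y; split => //; first exact: Ymax.
Qed.

(** The energy is a squared norm, and that of [a + b] falls short of
    [3 / 2 * a ^+ 2 + 3 * b ^+ 2] by half the squared norm of [a - 2 * b]. *)
Lemma set_part_energy (Y W : {set T}) : W \subset Y ->
  energy Y Y <= 3 / 2 * energy (Y :\: W) (Y :\: W) + 3 * energy W W.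
Proof.
move=> sWY.
have vE : vsum Y 0 =1 (fun i => vsum (Y :\: W) 0 i + 1 * vsum W 0 i).
  by move=> i; rewrite mul1r /vsum (big_setID W) /= (setIidPr sWY) addrC.
have := dot_ge0 (fun i => vsum (Y :\: W) 0 i + (- 2) * vsum W 0 i).
rewrite dot_comb !dot_vsum0.
rewrite -(dot_vsum0 Y Y 0) (eq_dot vE vE) dot_comb !dot_vsum0.
by lra.
Qed.

(** Points of an extremal [Y] whose row in the Gram matrix is more than twice
    the average are collected in [W]; they are few, and on the rest [Z] of [Y]
    the traces of the square and of the cube can be compared. *)
Section Extremal.
Variable Y : {set T}.
Local Notation n := (#|Y|%:R : R).
Local Notation rho := (density Y).
Hypothesis Yn0 : (0 < #|Y|)%N.
Hypothesis Yext : forall W, W != set0 -> density W ^+ 2 * #|W|%:R <= rho ^+ 2 * n.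
Hypothesis rho_ge : m ^+ 2 / K <= rho.
Hypothesis nK : 3 * K ^+ 6 <= m ^+ 3 * n.

Let n0 : 0 < n. Proof. by rewrite ltr0n. Qed.
Let rho0 : 0 < rho.
Proof. by apply: lt_le_trans rho_ge; rewrite divr_gt0 ?exprn_gt0. Qed.

Let W := [set w in Y | 2 * rho * n < energy [set w] Y].

Lemma extremal_energy (Z : {set T}) : energy Z Z ^+ 2 <= rho ^+ 2 * n * #|Z|%:R ^+ 3.
Proof.
have [->|Zn] := eqVneq Z set0.
  by rewrite cards0 expr0n mulr0 /energy big_set0 expr0n.
have := Yext Zn; move/(ler_wpM2r (_ : 0 <= #|Z|%:R ^+ 3)).
rewrite exprn_ge0 // => /(_ isT); rewrite energyE => h.
by apply: le_trans h; rewrite le_eqVlt; apply/orP; left; apply/eqP; ring.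
Qed.

(** Cauchy-Schwarz between the sums over [W] and over [Y] bounds the energy of
    [W] from below by [4 * rho * #|W| ^+ 2], more than extremality allows unless
    [W] is small. *)
Lemma card_heavy : 16 * #|W|%:R <= n.
Proof.
have [->|Wn] := eqVneq W set0; first by rewrite cards0 mulr0 ler0n.
have w0 : 0 < #|W|%:R :> R by rewrite ltr0n card_gt0.
have eWY : 2 * rho * n * #|W|%:R <= energy W Y.
  rewrite [leLHS]mulrC [leLHS]mulr_natl -sumr_const; apply: ler_sum => w.
  by rewrite inE => /andP[_ /ltW]; rewrite {1}/energy big_set1.
have h1 : (2 * rho * n * #|W|%:R) ^+ 2 <= energy W W * (rho * n ^+ 2).
  apply: le_trans (_ : energy W Y ^+ 2 <= _).
    have p : 0 <= 2 * rho * n * #|W|%:R.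
      by do 3?[apply: mulr_ge0 => //]; exact: density_ge0.
    by rewrite lerXn2r ?nnegrE // (le_trans p).
  by rewrite -energyE energy_CS.
have h2 : 4 * rho * #|W|%:R ^+ 2 <= energy W W.
  have p : 0 < rho * n ^+ 2 by rewrite mulr_gt0 ?exprn_gt0.
  rewrite -(ler_pM2r p); apply: le_trans h1.
  by rewrite le_eqVlt; apply/orP; left; apply/eqP; ring.
have h3 : (4 * rho * #|W|%:R ^+ 2) ^+ 2 <= rho ^+ 2 * n * #|W|%:R ^+ 3.
  apply: le_trans (extremal_energy W).
  rewrite lerXn2r ?nnegrE ?energy_ge0 //.
  by apply: mulr_ge0 (sqr_ge0 _); apply: mulr_ge0 => //; exact: density_ge0.
have p : 0 < rho ^+ 2 * #|W|%:R ^+ 3 by rewrite mulr_gt0 ?exprn_gt0.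
rewrite -(ler_pM2r p).
have -> : 16 * #|W|%:R * (rho ^+ 2 * #|W|%:R ^+ 3) = (4 * rho * #|W|%:R ^+ 2) ^+ 2.
  by ring.
by apply: le_trans h3 _; rewrite [leRHS]mulrCA mulrA.
Qed.

Let Z := Y :\: W.

Lemma energy_light : rho * n ^+ 2 / 2 <= energy Z Z.
Proof.
have eW : energy W W <= rho * n ^+ 2 / 64.
  have p : 0 <= rho * n ^+ 2 / 64 by rewrite divr_ge0 // mulr_ge0 ?sqr_ge0 ?ltW.
  rewrite -(@ler_pXn2r _ 2) ?nnegrE ?energy_ge0 //.
  apply: le_trans (extremal_energy W) _.
  have : #|W|%:R ^+ 3 <= (n / 16) ^+ 3.
    by rewrite lerXn2r ?nnegrE ?divr_ge0 // ler_pdivlMr // mulrC card_heavy.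
  move/(ler_wpM2l (_ : 0 <= rho ^+ 2 * n)); rewrite mulr_ge0 ?sqr_ge0 // => /(_ isT).
  move/le_trans; apply; rewrite le_eqVlt; apply/orP; left; apply/eqP; by field.
have sW : W \subset Y by apply/subsetP => t; rewrite inE => /andP[].
have := set_part_energy sW; rewrite energyE -/Z; move: eW.
have : 0 <= rho * n ^+ 2 by rewrite mulr_ge0 ?sqr_ge0 ?ltW.
by lra.
Qed.

Lemma card_light : n / 2 <= #|Z|%:R.
Proof.
have sW : W \subset Y by apply/subsetP => t; rewrite inE => /andP[].
have : #|Z|%:R = n - #|W|%:R :> R.
  by rewrite /Z cardsD (setIidPr sW) natrB // subset_leq_card.
move=> ->; have := card_heavy; have := ltW n0; lra.
Qed.

Local Notation b := (Num.sqrt rho).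

Let b0 : 0 < b. Proof. by rewrite sqrtr_gt0. Qed.
Let b2 : b ^+ 2 = rho. Proof. by rewrite sqr_sqrtr // ltW. Qed.

(** The diagonal entry at [w] of the cube of the kernel involves, apart from
    [w], only its neighbours, at which [phi] is at least [m]; as the row of [w]
    is light there are at most [2 * rho * n / m] of them, and extremality bounds
    the energy of so few points. The diagonal entries contribute the terms with
    [K], negligible by [nK]. *)
Lemma light_row w : w \in Z ->
  \sum_x \sum_y kernel_on Z w x * kernel_on Z x y * kernel_on Z y w <=
  4 * b ^+ 5 / m ^+ 2 * n ^+ 2.
Proof.
move=> wZ.
have K2n : K ^+ 2 <= n.
  have : K ^+ 2 <= 3 * K ^+ 6.
    apply: (@le_trans _ _ (K ^+ 6)); first by rewrite ler_weXn2l.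
    by rewrite ler_peMl ?exprn_ge0 ?ltW // ltr1n.
  move/le_trans/(_ nK)/le_trans; apply.
  by apply: ler_piMl (ltW n0) _; apply: exprn_ile1 => //; exact: ltW.
pose N := [set x in Z | (x != w) && (phi (pt w - pt x) != 0)].
have kge x y : 0 <= kernel_on Z x y.
  by rewrite /kernel_on; case: ifP => // _; exact: phi_pt_ge0.
(* The row of [w] is at most 1 at its neighbours and [K] at [w]. *)
pose g x : R := (x \in N)%:R + K * (x == w)%:R.
have g0 x : 0 <= g x by rewrite addr_ge0 // mulr_ge0 // ltW.
have kg x : kernel_on Z w x <= g x.
  rewrite /kernel_on wZ /=; case: ifPn => // xZ; rewrite /g /N inE xZ /=.
  have [->|xw] := eqVneq x w; first by rewrite subrr mulr1 /= add0r.
  have [->|ne] := eqVneq (phi _) 0; first by rewrite mulr0 addr0.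
  by rewrite mulr0 addr0 /=; rewrite eq_sym in xw; have /andP[] := phi_offdiag xw.
have Nb : #|N|%:R <= 2 * rho * n / m.
  rewrite ler_pdivlMr //; apply: (@le_trans _ _ (energy [set w] Y)); last first.
    have := wZ; rewrite !inE => /andP[]; rewrite negb_and => /orP[/negPf->//|].
    by rewrite -leNgt.
  rewrite [leLHS]mulr_natl -sumr_const /energy big_set1 big_mkcond [leRHS]big_mkcond.
  apply: ler_sum => x _; case: ifPn => [|_]; last first.
    by case: ifP => // _; exact: phi_pt_ge0.
  rewrite inE => /and3P[xZ xw ne]; have xY : x \in Y by move: xZ; rewrite inE => /andP[].
  rewrite xY; rewrite eq_sym in xw; have := phiV xw.
  by rewrite inE (negPf ne) => /Vm /andP[].
have eN : energy N N <= 3 * b ^+ 5 / m ^+ 2 * n ^+ 2.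
  have p : 0 <= 3 * b ^+ 5 / m ^+ 2 * n ^+ 2.
    by rewrite mulr_ge0 ?sqr_ge0 // divr_ge0 ?sqr_ge0 // mulr_ge0 // exprn_ge0 // ltW.
  rewrite -(@ler_pXn2r _ 2) ?nnegrE ?energy_ge0 //.
  apply: le_trans (extremal_energy N) _.
  have : #|N|%:R ^+ 3 <= (2 * rho * n / m) ^+ 3.
    rewrite lerXn2r ?nnegrE //; apply: divr_ge0 (ltW m0).
    by apply: mulr_ge0 => //; apply: mulr_ge0 => //; exact: ltW.
  move/(ler_wpM2l (_ : 0 <= rho ^+ 2 * n)); rewrite mulr_ge0 ?sqr_ge0 // => /(_ isT).
  move/le_trans; apply.
  have kk (p' q : R) : q ^+ 2 = p' ->
      p' ^+ 2 * n * (2 * p' * n / m) ^+ 3 = (q ^+ 5 * n ^+ 2) ^+ 2 * (8 / m ^+ 3).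
    by move=> <-; field; rewrite gt_eqF.
  rewrite (kk _ _ b2).
  have -> : (3 * b ^+ 5 / m ^+ 2 * n ^+ 2) ^+ 2 = (b ^+ 5 * n ^+ 2) ^+ 2 * (9 / m ^+ 4).
    by field; rewrite gt_eqF.
  rewrite ler_wpM2l ?sqr_ge0 // ler_pdivrMr ?exprn_gt0 //.
  have -> : 9 / m ^+ 4 * m ^+ 3 = 9 / m by field; rewrite gt_eqF.
  by rewrite ler_pdivlMr //; move: m1; lra.
have rest : 2 * K * n + K ^+ 3 <= b ^+ 5 / m ^+ 2 * n ^+ 2.
  have bK : m / K <= b.
    have mK0 : 0 <= m / K := ltW (divr_gt0 m0 K0).
    rewrite -(@ler_pXn2r _ 2) ?nnegrE ?(ltW b0) // b2; apply: le_trans rho_ge.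
    rewrite expr_div_n ler_wpM2l ?sqr_ge0 // lef_pV2 ?posrE ?exprn_gt0 //.
    by rewrite -{1}[K]expr1 ler_weXn2l.
  have b5 : (m / K) ^+ 5 <= b ^+ 5.
    by rewrite lerXn2r ?nnegrE ?(ltW b0) // (ltW (divr_gt0 m0 K0)).
  apply: (@le_trans _ _ (3 * K * n)).
    have : K * K ^+ 2 <= K * n by rewrite ler_wpM2l // ltW.
    by rewrite -exprS; lra.
  apply: (@le_trans _ _ ((m / K) ^+ 5 / m ^+ 2 * n ^+ 2)); last first.
    by rewrite ler_wpM2r ?sqr_ge0 // ler_wpM2r // invr_ge0 sqr_ge0.
  rewrite expr2 mulrA; apply: ler_wpM2r; first exact: ltW.
  have -> : (m / K) ^+ 5 / m ^+ 2 * n = m ^+ 3 * n / K ^+ 5.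
    by field; rewrite !gt_eqF.
  rewrite ler_pdivlMr ?exprn_gt0 //; apply: le_trans nK.
  by rewrite -mulrA -exprS.
apply: (@le_trans _ _ (\sum_x \sum_y g x * kernel_on Z x y * g y)).
  apply: ler_sum => x _; apply: ler_sum => y _.
  apply: ler_pM => //; first by rewrite mulr_ge0.
    by apply: ler_pM.
  by rewrite kernel_on_sym.
have -> : \sum_x \sum_y g x * kernel_on Z x y * g y =
   (\sum_x \sum_y (x \in N)%:R * (y \in N)%:R * kernel_on Z x y) +
   (2 * K * (\sum_x (x \in N)%:R * kernel_on Z x w) + K ^+ 2 * kernel_on Z w w).
  have e1 : \sum_x \sum_y g x * kernel_on Z x y * g y =
    \sum_x \sum_y (x \in N)%:R * (y \in N)%:R * kernel_on Z x y +
    (\sum_x \sum_y K * (x \in N)%:R * kernel_on Z x y * (y == w)%:R +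
    (\sum_x \sum_y K * (y \in N)%:R * kernel_on Z x y * (x == w)%:R +
     \sum_x \sum_y K ^+ 2 * kernel_on Z x y * (x == w)%:R * (y == w)%:R)).
    rewrite -!big_split; apply: eq_bigr => x _; rewrite -!big_split.
    by apply: eq_bigr => y _; rewrite /g /=; ring.
  have pick (h : T -> R) : \sum_y h y * (y == w)%:R = h w.
    rewrite (bigD1 w) //= eqxx mulr1 big1 ?addr0 // => y /negPf->; exact: mulr0.
  rewrite e1; congr (_ + _); rewrite addrA; congr (_ + _).
    pose s := \sum_x (x \in N)%:R * kernel_on Z x w; have t1 : \sum_x \sum_y K * (x \in N)%:R * kernel_on Z x y * (y == w)%:R = K * s.
      by rewrite mulr_sumr; apply: eq_bigr => x _; rewrite pick -mulrA.
    have t2 : \sum_x \sum_y K * (y \in N)%:R * kernel_on Z x y * (x == w)%:R = K * s.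
      rewrite exchange_big mulr_sumr; apply: eq_bigr => y _ /=.
      by rewrite pick -mulrA [kernel_on Z w y]kernel_on_sym.
    by rewrite t1 t2 -/s; ring.
  under eq_bigr => x _ do rewrite pick.
  by rewrite pick.
have sumN : \sum_x (x \in N)%:R * kernel_on Z x w <= n.
  apply: (@le_trans _ _ (\sum_(x in Y) 1)); last by rewrite sumr_const.
  rewrite [leRHS]big_mkcond; apply: ler_sum => x _.
  case: (boolP (x \in N)) => xN; last by rewrite mul0r; case: ifP => // _; exact: ler01.
  move: xN; rewrite inE => /and3P[xZ xw _]; have xY : x \in Y by move: xZ; rewrite inE => /andP[].
  by rewrite mul1r xY /kernel_on xZ wZ /=; have /andP[] := phi_offdiag xw.
have kww : kernel_on Z w w <= K by rewrite /kernel_on wZ /= subrr.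
have eNE : \sum_x \sum_y (x \in N)%:R * (y \in N)%:R * kernel_on Z x y = energy N N.
  rewrite /energy [RHS]big_mkcond; apply: eq_bigr => x _.
  case: (boolP (x \in N)) => xN; last by rewrite big1 // => y _; rewrite !mul0r.
  rewrite [RHS]big_mkcond; apply: eq_bigr => y _.
  case: (boolP (y \in N)) => yN; last by rewrite mulr0 mul0r.
  have sN t : t \in N -> t \in Z by rewrite inE => /andP[].
  by rewrite !mul1r /kernel_on !sN.
rewrite eNE.
have h1 := ler_wpM2l (_ : 0 <= 2 * K) sumN.
have h2 := ler_wpM2l (sqr_ge0 K) kww.
have {}h1 := h1 (mulr_ge0 (ler0n _ _) (ltW K0)).
apply: (@le_trans _ _ (energy N N + (2 * K * n + K ^+ 3))).
  by rewrite lerD2l; apply: lerD h1 _; rewrite [K ^+ 3]exprSr.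
have h3 := lerD eN rest; apply: le_trans h3 _.
by rewrite le_eqVlt; apply/orP; left; apply/eqP; field; rewrite gt_eqF.
Qed.

(** If [b = sqrt rho] is small, the bound [light_row] on the trace of the cube
    shows that the eigenvalues above [th = 16 * b ^+ 3 * n / m ^+ 3] carry at
    most half of the trace of the square, which is at least
    [m * rho * n ^+ 2 / 2]. The hypothesis on low eigenvalues, with [w ^+ 8] of
    order [b ^- 3], leaves [2 * n ^+ 2 / w ^+ 6], of order
    [b ^+ (9 / 4) * n ^+ 2], for the others: too little against [rho = b ^+ 2].
    Raising to the fourth power clears the fractional exponents. *)
Lemma extremal_density_bound (w0 beta : R) (C : nat) : 1 <= w0 ->
  (forall (Y' : {set T}) r (l : 'I_r -> R) (f : 'I_r -> T -> R),
    spectral (kernel_on Y') l f -> C%:R * K ^+ C <= #|Y'|%:R ->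
    forall w, w0 <= w -> \sum_(i | l i <= #|Y'|%:R / w ^+ 8) l i ^+ 2 <=
      2 * #|Y'|%:R ^+ 2 / w ^+ 6) ->
  2 * (C%:R * K ^+ C) <= n ->
  beta <= m ^+ 13 / 2 ^+ 27 -> beta <= m / (32 * w0 ^+ 8) -> beta <= b.
Proof.
move=> w01 LS nC beta1 beta2; rewrite leNgt; apply/negP => bbeta.
have w00 : 0 < w0 by apply: lt_le_trans w01.
have b32 : b * (32 * w0 ^+ 8) <= m.
  rewrite -ler_pdivlMr ?mulr_gt0 ?exprn_gt0 ?ltr0n //.
  by apply: le_trans beta2; exact: ltW.
(* The scale [w] for which [n / w ^+ 8] is of the order of the threshold [th]. *)
pose t := m ^+ 3 / (32 * b ^+ 3).
have t0 : 0 < t by rewrite divr_gt0 ?mulr_gt0 ?exprn_gt0 ?ltr0n.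
pose w := Num.sqrt (Num.sqrt (Num.sqrt t)).
have w8 : w ^+ 8 = t.
  rewrite (_ : 8%N = (2 * (2 * 2))%N) // exprM sqr_sqrtr ?sqrtr_ge0 //.
  by rewrite exprM sqr_sqrtr ?sqrtr_ge0 // sqr_sqrtr // ltW.
have wp : 0 < w by rewrite !sqrtr_gt0.
have w0w : w0 <= w.
  rewrite -(@ler_pXn2r _ 8) ?nnegrE ?(ltW w00) ?(ltW wp) // w8.
  rewrite ler_pdivlMr ?mulr_gt0 ?exprn_gt0 ?ltr0n //.
  apply: (@le_trans _ _ ((b * (32 * w0 ^+ 8)) ^+ 3)).
    have -> : (b * (32 * w0 ^+ 8)) ^+ 3 =
       w0 ^+ 8 * (32 * b ^+ 3) * (1024 * w0 ^+ 16) by ring.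
    rewrite ler_peMr // ?mulr_ge0 ?exprn_ge0 ?(ltW w00) ?(ltW b0) //.
    apply: (@le_trans _ _ (w0 ^+ 16)); first exact: exprn_ege1.
    by rewrite ler_peMl ?exprn_ge0 ?(ltW w00) // ler1n.
  rewrite lerXn2r ?nnegrE ?(ltW m0) //.
  by rewrite !mulr_ge0 ?exprn_ge0 ?(ltW w00) ?(ltW b0).
have [r [l [f [specM _]]]] := spectral_kernel (@kernel_on_sym Z).
have l0 i : 0 <= l i := spectral_ge0 specM i (@kernel_on_psd Z).
have cZ : #|Z|%:R <= n.
  by rewrite ler_nat subset_leq_card // subsetDl.
have low := LS Z r l f specM _ w w0w.
have {}low : \sum_(i | l i <= #|Z|%:R / w ^+ 8) l i ^+ 2 <= 2 * n ^+ 2 / w ^+ 6.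
  apply: le_trans (low _) _.
    by have := card_light; move: nC; lra.
  rewrite ler_wpM2r ?invr_ge0 ?exprn_ge0 ?(ltW wp) // ler_wpM2l //.
  by rewrite lerXn2r ?nnegrE.
have sum2 : m * (rho * n ^+ 2 / 2) <= \sum_i l i ^+ 2.
  rewrite -(spectral_trace2 specM (@kernel_on_sym Z)).
  rewrite (sum_kernel_on Z (h := fun x => x ^+ 2)) ?expr0n //.
  apply: le_trans (ler_wpM2l (ltW m0) energy_light) _.
  rewrite /energy mulr_sumr; apply: ler_sum => x _.
  by rewrite mulr_sumr; apply: ler_sum => y _; exact: phi_sq_ge.
have sum3 : \sum_i l i ^+ 3 <= n * (4 * b ^+ 5 / m ^+ 2 * n ^+ 2).
  rewrite -(spectral_trace3 specM).
  apply: (@le_trans _ _ (\sum_(x in Z) (4 * b ^+ 5 / m ^+ 2 * n ^+ 2))).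
    rewrite [leRHS]big_mkcond; apply: ler_sum => x _.
    case: ifPn => xZ; first exact: light_row.
    rewrite big1 // => y _; rewrite big1 // => z _.
    by rewrite {1}/kernel_on (negPf xZ) !mul0r.
  rewrite sumr_const -[leLHS]mulr_natl ler_wpM2r //.
  by rewrite mulr_ge0 ?sqr_ge0 // divr_ge0 ?sqr_ge0 // mulr_ge0 // exprn_ge0 // ltW.
pose th := 16 * b ^+ 3 * n / m ^+ 3.
have th0 : 0 < th by rewrite divr_gt0 ?exprn_gt0 // !mulr_gt0 ?exprn_gt0 ?ltr0n.
have thZ : th <= #|Z|%:R / w ^+ 8.
  rewrite w8 ler_pdivlMr //; apply: le_trans card_light.
  by rewrite le_eqVlt; apply/orP; left; apply/eqP; rewrite /th /t; field; rewrite !gt_eqF.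
have high : \sum_(i | ~~ (l i <= #|Z|%:R / w ^+ 8)) l i ^+ 2 <= m * rho * n ^+ 2 / 4.
  have h : \sum_(i | ~~ (l i <= #|Z|%:R / w ^+ 8)) l i ^+ 2 * th <= \sum_i l i ^+ 3.
    rewrite big_mkcond; apply: ler_sum => i _; case: ifPn => [|_]; last exact: exprn_ge0.
    rewrite -ltNge => /(le_lt_trans thZ)/ltW li.
    by rewrite [l i ^+ 3]exprSr ler_wpM2l ?sqr_ge0.
  rewrite -mulr_suml in h; rewrite -(ler_pM2r th0); apply: le_trans h _.
  apply: le_trans sum3 _; rewrite -{2}b2.
  by rewrite le_eqVlt; apply/orP; left; apply/eqP; rewrite /th; field; rewrite !gt_eqF.
have key : m * rho * n ^+ 2 / 4 <= 2 * n ^+ 2 / w ^+ 6.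
  move: sum2; rewrite (bigID (fun i => l i <= #|Z|%:R / w ^+ 8)) /=.
  by move: low high; lra.
have {}key : m * b ^+ 2 * w ^+ 6 <= 8.
  have n2 : 0 < n ^+ 2 by rewrite exprn_gt0.
  have h : m * rho * n ^+ 2 / 4 * w ^+ 6 <= 2 * n ^+ 2.
    by rewrite -ler_pdivlMr ?exprn_gt0.
  rewrite b2 -(ler_pM2r n2); move: h; lra.
have {}key : (m * b ^+ 2 * w ^+ 6) ^+ 4 <= 8 ^+ 4.
  by rewrite lerXn2r ?nnegrE // !mulr_ge0 ?exprn_ge0 ?(ltW wp) ?(ltW b0) ?(ltW m0).
have : m ^+ 13 / 2 ^+ 27 <= b.
  have bb : (m * b ^+ 2 * w ^+ 6) ^+ 4 = m ^+ 4 * b ^+ 8 * (w ^+ 8) ^+ 3 by ring.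
  move: key; rewrite bb w8 /t.
  have -> : m ^+ 4 * b ^+ 8 * (m ^+ 3 / (32 * b ^+ 3)) ^+ 3 =
     m ^+ 13 / 2 ^+ 27 / b * 8 ^+ 4 by field; rewrite gt_eqF.
  rewrite -[leRHS]mul1r ler_pM2r ?exprn_gt0 ?ltr0n //.
  by rewrite ler_pdivrMr // mul1r.
by move/(le_trans beta1)/(lt_le_trans bbeta); rewrite ltxx.
Qed.
End Extremal.

End Config.

(** The whole set has density at least [m ^+ 2 / K]. This is not bounded below,
    but it makes an extremal subset [Y] of polynomial proportion, large enough
    for [extremal_density_bound]. *)
Lemma dense_subset (R : rcfType) (V : seq R) (m : R) : 0 < m -> m <= 1 ->
  (forall v, v \in V -> m <= v <= 1) ->
  exists (c a : R) (C : nat), 0 < c /\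
  forall (T I : finType) (G : zmodType) (X : G -> I -> R) (phi : G -> R)
    (pt : T -> G) (K : R),
    (forall a b, dot (X a) (X b) = phi (a - b)) ->
    1 <= K -> phi 0 <= K ->
    (forall t t', t != t' -> phi (pt t - pt t') \in 0 :: V) ->
    (forall t, m <= phi (pt t)) ->
    a * K ^+ C <= #|T|%:R ->
    exists Y : {set T},
      c <= density phi pt Y /\ m ^+ 4 * #|T|%:R <= 4 * K ^+ 4 * #|Y|%:R.
Proof.
move=> m0 m1 Vm.
have V01 v : v \in V -> 0 <= v <= 1.
  by move=> /Vm/andP[mv ->]; rewrite (le_trans (ltW m0)).
have [w0 [C [w01 C0 LS]]] := low_spectrum V01.
pose beta := Num.min (m ^+ 13 / 2 ^+ 27) (m / (32 * w0 ^+ 8)).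
have w00 : 0 < w0 by apply: lt_le_trans w01.
have beta0 : 0 < beta.
  by rewrite lt_min !divr_gt0 ?mulr_gt0 ?exprn_gt0 ?ltr0n.
pose a := (12 + 8 * C%:R) / m ^+ 7.
exists (beta ^+ 2), a, (C + 10)%N; split; first exact: exprn_gt0.
move=> T I G X phi pt K XX K1 phi0 phiV phi_m Tbig.
have K0 : 0 < K by apply: lt_le_trans K1.
have aK : 12 + 8 * C%:R <= m ^+ 7 * a.
  by rewrite /a mulrCA mulfV ?mulr1 // gt_eqF ?exprn_gt0.
have a12 : 12 <= a.
  rewrite ler_pdivlMr ?exprn_gt0 //; apply: (@le_trans _ _ 12).
    by rewrite ler_piMr // exprn_ile1 // ltW.
  by rewrite lerDl mulr_ge0.
have T0 : (0 < #|T|)%N.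
  rewrite -(ltr_nat R); apply: lt_le_trans Tbig.
  by rewrite mulr_gt0 ?exprn_gt0 // (lt_le_trans _ a12) // ltr0n.
have Tn : [set: T] != set0 by rewrite -card_gt0 cardsT.
have [Y [Yn Yge Yext]] := extremal_set phi pt Tn.
have n0 : 0 < #|Y|%:R :> R by rewrite ltr0n card_gt0.
have N0 : 0 < #|T|%:R :> R by rewrite ltr0n.
have rT : m ^+ 2 / K <= density phi pt [set: T].
  rewrite /density ler_pdivlMr ?exprn_gt0 ?ltr0n ?cardsT //.
  exact: (energy_setT XX m0 K1 phi0 phi_m).
have r0 : 0 <= m ^+ 2 / K by rewrite divr_ge0 ?sqr_ge0 ?ltW.
have rY0 : 0 <= density phi pt Y by exact: density_ge0.
have Yge' : (m ^+ 2 / K) ^+ 2 * #|T|%:R <= density phi pt Y ^+ 2 * #|Y|%:R.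
  apply: le_trans Yge; rewrite cardsT ler_wpM2r // lerXn2r ?nnegrE //.
  exact: le_trans rT.
have YT : #|Y|%:R <= #|T|%:R :> R by rewrite ler_nat max_card.
have rY : m ^+ 2 / K <= density phi pt Y.
  rewrite -(@ler_pXn2r _ 2) ?nnegrE // -(ler_pM2r n0).
  by apply: le_trans Yge'; rewrite ler_wpM2l ?sqr_ge0.
have r2K : density phi pt Y <= 2 * K.
  apply: le_trans (density_le m0 Vm phi0 phiV _) _; first by rewrite card_gt0.
  rewrite mulrDl mul1r; apply: lerD => //.
  by rewrite ler_pdivrMr // ler_peMr ?(ltW K0) // ler1n card_gt0.
have Ybig : m ^+ 4 * #|T|%:R <= 4 * K ^+ 4 * #|Y|%:R.
  have h : density phi pt Y ^+ 2 <= (2 * K) ^+ 2.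
    by rewrite lerXn2r ?nnegrE // (le_trans rY0).
  have := le_trans Yge' (ler_wpM2r (ltW n0) h).
  rewrite expr_div_n mulrAC ler_pdivrMr ?exprn_gt0 // -exprM.
  by rewrite (_ : (2 * K) ^+ 2 * #|Y|%:R * K ^+ 2 = 4 * K ^+ 4 * #|Y|%:R) //; ring.
have nbig : m ^+ 4 * a * K ^+ (C + 6) <= 4 * #|Y|%:R.
  rewrite -(ler_pM2r (exprn_gt0 4 K0)); apply: (@le_trans _ _ (m ^+ 4 * #|T|%:R)).
    have -> : m ^+ 4 * a * K ^+ (C + 6) * K ^+ 4 = m ^+ 4 * (a * K ^+ (C + 10)).
      by rewrite -!mulrA -exprD -addnA.
    by rewrite ler_wpM2l // exprn_ge0 // ltW.
  by apply: le_trans Ybig _; rewrite le_eqVlt; apply/orP; left; apply/eqP; ring.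
have m47 : m ^+ 7 * a <= m ^+ 4 * a.
  rewrite ler_wpM2r ?(le_trans _ a12) // (_ : 7 = 4 + 3)%N // exprD.
  by rewrite ler_piMr ?exprn_ge0 ?exprn_ile1 // ltW.
exists Y; split=> //.
have LSY (Y' : {set T}) r (l : 'I_r -> R) (f : 'I_r -> T -> R) :
    spectral (kernel_on phi pt Y') l f -> C%:R * K ^+ C <= #|Y'|%:R ->
    forall w, w0 <= w -> \sum_(i | l i <= #|Y'|%:R / w ^+ 8) l i ^+ 2 <=
      2 * #|Y'|%:R ^+ 2 / w ^+ 6.
  move=> specM Y'big w w0w; apply: (LS _ (kernel_on phi pt Y') K Y' r l f) => //.
  - by move=> x y; exact: kernel_on_sym.
  - exact: kernel_on_psd.
  - by move=> x y; rewrite /kernel_on => /negPf->.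
  - by move=> x; rewrite /kernel_on subrr; case: ifP => // _; exact: ltW.
  - move=> x y xy; rewrite /kernel_on; case: ifP => _; first exact: phiV.
    by rewrite inE eqxx.
have nK : 3 * K ^+ 6 <= m ^+ 3 * #|Y|%:R.
  apply: (@le_trans _ _ (m ^+ 3 * (m ^+ 4 * a * K ^+ (C + 6)) / 4)).
    have -> : 3 * K ^+ 6 = 12 * K ^+ 6 / 4 by field.
    have -> : m ^+ 3 * (m ^+ 4 * a * K ^+ (C + 6)) = m ^+ 7 * a * K ^+ (C + 6).
      by ring.
    apply: ler_wpM2r; first by rewrite invr_ge0.
    apply: ler_pM; rewrite ?exprn_ge0 ?(ltW K0) //.
      by apply: le_trans aK; rewrite lerDl mulr_ge0.
    by rewrite ler_weXn2l // leq_addl.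
  rewrite ler_pdivrMr // -[leRHS]mulrA [_ * 4]mulrC; apply: ler_wpM2l nbig.
  exact/exprn_ge0/ltW.
have nC : 2 * (C%:R * K ^+ C) <= #|Y|%:R.
  rewrite -(@ler_pM2l _ 4) ?ltr0n //; apply: le_trans nbig.
  apply: (@le_trans _ _ ((12 + 8 * C%:R) * K ^+ C)).
    rewrite !mulrA ler_wpM2r ?exprn_ge0 ?(ltW K0) //; have : 0 <= C%:R :> R by [].
    lra.
  apply: ler_pM; rewrite ?exprn_ge0 ?(ltW K0) ?addr_ge0 ?mulr_ge0 //.
    exact: le_trans m47.
  by rewrite ler_weXn2l // leq_addr.
have bb : beta <= Num.sqrt (density phi pt Y).
  apply: (extremal_density_bound XX m0 m1 Vm K1 phi0 phiV phi_m _ Yext rY nK w01 LSY nC).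
  - by rewrite card_gt0.
  - by rewrite ge_min lexx.
  - by rewrite ge_min lexx orbT.
rewrite -[leRHS]sqr_sqrtr // lerXn2r ?nnegrE ?sqrtr_ge0 //; exact: ltW.
Qed.

(** * A subset with stable averages *)

Section Dist.
Context {R : rcfType} {I : finType}.
Implicit Types u v w : I -> R.

Definition dist2 u v : R := dot (fun i => u i - v i) (fun i => u i - v i).

Lemma dist2E u v : dist2 u v = dot u u - 2 * dot u v + dot v v.
Proof.
rewrite /dist2 (@eq_dot _ _ _ _ (fun i => u i + (-1) * v i) (fun i => u i + (-1) * v i)).
- by rewrite dot_comb; ring.
- by move=> i; rewrite mulN1r.
- by move=> i; rewrite mulN1r.
Qed.

Lemma dist2_ge0 u v : 0 <= dist2 u v. Proof. exact: dot_ge0. Qed.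

Lemma dist2C u v : dist2 u v = dist2 v u.
Proof. by rewrite !dist2E [dot v u]dotC; ring. Qed.

(** The factors 2 come with squared distances. *)
Lemma dist2_triangle u v w : dist2 u w <= 2 * dist2 u v + 2 * dist2 v w.
Proof.
rewrite /dist2 /dot !mulr_sumr -big_split; apply: ler_sum => i _ /=.
rewrite -subr_ge0.
have -> : 2 * ((u i - v i) * (u i - v i)) + 2 * ((v i - w i) * (v i - w i)) -
  (u i - w i) * (u i - w i) = (u i - 2 * v i + w i) ^+ 2 by ring.
exact: sqr_ge0.
Qed.

Lemma dot_dist2 u v w : (dot u w - dot v w) ^+ 2 <= dist2 u v * dot w w.
Proof.
have -> : dot u w - dot v w = dot (fun i => u i - v i) w.
  by rewrite /dot -sumrB; apply: eq_bigr => i _; rewrite mulrBl.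
exact: cauchy_schwarz.
Qed.

End Dist.

Section Config.
Context {R : rcfType} {T I : finType} {G : zmodType}.
Variables (X : G -> I -> R) (phi : G -> R) (pt : T -> G).
Hypothesis XX : forall a b, dot (X a) (X b) = phi (a - b).
Implicit Types Y W : {set T}.
Local Notation vsum := (vsum X pt).
Local Notation energy := (energy phi pt).
Local Notation density := (density phi pt).

Definition vavg Y (z : G) : I -> R := fun i => #|Y|%:R^-1 * vsum Y z i.

Lemma dot_vavg Y W z z' : dot (vavg Y z) (vavg W z') =
  (#|Y|%:R^-1 * #|W|%:R^-1) * dot (vsum Y z) (vsum W z').
Proof. by rewrite dotZl dotZr mulrA. Qed.

Lemma dot_vavg_self Y z : dot (vavg Y z) (vavg Y z) = density Y.
Proof. by rewrite dot_vavg (dot_vsum0 _ XX) /density -invfM -expr2 mulrC. Qed.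

Lemma dot_vavg_same Y W z : dot (vavg Y z) (vavg W z) =
  energy Y W / (#|Y|%:R * #|W|%:R).
Proof. by rewrite dot_vavg (dot_vsum0 _ XX) -invfM mulrC. Qed.

Lemma dot_vavg_shift Y W z z' s :
  dot (vavg Y (z + s)) (vavg W (z' + s)) = dot (vavg Y z) (vavg W z').
Proof.
rewrite !dot_vavg !(dot_vsum pt XX); congr (_ * _).
apply: eq_bigr => y _; apply: eq_bigr => w _.
by congr (phi (_ + _)); rewrite opprD addrACA subrr addr0.
Qed.

Lemma dist2_vavg_shift Y W z z' s :
  dist2 (vavg Y (z + s)) (vavg W (z' + s)) = dist2 (vavg Y z) (vavg W z').
Proof. by rewrite !dist2E !dot_vavg_shift. Qed.

Variables (K : R) (V : seq R) (m : R).
Hypothesis m0 : 0 < m.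
Hypothesis Vm : forall v, v \in V -> m <= v <= 1.
Hypotheses (K1 : 1 <= K) (phi0 : phi 0 <= K).
Hypothesis phiV : forall t t', t != t' -> phi (pt t - pt t') \in 0 :: V.

Local Notation kap := (2 * K).
Let K0 : 0 < K. Proof. exact: lt_le_trans ltr01 K1. Qed.
Let kap0 : 0 < kap. Proof. by rewrite mulr_gt0. Qed.
Let kap2 : 2 <= kap. Proof. by rewrite ler_peMr. Qed.
Let kap1 : 1 <= kap. Proof. by apply: le_trans kap2; rewrite ler1n. Qed.

Lemma density_le2 Y : K <= #|Y|%:R -> density Y <= 2.
Proof.
move=> KY; have Y0 : (0 < #|Y|)%N by rewrite -(ltr_nat R) (lt_le_trans K0).
apply: le_trans (density_le m0 Vm phi0 phiV Y0) _.
have : K / #|Y|%:R <= 1 by rewrite ler_pdivrMr ?mul1r ?ltr0n.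
by lra.
Qed.

Lemma row_energy_le Y W : W \subset Y -> K <= #|Y|%:R ->
  energy W Y <= #|W|%:R * (2 * #|Y|%:R).
Proof.
move=> /subsetP WY KY; rewrite mulr_natl -sumr_const; apply: ler_sum => w wW.
have wY := WY _ wW.
rewrite (bigD1 w) //= subrr mulrDl mul1r; apply: lerD; first exact: le_trans KY.
apply: (@le_trans _ _ (\sum_(t in Y | t != w) 1)).
  by apply: ler_sum => t /andP[_]; rewrite eq_sym => /(phi_offdiag m0 Vm phiV)/andP[].
rewrite sumr_const ler_nat; apply: subset_leq_card; apply/subsetP => x.
by rewrite unfold_in /= => /andP[].
Qed.

(** The exponents of [2 * K] lost after [s] passages to subsets, starting from
    [a]. *)
Fixpoint exponent_bound (b s a : nat) : nat :=
  if s is s'.+1 then exponent_bound b s' (2 * a + b)%N else a.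

Lemma exponent_bound_ge b s a : (a <= exponent_bound b s a)%N.
Proof.
elim: s a => //= s IH a; apply: leq_trans (IH _).
by rewrite mul2n -addnn -addnA leq_addr.
Qed.

(** As long as the conclusion fails, some subset [W] is denser by a factor
    [1 + eps] and not too small. A set of at least [K] points has density at
    most 2, so this happens at most [s] times. *)
Lemma increment (eps c : R) (b s a : nat) Y : 0 < eps -> 0 < c ->
  #|T|%:R <= kap ^+ a * #|Y|%:R -> c <= density Y ->
  2 < density Y * (1 + eps) ^+ s ->
  K * kap ^+ exponent_bound b s a <= #|T|%:R ->
  exists a' Y', [/\ (a' <= exponent_bound b s a)%N,
    #|T|%:R <= kap ^+ a' * #|Y'|%:R, c <= density Y' &
    forall W, W \subset Y' -> #|Y'|%:R <= kap ^+ (a' + b) * #|W|%:R ->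
      density W <= (1 + eps) * density Y'].
Proof.
move=> eps0 c0; elim: s a Y => [|s IH] a Y TY cY incr Tbig.
  have : density Y <= 2.
    apply: density_le2; rewrite -(ler_pM2r (exprn_gt0 a kap0)).
    by apply: le_trans Tbig _; rewrite mulrC.
  by rewrite expr0 mulr1 in incr; rewrite leNgt incr.
pose bad W := (W \subset Y) && (#|Y|%:R <= kap ^+ (a + b) * #|W|%:R) &&
  ((1 + eps) * density Y < density W).
have [/existsP[W /andP[/andP[WY YW] dW]]|] := boolP [exists W, bad W]; last first.
  move/existsPn => good; exists a, Y; split => //; first exact: exponent_bound_ge.
  by move=> W WY YW; have := good W; rewrite /bad WY YW /= -leNgt.
apply: (IH (2 * a + b)%N W) => //.
- apply: le_trans TY _; rewrite mul2n -addnn -addnA exprD -mulrA.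
  by rewrite ler_wpM2l // exprn_ge0 // ltW.
- apply: le_trans cY _; apply: le_trans (ltW dW).
  apply: ler_peMl; [exact: density_ge0 | move: eps0; lra].
- apply: lt_le_trans incr _; rewrite exprS mulrA [_ * (1 + eps)]mulrC.
  by apply: ler_wpM2r; [rewrite exprn_ge0 //; lra | exact: ltW].
Qed.

(** Let [B] consist of the points whose average against [Y] is below
    [(1 - d) * rho]. Removing [B] increases the density noticeably unless [B]
    has at most [d * n] points; so the rest [Z] is large. For a large subset [W]
    of [Z] the average [vavg W 0] has inner product at least [(1 - d) * rho]
    with [vavg Y 0], while both squared norms are at most
    [(1 + 2 * d ^+ 2) * rho]: the two are close. *)
Lemma homogenize (c d : R) (a b : nat) Y :
  0 < c -> 0 < d -> d <= 1 / 2 -> K <= #|Y|%:R -> c <= density Y ->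
  2 / (c * d) <= 2 ^+ b ->
  (forall W, W \subset Y -> #|Y|%:R <= kap ^+ (a + b.+1) * #|W|%:R ->
      density W <= (1 + 2 * d ^+ 2) * density Y) ->
  exists Z : {set T}, [/\ #|Y|%:R <= 2 * #|Z|%:R :> R, c <= density Z &
    forall W, W \subset Z -> #|Z|%:R <= kap ^+ (a + b) * #|W|%:R ->
      dist2 (vavg W 0) (vavg Z 0) <= 32 * d].
Proof.
move=> c0 d0 d2 KY cY bbig hom.
set rho := density Y in cY hom *; set n : R := #|Y|%:R in KY hom *.
have n0 : 0 < n by exact: lt_le_trans KY.
have rho0 : 0 < rho by exact: lt_le_trans cY.
have rho2 : rho <= 2 by exact: density_le2.
pose B := [set w in Y | energy [set w] Y < (1 - d) * rho * n].
have BY : B \subset Y by apply/subsetP => t; rewrite inE => /andP[].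
pose Z := Y :\: B; have ZY : Z \subset Y by exact: subsetDl.
set x : R := #|B|%:R; set N : R := #|Z|%:R.
have x0 : 0 <= x by []. have N0 : 0 <= N by [].
have xN : x + N = n.
  by rewrite /x /N -natrD /Z cardsD (setIidPr BY) subnKC // subset_leq_card.
have eB : energy B Y <= (1 - d) * rho * n * x.
  rewrite [leRHS]mulrC /x mulr_natl -sumr_const; apply: ler_sum => w.
  by rewrite inE => /andP[_ /ltW]; rewrite {1}/energy big_set1.
have eY : energy Y Y = rho * n ^+ 2 by exact: energyE.
have eZB : energy B Y + energy Z Y = rho * n ^+ 2.
  rewrite -eY /energy [RHS](big_setID B) /= (setIidPr BY) //.
have eZ : rho * n * (N + d * x) <= energy Z Y.
  have : rho * n * (N + d * x) = rho * n ^+ 2 - (1 - d) * rho * n * x.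
    by rewrite -xN; ring.
  by move: eB eZB; lra.
have CS := energy_CS pt XX Z Y; rewrite eY in CS.
(* By Cauchy-Schwarz, keeping the points well correlated with [Y] gains density. *)
have eZZ : rho * (N + d * x) ^+ 2 <= energy Z Z.
  have p : 0 < rho * n ^+ 2 by rewrite mulr_gt0 ?exprn_gt0.
  rewrite -(ler_pM2r p); apply: le_trans CS.
  have -> : rho * (N + d * x) ^+ 2 * (rho * n ^+ 2) = (rho * n * (N + d * x)) ^+ 2.
    by ring.
  have q : 0 <= rho * n * (N + d * x).
    by apply: mulr_ge0; [apply: mulr_ge0; exact: ltW | rewrite addr_ge0 // mulr_ge0 // ltW].
  by rewrite lerXn2r ?nnegrE // (le_trans q).
have Nbig : n <= 2 ^+ b * N.
  have h : rho * n * (d * n) <= N * (2 * n).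
    apply: le_trans (row_energy_le ZY KY); apply: le_trans eZ.
    apply: ler_wpM2l; first by apply: mulr_ge0; exact: ltW.
    rewrite -{1}xN.
    have : d * N <= 1 * N by rewrite ler_wpM2r //; lra.
    by lra.
  apply: (@le_trans _ _ (2 / (c * d) * N)); last by rewrite ler_wpM2r.
  have cd0 : 0 < c * d by rewrite mulr_gt0.
  rewrite mulrAC ler_pdivlMr // -(ler_pM2r n0) ; apply: le_trans (_ : N * (2 * n) <= _); last by lra.
  apply: le_trans h; have : c * (n * (d * n)) <= rho * (n * (d * n)).
    by rewrite ler_wpM2r // !mulr_ge0 ?(ltW n0) ?(ltW d0).
  by lra.
have kapb : 2 ^+ b <= kap ^+ b by rewrite lerXn2r ?nnegrE ?(ltW kap0).
have kmono i j : (i <= j)%N -> kap ^+ i <= kap ^+ j by move=> ij; rewrite ler_weXn2l.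
have Nbig' : n <= kap ^+ (a + b.+1) * N.
  apply: le_trans Nbig _; rewrite ler_wpM2r //; apply: le_trans kapb _.
  by apply: kmono; apply: leq_trans (leq_addl a _).
have NN : 0 < N by rewrite -(pmulr_rgt0 _ (exprn_gt0 b (ltr0n R 2))) (lt_le_trans n0).
(* As [Z] is an admissible subset, this gain is at most [2 * d ^+ 2]: few points
   were removed. *)
have xd : x <= d * n.
  have h1 := hom Z ZY Nbig'.
  have h2 : energy Z Z <= (1 + 2 * d ^+ 2) * rho * N ^+ 2.
    by rewrite (energyE phi pt Z) ler_wpM2r ?sqr_ge0.
  have h3 : rho * ((N + d * x) ^+ 2) <= rho * ((1 + 2 * d ^+ 2) * N ^+ 2).
    by apply: le_trans eZZ _; apply: le_trans h2 _; rewrite mulrA [rho * _]mulrC lexx.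
  rewrite ler_pM2l // in h3.
  have h4 : d * N * x <= d * N * (d * N).
    have := sqr_ge0 (d * x); move: h3; rewrite !expr2; lra.
  rewrite ler_pM2l ?mulr_gt0 // in h4; apply: le_trans h4 _.
  by rewrite ler_pM2l // -xN lerDr.
have N2 : n <= 2 * N.
  have : d * n <= 1 / 2 * n by rewrite ler_pM2r.
  by move: xd xN; lra.
have rZ : rho <= density Z.
  rewrite -(ler_pM2r (exprn_gt0 2 NN)) -(energyE phi pt Z); apply: le_trans eZZ.
  rewrite ler_pM2l // lerXn2r ?nnegrE ?addr_ge0 ?mulr_ge0 ?(ltW d0) //.
  by rewrite lerDl mulr_ge0 // ltW.
have near W : W \subset Z -> n <= kap ^+ (a + b.+1) * #|W|%:R ->
    dist2 (vavg W 0) (vavg Y 0) <= 8 * d.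
  move=> WZ nW.
  have w0 : 0 < #|W|%:R :> R.
    rewrite -(pmulr_rgt0 _ (exprn_gt0 (a + b.+1) kap0)); exact: lt_le_trans nW.
  have h1 := hom W (subset_trans WZ ZY) nW.
  have eWY : (1 - d) * rho * n * #|W|%:R <= energy W Y.
    rewrite [leLHS]mulrC mulr_natl -sumr_const; apply: ler_sum => w wW.
    have := subsetP WZ _ wW; rewrite !inE => /andP[nb _]; move: nb.
    rewrite negb_and (subsetP ZY _ (subsetP WZ _ wW)) /= -leNgt.
    by rewrite /energy big_set1.
  rewrite dist2E !dot_vavg_self dot_vavg_same -/rho -/n.
  have : (1 - d) * rho <= energy W Y / (#|W|%:R * n).
    rewrite ler_pdivlMr ?mulr_gt0 //; apply: le_trans eWY.
    by rewrite le_eqVlt; apply/orP; left; apply/eqP; ring.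
  have : rho * d ^+ 2 <= 2 * (1 / 2 * d).
    apply: ler_pM => //; rewrite ?(ltW rho0) ?sqr_ge0 // expr2 ler_wpM2r //.
    exact: ltW.
  have : rho * d <= 2 * d by rewrite ler_pM2r.
  by move: h1; rewrite mulrDl mul1r; lra.
exists Z; split=> //; first exact: le_trans rZ.
move=> W WZ NW.
have nW : n <= kap ^+ (a + b.+1) * #|W|%:R.
  apply: le_trans N2 _; rewrite addnS exprS -mulrA; apply: ler_pM => //.
have h1 := near W WZ nW.
have h2 := near Z (subxx _) Nbig'; rewrite dist2C in h2.
by apply: le_trans (dist2_triangle _ (vavg Y 0) _) _; lra.
Qed.

End Config.

(** * Variance on a stable subset *)

Section Variance.
Context {R : rcfType} {T I : finType} {G : zmodType}.
Variables (X : G -> I -> R) (phi : G -> R) (pt : T -> G).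
Hypothesis XX : forall a b, dot (X a) (X b) = phi (a - b).
Implicit Types Y W : {set T}.
Local Notation vsum := (vsum X pt).
Local Notation vavg := (vavg X pt).
Local Notation energy := (energy phi pt).
Local Notation density := (density phi pt).

Variables (K : R) (V : seq R) (m : R).
Hypothesis m0 : 0 < m.
Hypothesis Vm : forall v, v \in V -> m <= v <= 1.
Hypotheses (K1 : 1 <= K) (phi0 : phi 0 <= K).
Hypothesis phiV : forall t t', t != t' -> phi (pt t - pt t') \in 0 :: V.

Let K0 : 0 < K. Proof. exact: lt_le_trans ltr01 K1. Qed.

Variable Y : {set T}.
Local Notation n := (#|Y|%:R : R).
Local Notation rho := (density Y).
Local Notation u := (vavg Y 0).
Variables (g e : R).
Hypotheses (g0 : 0 < g) (e0 : 0 < e) (e1 : e <= 1).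
Hypothesis nK : K ^+ 2 <= n.
Hypothesis small : 6 / g ^+ 2 + 2 * K / (g * n) <= e ^+ 2.
Hypothesis hom : forall W, W \subset Y -> n <= g * #|W|%:R ->
  dist2 (vavg W 0) u <= e ^+ 2.

Let n0 : 0 < n. Proof. by apply: lt_le_trans nK; rewrite exprn_gt0. Qed.
Let Kn : K <= n.
Proof. by apply: le_trans nK; rewrite -{1}[K]expr1 ler_weXn2l. Qed.
Let rho2 : rho <= 2. Proof. exact: (density_le2 m0 Vm K1 phi0 phiV Kn). Qed.
Let rho0 : 0 <= rho. Proof. exact: density_ge0. Qed.
Let uu : dot u u = rho. Proof. exact: dot_vavg_self. Qed.

Definition residual (y : T) : I -> R := fun i => X (pt y) i - u i.

(** For large [W] this is the stability hypothesis; for small [W] the trivial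
    bound on the energy of [W] suffices, by [small]. *)
Lemma residual_sum W : W \subset Y ->
  dot (fun i => \sum_(y in W) residual y i) (fun i => \sum_(y in W) residual y i)
    <= (n * e) ^+ 2.
Proof.
move=> WY; set N : R := #|W|%:R.
have rE : (fun i => \sum_(y in W) residual y i) =1
    (fun i => vsum W 0 i + (- N) * u i).
  move=> i; rewrite /residual sumrB sumr_const mulNr mulr_natl; congr (_ - _).
  by apply: eq_bigr => y _; rewrite addr0.
have [nW|Wsmall] := lerP n (g * N).
  have N0 : 0 < N by rewrite -(pmulr_rgt0 _ g0) (lt_le_trans n0).
  have dE : (fun i => vsum W 0 i + (- N) * u i) =1
      (fun i => N * (vavg W 0 i - u i)).
    move=> i; rewrite mulrBr mulNr; congr (_ - _).
    by rewrite /vavg -/N mulrA mulfV ?gt_eqF // mul1r.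
  have rE' i := etrans (rE i) (dE i).
  rewrite (eq_dot rE' rE') dotZl dotZr mulrA -expr2 exprMn.
  apply: ler_pM; rewrite ?sqr_ge0 ?dist2_ge0 //; last exact: hom.
  by rewrite lerXn2r ?nnegrE // ler_nat subset_leq_card.
rewrite (eq_dot rE rE) dot_comb uu (dot_vsum0 _ XX).
have N0 : 0 <= N by [].
apply: (@le_trans _ _ (2 * energy W W + 2 * N ^+ 2 * rho)).
  have := dot_ge0 (fun i => vsum W 0 i + N * u i).
  by rewrite dot_comb uu (dot_vsum0 _ XX) sqrrN; lra.
apply: (@le_trans _ _ (6 * N ^+ 2 + 2 * K * N)).
  have := energy_le m0 Vm phi0 phiV W; rewrite -/N => h1.
  have h2 : N ^+ 2 * rho <= N ^+ 2 * 2 by rewrite ler_wpM2l ?sqr_ge0.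
  by move: h1 h2; lra.
have Nn : N <= n / g by rewrite ler_pdivlMr // mulrC ltW.
apply: (@le_trans _ _ (6 * (n / g) ^+ 2 + 2 * K * (n / g))).
  apply: lerD; apply: ler_wpM2l => //; last by rewrite mulr_ge0 // ltW.
  by rewrite lerXn2r ?nnegrE // divr_ge0 // ltW.
rewrite [leRHS]exprMn; apply: le_trans (ler_wpM2l (sqr_ge0 n) small).
rewrite le_eqVlt; apply/orP; left; apply/eqP; field; rewrite !gt_eqF //.
Qed.

(** Pair the combination [q] with itself and split the sum according to the sign
    of [dot (residual y) q]. Since the coefficients are bounded, each half is at
    most [b] times a sum of residuals against [q], to which [residual_sum]
    applies. *)
Lemma residual_comb (f : T -> R) b : 0 <= b ->
  (forall y, y \in Y -> `|f y| <= b) ->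
  dot (fun i => \sum_(y in Y) f y * residual y i)
      (fun i => \sum_(y in Y) f y * residual y i) <= 4 * b ^+ 2 * (n * e) ^+ 2.
Proof.
move=> b0 fb; set q := (fun i => \sum_(y in Y) _); set s := dot q q.
have s0 : 0 <= s by exact: dot_ge0.
pose c y := dot (residual y) q.
have sE : s = \sum_(y in Y) f y * c y.
  rewrite /s {1}/q dot_suml; apply: eq_bigr => y _; exact: dotZl.
pose P := [set y in Y | 0 <= c y]; pose N := Y :\: P.
have PY : P \subset Y by apply/subsetP => y; rewrite inE => /andP[].
have NY : N \subset Y by exact: subsetDl.
pose A := \sum_(y in P) c y; pose B := \sum_(y in N) c y.
have bound W : W \subset Y -> (\sum_(y in W) c y) ^+ 2 <= s * (n * e) ^+ 2.
  move=> WY; have -> : \sum_(y in W) c y = dot (fun i => \sum_(y in W) residual y i) q.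
    by rewrite dot_suml.
  apply: le_trans (cauchy_schwarz _ _) _; rewrite mulrC; apply: ler_wpM2l => //.
  exact: residual_sum.
have sAB : s <= b * (A - B).
  rewrite sE (big_setID P) /= (setIidPr PY) mulrBr !mulr_sumr -sumrN.
  apply: lerD; apply: ler_sum => y.
    rewrite inE => /andP[yY cy]; apply: ler_wpM2r => //.
    by apply: le_trans (fb _ yY); exact: ler_norm.
  rewrite !inE => /andP[nP yY]; move: nP; rewrite yY /= -ltNge => cy.
  rewrite -mulNr; apply: ler_wnM2r; first exact: ltW.
  by have := fb _ yY; rewrite ler_norml => /andP[].
have A2 := bound P PY; have B2 := bound N NY; rewrite -/A in A2; rewrite -/B in B2.
have s2 : s ^+ 2 <= b ^+ 2 * (4 * (s * (n * e) ^+ 2)).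
  apply: (@le_trans _ _ ((b * (A - B)) ^+ 2)).
    by rewrite lerXn2r ?nnegrE // (le_trans s0).
  rewrite exprMn; apply: ler_wpM2l; first exact: sqr_ge0.
  by have := sqr_ge0 (A + B); rewrite sqrrD sqrrB; move: A2 B2; lra.
move: s0; rewrite le_eqVlt => /orP[/eqP<-|sp].
  by apply: mulr_ge0 (sqr_ge0 _); apply: mulr_ge0 (sqr_ge0 _).
rewrite -(ler_pM2l sp) -expr2; apply: le_trans s2 _.
by rewrite le_eqVlt; apply/orP; left; apply/eqP; ring.
Qed.

Variable w : R.
Hypothesis w1 : 1 <= w.
Hypothesis LS : forall r (l : 'I_r -> R) (f : 'I_r -> T -> R),
  spectral (kernel_on phi pt Y) l f ->
  \sum_(i | l i <= n / w ^+ 8) l i ^+ 2 <= 2 * n ^+ 2 / w ^+ 6.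

Let w0 : 0 < w. Proof. exact: lt_le_trans ltr01 w1. Qed.
Let wj j : 0 < w ^+ j. Proof. by rewrite exprn_gt0. Qed.
Let wj0 j : 0 <= w ^+ j. Proof. exact: ltW. Qed.
Local Notation eta := (16 * w ^+ 16 * e).

(** The sum is that of the squares of the eigenvalues. Those below [n / w ^+ 8]
    are covered by [LS]. There are at most [2 * w ^+ 16] others, whose
    eigenvectors have entries of order [w ^+ 8 / sqrt n]; by [residual_comb] the
    combination of the vectors [X (pt y)] with these coefficients is close to
    [u] times their sum [Gs i], so that the eigenvalue, which is its squared
    norm, is at most [rho * Gs i ^+ 2 + eta * n]. By Bessel the [Gs i ^+ 2] have
    sum at most [n]. *)
Lemma second_moment :
  \sum_(x in Y) \sum_(y in Y) phi (pt x - pt y) ^+ 2 <=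
  n ^+ 2 * (rho ^+ 2 + 2 / w ^+ 6 + 4 * eta + 2 * w ^+ 16 * eta ^+ 2).
Proof.
set M := kernel_on phi pt Y.
have symM x y : M x y = M y x by exact: kernel_on_sym.
have psdM : psd M by exact: kernel_on_psd.
have V01 v : v \in V -> 0 <= v <= 1.
  by move=> /Vm/andP[mv ->]; rewrite (le_trans (ltW m0)).
have MY x y : ~~ ((x \in Y) && (y \in Y)) -> M x y = 0.
  by rewrite /M /kernel_on => /negPf->.
have MK x : M x x <= K.
  by rewrite /M /kernel_on subrr; case: ifP => // _; exact: ltW.
have MV x y : x != y -> M x y \in 0 :: V.
  by move=> xy; rewrite /M /kernel_on; case: ifP => _; [exact: phiV | rewrite inE eqxx].
have [r [l [f [specM _]]]] := spectral_kernel symM.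
have [orth _] := specM.
have l0 i : 0 <= l i := spectral_ge0 specM i psdM.
pose H : pred 'I_r := fun i => ~~ (l i <= n / w ^+ 8).
have lH i : H i -> n / w ^+ 8 < l i by rewrite /H -ltNge.
have nw0 : 0 < n / w ^+ 8 by rewrite divr_gt0.
have cardH : #|H|%:R <= 2 * w ^+ 16.
  have h : #|H|%:R * (n / w ^+ 8) ^+ 2 <= 2 * n ^+ 2.
    apply: le_trans (trace_sq V01 symM psdM specM K1 MY MK MV nK).
    rewrite [leLHS]mulr_natl -sumr_const [leLHS]big_mkcond; apply: ler_sum => i _.
    case: ifP => [/lH li|_]; last exact: sqr_ge0.
    by rewrite lerXn2r ?nnegrE // ltW.
  rewrite -(ler_pM2r (exprn_gt0 2 nw0)); apply: le_trans h _.
  by rewrite le_eqVlt; apply/orP; left; apply/eqP; field; rewrite gt_eqF.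
pose Gs i := \sum_(y in Y) f i y.
pose one y : R := (y \in Y)%:R.
have GsE i : Gs i = dot (f i) one.
  rewrite /Gs /dot big_mkcond; apply: eq_bigr => y _; rewrite /one.
  by case: ifP; rewrite ?mulr1 ?mulr0.
have Gsum : \sum_i Gs i ^+ 2 <= n.
  under eq_bigr => i _ do rewrite GsE.
  apply: le_trans (bessel specM one) _; rewrite /dot.
  rewrite -sumr_const [leRHS]big_mkcond; apply: ler_sum => y _ /=.
  by rewrite /one; case: ifP; rewrite ?mulr1 ?mulr0.
have Gn i : Gs i ^+ 2 <= n.
  apply: le_trans Gsum; rewrite (bigD1 i) //= lerDl.
  by apply: sumr_ge0 => j _; exact: sqr_ge0.
have fsup i : H i -> forall y, y \in Y -> `|f i y| <= Num.sqrt (2 * w ^+ 16 / n).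
  move=> /lH li y _; have li0 : 0 < l i by exact: lt_trans li.
  have h : (l i * f i y) ^+ 2 <= 2 * n.
    rewrite -(spectral_eigen specM).
    apply: le_trans (cauchy_schwarz (M y) (f i)) _.
    rewrite orth eqxx mulr1; apply: le_trans (row_sq V01 psdM specM K1 MY MK MV y nK).
    by apply: ler_sum => z _; rewrite expr2.
  rewrite -sqrtr_sqr ler_wsqrtr // ler_pdivlMr //.
  rewrite -(ler_pM2l (exprn_gt0 2 nw0)).
  apply: (@le_trans _ _ ((l i * f i y) ^+ 2 * n)).
    rewrite [leLHS]mulrA; apply: ler_wpM2r; first exact: ltW.
    rewrite [leRHS]exprMn; apply: ler_wpM2r; first exact: sqr_ge0.
    by rewrite lerXn2r ?nnegrE ?(ltW nw0) // ltW.
  apply: le_trans (ler_wpM2r (ltW n0) h) _.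
  by rewrite le_eqVlt; apply/orP; left; apply/eqP; field; rewrite gt_eqF.
have lam i : H i -> l i <= rho * Gs i ^+ 2 + eta * n.
  move=> Hi; have fb := fsup i Hi.
  have b0 : 0 <= 2 * w ^+ 16 / n by rewrite divr_ge0 ?mulr_ge0 ?exprn_ge0 // ltW.
  have := residual_comb (sqrtr_ge0 _) fb; rewrite sqr_sqrtr //.
  set q := (fun i0 => \sum_(y in Y) _) => qq.
  have {}qq : dot q q <= 8 * w ^+ 16 * n * e ^+ 2.
    apply: le_trans qq _.
    by rewrite le_eqVlt; apply/orP; left; apply/eqP; field; rewrite gt_eqF.
  have xE : (fun j => \sum_(y in Y) f i y * X (pt y) j) =1 (fun j => q j + Gs i * u j).
    move=> j; rewrite /q /Gs mulr_suml -big_split; apply: eq_bigr => y _ /=.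
    by rewrite /residual; ring.
  rewrite -(spectral_qf specM) (kernel_on_qf pt XX) (eq_dot xE xE) dot_comb uu.
  (* The deviation [q] enters linearly here, whence [eta] of order [e]. *)
  have cross : Gs i * dot q u <= 4 * w ^+ 8 * n * e.
    have p : 0 <= 4 * w ^+ 8 * n * e.
      by apply: mulr_ge0 (ltW e0); apply: mulr_ge0 => //; exact: mulr_ge0.
    apply: le_trans (ler_norm _) _; rewrite -(@ler_pXn2r _ 2) ?nnegrE //.
    rewrite real_normK ?num_real // exprMn.
    apply: (@le_trans _ _ (n * (8 * w ^+ 16 * n * e ^+ 2 * 2))).
      apply: ler_pM; rewrite ?sqr_ge0 //; apply: le_trans (cauchy_schwarz _ _) _.
      by rewrite uu; apply: ler_pM => //; exact: dot_ge0.
    by rewrite le_eqVlt; apply/orP; left; apply/eqP; ring.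
  have w816 : w ^+ 8 * (n * e) <= w ^+ 16 * (n * e).
    by rewrite ler_wpM2r ?mulr_ge0 ?(ltW e0) // ler_weXn2l.
  have ee : w ^+ 16 * n * e ^+ 2 <= w ^+ 16 * n * e.
    apply: ler_wpM2l; first exact: mulr_ge0.
    by rewrite expr2 -[leRHS]mulr1 ler_wpM2l // ltW.
  by move: qq cross w816 ee; lra.
rewrite -(sum_kernel_on phi pt Y (h := fun x => x ^+ 2)) ?expr0n //.
rewrite (spectral_trace2 specM symM) (bigID (fun i => l i <= n / w ^+ 8)) /=.
have eta0 : 0 <= eta by apply: mulr_ge0 (ltW e0); exact: mulr_ge0.
have high : \sum_(i | H i) l i ^+ 2 <=
    n ^+ 2 * (rho ^+ 2 + 4 * eta + 2 * w ^+ 16 * eta ^+ 2).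
  apply: (@le_trans _ _ (\sum_(i | H i)
     ((rho ^+ 2 * n + 2 * rho * eta * n) * Gs i ^+ 2 + eta ^+ 2 * n ^+ 2))).
    apply: ler_sum => i Hi; apply: (@le_trans _ _ ((rho * Gs i ^+ 2 + eta * n) ^+ 2)).
      have li := lam i Hi; rewrite lerXn2r ?nnegrE //; exact: le_trans (l0 i) li.
    have : rho ^+ 2 * (Gs i ^+ 2 * Gs i ^+ 2) <= rho ^+ 2 * (n * Gs i ^+ 2).
      by rewrite ler_wpM2l ?sqr_ge0 // ler_wpM2r ?sqr_ge0.
    by lra.
  rewrite big_split sumr_const /= -mulr_sumr -[_ *+ #|H|]mulr_natl.
  have h1 : #|H|%:R * (eta ^+ 2 * n ^+ 2) <= 2 * w ^+ 16 * (eta ^+ 2 * n ^+ 2).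
    by rewrite ler_wpM2r // mulr_ge0 ?sqr_ge0.
  have h2 : (rho ^+ 2 * n + 2 * rho * eta * n) * (\sum_(i | H i) Gs i ^+ 2) <=
            (rho ^+ 2 * n + 2 * rho * eta * n) * n.
    apply: ler_wpM2l; first apply: addr_ge0.
    - by apply: mulr_ge0; rewrite ?sqr_ge0.
    - by apply: mulr_ge0 => //; apply: mulr_ge0 => //; exact: mulr_ge0.
    apply: le_trans Gsum; rewrite big_mkcond; apply: ler_sum => i _.
    by case: ifP => // _; exact: sqr_ge0.
  have h3 : rho * (eta * n ^+ 2) <= 2 * (eta * n ^+ 2).
    by rewrite ler_wpM2r // mulr_ge0 ?sqr_ge0.
  by move: h1 h2 h3; lra.
have := LS specM; rewrite -/H; move: high.
by lra.
Qed.

End Variance.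

(** * Walking along a popular difference *)

Section Tensor.
Context {R : rcfType} {I : finType}.
Implicit Types u v : I -> R.

(** Gram vectors for the square of a positive definite function. *)
Definition tensor_sq u : I * I -> R := fun p => u p.1 * u p.2.

Lemma dot_tensor_sq u v : dot (tensor_sq u) (tensor_sq v) = dot u v ^+ 2.
Proof.
rewrite expr2 /dot big_distrlr /= pair_bigA /=; apply: eq_bigr => p _.
by rewrite /tensor_sq; ring.
Qed.

End Tensor.

Section Walk.
Context {R : rcfType} {T I : finType} {G : zmodType}.
Variables (X : G -> I -> R) (phi : G -> R) (pt : T -> G).
Hypothesis XX : forall a b, dot (X a) (X b) = phi (a - b).
Implicit Types Y W : {set T}.
Local Notation vsum := (vsum X pt).
Local Notation vavg := (vavg X pt).
Local Notation energy := (energy phi pt).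
Local Notation density := (density phi pt).

(** Let [P s] be the average of the tensor squares of the translated vectors,
    and [Q s] the tensor square of their average. The hypothesis says that [P 0]
    is close to [Q 0]; by invariance [P z] is as close to [Q z]. So the inner
    product of [P z] and [P 0] is close to that of [Q z] and [Q 0]. *)
Lemma moment_transfer Y z v : (0 < #|Y|)%N -> density Y <= 2 -> 0 <= v -> v <= 1 ->
  \sum_(x in Y) \sum_(y in Y) phi (pt x - pt y) ^+ 2 <=
    #|Y|%:R ^+ 2 * (density Y ^+ 2 + v) ->
  (#|Y|%:R ^- 2 * (\sum_(x in Y) \sum_(y in Y) phi (pt x - pt y + z) ^+ 2) -
    dot (vavg Y z) (vavg Y 0) ^+ 2) ^+ 2 <= 18 * v.
Proof.
move=> Y0 rho2 v0 v1; set n : R := #|Y|%:R; set rho := density Y => sq.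
have n0 : 0 < n by rewrite ltr0n.
have rho0 : 0 <= rho by exact: density_ge0.
pose P s : I * I -> R := fun p => n^-1 * \sum_(y in Y) tensor_sq (X (pt y + s)) p.
pose Q s := tensor_sq (vavg Y s).
have PP s s' : dot (P s) (P s') =
    n ^- 2 * \sum_(x in Y) \sum_(y in Y) phi (pt x - pt y + (s - s')) ^+ 2.
  rewrite dotZl dotZr mulrA -expr2 exprVn; congr (_ * _).
  rewrite dot_suml; apply: eq_bigr => x _; rewrite dot_sumr; apply: eq_bigr => y _.
  by rewrite dot_tensor_sq XX opprD addrACA.
have QQ s s' : dot (Q s) (Q s') = dot (vavg Y s) (vavg Y s') ^+ 2.
  exact: dot_tensor_sq.
have Pself s : dot (P s) (P s) <= rho ^+ 2 + v.
  rewrite PP subrr mulrC ler_pdivrMr ?exprn_gt0 // [leRHS]mulrC.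
  apply: le_trans sq; rewrite le_eqVlt; apply/orP; left; apply/eqP.
  by apply: eq_bigr => x _; apply: eq_bigr => y _; rewrite addr0.
have Qself s : dot (Q s) (Q s) = rho ^+ 2 by rewrite QQ (dot_vavg_self pt XX).
(* By convexity: the mean of the [a y] is [rho]. *)
have PQ s : rho ^+ 2 <= dot (P s) (Q s).
  pose a y := dot (X (pt y + s)) (vavg Y s).
  have -> : dot (P s) (Q s) = n^-1 * \sum_(y in Y) a y ^+ 2.
    rewrite dotZl dot_suml; congr (_ * _); apply: eq_bigr => y _.
    exact: dot_tensor_sq.
  have suma : \sum_(y in Y) a y = n * rho.
    rewrite /rho -(dot_vavg_self pt XX Y s) dotZl mulrA mulfV ?gt_eqF // mul1r.
    by rewrite dot_suml.
  have : 0 <= \sum_(y in Y) (a y - rho) ^+ 2.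
    by apply: sumr_ge0 => y _; exact: sqr_ge0.
  have -> : \sum_(y in Y) (a y - rho) ^+ 2 =
      \sum_(y in Y) a y ^+ 2 - 2 * rho * (\sum_(y in Y) a y) + n * rho ^+ 2.
    rewrite mulr_sumr -sumrB /n [X in _ + X]mulr_natl -sumr_const -big_split.
    by apply: eq_bigr => y _ /=; ring.
  rewrite suma => h; rewrite ler_pdivlMl //; move: h; lra.
have near s : dist2 (P s) (Q s) <= v.
  by rewrite dist2E Qself; have := PQ s; have := Pself s; lra.
have D1 := dot_dist2 (P z) (Q z) (P 0).
have D2 := dot_dist2 (P 0) (Q 0) (Q z).
rewrite [dot (P 0) (Q z)]dotC [dot (Q 0) (Q z)]dotC in D2.
have -> : n ^- 2 * (\sum_(x in Y) \sum_(y in Y) phi (pt x - pt y + z) ^+ 2) =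
    dot (P z) (P 0) by rewrite PP subr0.
rewrite -QQ.
have h1 : dist2 (P z) (Q z) * dot (P 0) (P 0) <= v * (rho ^+ 2 + v).
  by apply: ler_pM; rewrite ?dist2_ge0 ?dot_ge0.
have h2 : dist2 (P 0) (Q 0) * dot (Q z) (Q z) <= v * rho ^+ 2.
  by rewrite Qself; apply: ler_pM; rewrite ?dist2_ge0 ?sqr_ge0.
have r4 : v * rho ^+ 2 <= v * 4.
  apply: ler_wpM2l => //; rewrite (_ : 4 = 2 ^+ 2 :> R); last by ring.
  by rewrite lerXn2r ?nnegrE.
have vv : v * v <= v * 1 by rewrite ler_wpM2l.
set A := dot (P z) (P 0) in D1 *; set B := dot (Q z) (P 0) in D1 D2 *.
set C := dot (Q z) (Q 0) in D2 *.
have : (A - C) ^+ 2 <= 2 * (A - B) ^+ 2 + 2 * (B - C) ^+ 2.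
  rewrite -subr_ge0; have -> : 2 * (A - B) ^+ 2 + 2 * (B - C) ^+ 2 - (A - C) ^+ 2 =
    (A - 2 * B + C) ^+ 2 by ring.
  exact: sqr_ge0.
by move: D1 D2 h1 h2 r4 vv; lra.
Qed.

Variables (K : R) (V : seq R) (m : R).
Hypothesis pt_inj : injective pt.
Hypotheses (m0 : 0 < m) (m1 : m <= 1).
Hypothesis Vm : forall v, v \in V -> m <= v <= 1.
Hypotheses (K1 : 1 <= K) (phi0 : phi 0 <= K).
Hypothesis phiV : forall t t', t != t' -> phi (pt t - pt t') \in 0 :: V.
Hypothesis phi_diff : forall t t', t != t' -> phi (pt t - pt t') != 0 ->
  exists s, pt s = pt t - pt t'.

Let K0 : 0 < K. Proof. exact: lt_le_trans ltr01 K1. Qed.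

(** The number of points of [Y] that stay in [Y] under translation by
    [pt t' - pt t]. *)
Definition matches Y (t t' : T) : R :=
  \sum_(y in Y) \sum_(y' in Y) (pt y - pt t == pt y' - pt t')%:R.

(** By [phi_diff], the pairs of points of [Y] at whose difference [phi] does not
    vanish have their differences among the points [pt s]. There are at least
    [c / 2 * n ^+ 2] such pairs and at most [g * n] differences, so by
    Cauchy-Schwarz there are many coincidences [y - t = y' - t']. Those with
    [t = t'] number [n ^+ 2] only, and some other pair [t, t'] accounts for many
    of them. *)
Lemma popular_translate Y (c g h : R) : 0 < c -> c <= density Y ->
  0 < g -> 0 < h -> 2 * K <= c * #|Y|%:R ->
  #|T|%:R <= g * #|Y|%:R -> 8 / c ^+ 2 <= h -> 8 * g / c ^+ 2 < #|Y|%:R ->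
  exists t t', [/\ t \in Y, t' \in Y, t != t' &
    #|Y|%:R <= g * h * matches Y t t'].
Proof.
set n : R := #|Y|%:R => c0 cY g0 h0 nK Tg hc ng.
have n0 : 0 < n by apply: lt_trans ng; rewrite divr_gt0 ?mulr_gt0 ?exprn_gt0 ?ltr0n.
pose good t t' := [&& t \in Y, t' \in Y, t != t' & n <= g * h * matches Y t t'].
have [/existsP[t /existsP[t' /and4P[? ? ? ?]]]|/existsPn none] :=
  boolP [exists t, [exists t', good t t']]; first by exists t, t'.
exfalso.
have few t t' : t \in Y -> t' \in Y -> t != t' -> matches Y t t' <= n / (g * h).
  move=> tY t'Y tt'; have /existsPn/(_ t') := none t.
  rewrite /good tY t'Y tt' /= -ltNge => /ltW.
  by rewrite ler_pdivlMr ?mulr_gt0 // mulrC.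
have diag t : matches Y t t = n.
  rewrite /matches /n -sumr_const; apply: eq_bigr => y yY.
  rewrite (bigD1 y) //= eqxx big1 ?addr0 // => y' /andP[_ y'y].
  by rewrite (inj_eq (addIr _)) (inj_eq pt_inj) eq_sym (negPf y'y).
have total : \sum_(t in Y) \sum_(t' in Y) matches Y t t' <= n ^+ 2 + n ^+ 3 / (g * h).
  apply: (@le_trans _ _ (\sum_(t in Y) (n + n * (n / (g * h))))); last first.
    rewrite sumr_const -[leLHS]mulr_natl -/n.
    by rewrite le_eqVlt; apply/orP; left; apply/eqP; field; rewrite !gt_eqF.
  apply: ler_sum => t tY; rewrite (bigD1 t) //= diag lerD2l.
  apply: (@le_trans _ _ (\sum_(t' in Y | t' != t) (n / (g * h)))).
    by apply: ler_sum => t' /andP[t'Y]; rewrite eq_sym; exact: few.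
  rewrite sumr_const -[leLHS]mulr_natl; apply: ler_wpM2r.
    by apply: divr_ge0 (ltW n0) _; apply: mulr_ge0; exact: ltW.
  rewrite ler_nat; apply: subset_leq_card; apply/subsetP => x.
  by rewrite unfold_in /= => /andP[].
(* The number of representations of [pt s] as a difference of [Y]. *)
pose rep s : R := \sum_(y in Y) \sum_(t in Y) (pt y - pt t == pt s)%:R.
have rep_sum : c / 2 * n ^+ 2 <= \sum_s rep s.
  have h1 : energy Y Y <= K * n + \sum_s rep s.
    have -> : \sum_s rep s = \sum_(y in Y) \sum_(t in Y) \sum_s (pt y - pt t == pt s)%:R.
      rewrite exchange_big /=; apply: eq_bigr => y _; exact: exchange_big.
    rewrite [K * n]mulrC mulr_natl -sumr_const -big_split; apply: ler_sum => y yY /=.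
    rewrite (bigD1 y) //= subrr; apply: lerD => //.
    rewrite [leRHS](bigD1 y) //= -[leLHS]add0r; apply: lerD.
      by apply: sumr_ge0.
    apply: ler_sum => t /andP[tY]; rewrite eq_sym => yt.
    have [->|ne] := eqVneq (phi (pt y - pt t)) 0; first exact: sumr_ge0.
    have [s sE] := phi_diff yt ne.
    rewrite (bigD1 s) //= sE eqxx; apply: (@le_trans _ _ 1).
      by have /andP[] := phi_offdiag m0 Vm phiV yt.
    by rewrite lerDl sumr_ge0.
  rewrite (energyE phi pt) -/n in h1.
  have h2 : c * n ^+ 2 <= density Y * n ^+ 2 by rewrite ler_wpM2r ?sqr_ge0.
  have h3 : 2 * K * n <= c * n * n by rewrite ler_wpM2r // ltW.
  by move: h1 h2 h3; lra.
have rep_sq : \sum_s rep s ^+ 2 <= \sum_(t in Y) \sum_(t' in Y) matches Y t t'.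
  have -> : \sum_(t in Y) \sum_(t' in Y) matches Y t t' =
     \sum_(y in Y) \sum_(t in Y) \sum_(y' in Y) \sum_(t' in Y)
       (pt y - pt t == pt y' - pt t')%:R.
    rewrite [RHS]exchange_big /=; apply: eq_bigr => t _.
    rewrite /matches exchange_big /=; apply: eq_bigr => y _; exact: exchange_big.
  have -> : \sum_s rep s ^+ 2 = \sum_(y in Y) \sum_(t in Y) \sum_(y' in Y)
     \sum_(t' in Y) \sum_s (pt y - pt t == pt s)%:R * (pt y' - pt t' == pt s)%:R.
    transitivity (\sum_s \sum_(y in Y) \sum_(t in Y) \sum_(y' in Y) \sum_(t' in Y)
       (pt y - pt t == pt s)%:R * (pt y' - pt t' == pt s)%:R : R).
      apply: eq_bigr => s _; rewrite expr2 {1}/rep mulr_suml; apply: eq_bigr => y _.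
      rewrite mulr_suml; apply: eq_bigr => t _; rewrite /rep mulr_sumr.
      by apply: eq_bigr => y' _; rewrite mulr_sumr.
    rewrite exchange_big /=; apply: eq_bigr => y _.
    rewrite exchange_big /=; apply: eq_bigr => t _.
    rewrite exchange_big /=; apply: eq_bigr => y' _; exact: exchange_big.
  apply: ler_sum => y _; apply: ler_sum => t _; apply: ler_sum => y' _.
  apply: ler_sum => t' _.
  have [s /eqP sE|none'] := pickP (fun s => pt y - pt t == pt s); last first.
    by rewrite big1 // => s _; rewrite none' mul0r.
  rewrite (bigD1 s) //= sE eqxx mul1r [pt s == _]eq_sym big1 ?addr0 // => s' s's.
  by rewrite (inj_eq pt_inj) eq_sym (negPf s's) mul0r.
have CS : (\sum_s rep s) ^+ 2 <= #|T|%:R * \sum_s rep s ^+ 2.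
  have := cauchy_schwarz (fun _ : T => 1) rep.
  have -> : dot (fun _ : T => 1) rep = \sum_s rep s :> R.
    by apply: eq_bigr => s _; rewrite mul1r.
  have -> : dot (fun _ : T => 1 : R) (fun=> 1) = #|T|%:R.
    by rewrite /dot -sumr_const; apply: eq_bigr => s _; rewrite mulr1.
  suff -> : dot rep rep = \sum_s rep s ^+ 2 by [].
  by apply: eq_bigr => s _; rewrite expr2.
have Q0 : 0 <= \sum_s rep s ^+ 2 by apply: sumr_ge0 => s _; exact: sqr_ge0.
have h1 : (c / 2 * n ^+ 2) ^+ 2 <= g * n * (n ^+ 2 + n ^+ 3 / (g * h)).
  apply: (@le_trans _ _ ((\sum_s rep s) ^+ 2)).
    have p : 0 <= c / 2 * n ^+ 2 by rewrite mulr_ge0 ?sqr_ge0 // divr_ge0 // ltW.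
    by rewrite lerXn2r ?nnegrE // (le_trans p).
  apply: le_trans CS _; apply: ler_pM => //.
  exact: le_trans rep_sq total.
have h2 : g * n * (n ^+ 2 + n ^+ 3 / (g * h)) = g * n ^+ 3 + n ^+ 4 / h.
  by field; rewrite !gt_eqF.
rewrite h2 in h1.
have h3 : n ^+ 4 / h <= n ^+ 4 * (c ^+ 2 / 8).
  rewrite ler_wpM2l ?exprn_ge0 ?(ltW n0) // -[c ^+ 2 / 8]invf_div.
  by rewrite lef_pV2 ?posrE // divr_gt0 ?exprn_gt0.
have h4 : c ^+ 2 / 8 * n ^+ 4 <= g * n ^+ 3 by move: h1 h3; lra.
have n3 : 0 < n ^+ 3 by rewrite exprn_gt0.
have : c ^+ 2 / 8 * n <= g.
  by rewrite -(ler_pM2r n3); move: h4; lra.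
rewrite -ler_pdivlMl ?divr_gt0 ?exprn_gt0 // invf_div => h5.
by have := lt_le_trans ng h5; rewrite mulrAC ltxx.
Qed.

(** [W] and [W'] are the sets of the [y] and of the [y'] with [y - t = y' - t']
    for some partner in [Y]; each determines the other, as [pt] is injective. *)
Lemma matches_sets Y t t' : exists W W' : {set T}, [/\ W \subset Y, W' \subset Y,
  #|W|%:R = matches Y t t', #|W'|%:R = matches Y t t' &
  forall z i, vsum W' z i = vsum W (z - (pt t - pt t')) i].
Proof.
pose rel y y' := pt y - pt t == pt y' - pt t'.
pose W := [set y in Y | [exists y', (y' \in Y) && rel y y']].
pose W' := [set y' in Y | [exists y, (y \in Y) && rel y y']].
have uniq1 y (F : T -> R) : y \in Y ->
    \sum_(y' in Y) (rel y y')%:R * F y = (y \in W)%:R * F y.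
  move=> yY; rewrite inE yY /=; case: (boolP [exists y', _]) => [/existsP[y' /andP[y'Y ry]]|/existsPn no].
    rewrite (bigD1 y') //= ry big1 ?addr0 // => z /andP[zY zy'].
    suff -> : rel y z = false by rewrite mul0r.
    apply/negP => /eqP rz; move: ry zy'; rewrite /rel rz (inj_eq (addIr _)).
    by rewrite (inj_eq pt_inj) => ->.
  rewrite mul0r big1 // => y' y'Y; have := no y'; rewrite y'Y /= => /negPf->.
  by rewrite mul0r.
have uniq2 y' (F : T -> R) : y' \in Y ->
    \sum_(y in Y) (rel y y')%:R * F y' = (y' \in W')%:R * F y'.
  move=> yY; rewrite inE yY /=; case: (boolP [exists y, _]) => [/existsP[y /andP[y'Y ry]]|/existsPn no].
    rewrite (bigD1 y) //= ry big1 ?addr0 // => z /andP[zY zy'].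
    suff -> : rel z y' = false by rewrite mul0r.
    apply/negP => /eqP rz; move: ry zy'; rewrite /rel -rz (inj_eq (addIr _)).
    by rewrite (inj_eq pt_inj) eq_sym => ->.
  rewrite mul0r big1 // => y y'Y; have := no y; rewrite y'Y /= => /negPf->.
  by rewrite mul0r.
have sW (F : T -> R) : \sum_(y in W) F y = \sum_(y in Y) \sum_(y' in Y) (rel y y')%:R * F y.
  rewrite big_mkcond [RHS]big_mkcond; apply: eq_bigr => y _.
  case: ifPn => yW; last first.
    case: ifP => // yY; by rewrite uniq1 // (negPf yW) mul0r.
  have yY : y \in Y by move: yW; rewrite inE => /andP[].
  by rewrite yY uniq1 // yW mul1r.
have sW' (F : T -> R) : \sum_(y in W') F y = \sum_(y in Y) \sum_(y' in Y) (rel y y')%:R * F y'.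
  rewrite [RHS]exchange_big /= big_mkcond [RHS]big_mkcond; apply: eq_bigr => y _.
  case: ifPn => yW; last first.
    case: ifP => // yY; by rewrite uniq2 // (negPf yW) mul0r.
  have yY : y \in Y by move: yW; rewrite inE => /andP[].
  by rewrite yY uniq2 // yW mul1r.
exists W, W'; split.
- by apply/subsetP => y; rewrite inE => /andP[].
- by apply/subsetP => y; rewrite inE => /andP[].
- rewrite -sumr_const sW; apply: eq_bigr => y _; apply: eq_bigr => y' _.
  by rewrite mulr1.
- rewrite -sumr_const sW'; apply: eq_bigr => y _; apply: eq_bigr => y' _.
  by rewrite mulr1.
- move=> z i; rewrite /vsum sW sW'; apply: eq_bigr => y _; apply: eq_bigr => y' _.
  case: (boolP (rel y y')) => [/eqP ry|]; last by rewrite !mul0r.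
  congr (_ * X _ i); have -> : pt y' = pt y - pt t + pt t' by rewrite ry subrK.
  by rewrite opprB -!addrA; congr (_ + _); rewrite addrCA [RHS]addrC -addrA.
Qed.

Hypothesis phi_gap : forall a, phi a = 0 \/ m <= phi a.

(** Let [x = pt t - pt t'] and let [psi k] be the mean of [phi] over the
    differences of [Y] translated by [x *+ k]. The sets of [matches_sets] are
    large, so their averages are both close to [vavg Y 0], and they are
    translates of each other by [x]: so [vavg Y 0] is hardly moved by [x], and
    [psi] has small increments. On the other hand [psi] cannot take a value in
    [[t0 / 2, t0]], because the mean of [phi ^+ 2] would then be close to
    [psi ^+ 2 <= t0 * psi], while it is at least [m * psi >= 4 * t0 * psi].
    Starting at the density of [Y], [psi] remains above [t0]. *)
Lemma walk_homogeneous Y (c g e t0 v : R) t t' :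
  K <= #|Y|%:R -> c <= density Y ->
  (forall W, W \subset Y -> #|Y|%:R <= g * #|W|%:R ->
     dist2 (vavg W 0) (vavg Y 0) <= e ^+ 2) ->
  \sum_(x in Y) \sum_(y in Y) phi (pt x - pt y) ^+ 2 <=
    #|Y|%:R ^+ 2 * (density Y ^+ 2 + v) ->
  #|Y|%:R <= g * matches Y t t' ->
  0 < t0 -> 4 * t0 <= m -> 4 * t0 <= c -> 0 <= v -> 18 * v < t0 ^+ 4 ->
  32 * e ^+ 2 <= t0 ^+ 2 ->
  forall k, exists y y', phi ((pt t - pt t') *+ k + (pt y - pt y')) != 0.
Proof.
set n : R := #|Y|%:R; set rho := density Y.
move=> Kn cY hom sq nm t00 t0m t0c v0 vt et.
have n0 : 0 < n by exact: lt_le_trans Kn.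
have rho2 : rho <= 2 by exact: (density_le2 m0 Vm K1 phi0 phiV Kn).
have rho0 : 0 <= rho by exact: density_ge0.
have t01 : t0 <= 1 / 4 by move: t0m m1; lra.
have v1 : v <= 1.
  have : t0 ^+ 4 <= 1 by rewrite exprn_ile1 ?(ltW t00) //; move: t01; lra.
  by move: vt v0; lra.
pose x := pt t - pt t'; pose u := vavg Y 0.
have [W [W' [WY W'Y Wc W'c shift]]] := matches_sets Y t t'.
have avgE : vavg W' 0 =1 vavg W (- x).
  by move=> i; rewrite /vavg Wc W'c shift sub0r.
have dW := hom W WY; rewrite Wc in dW.
have dW' := hom W' W'Y; rewrite W'c in dW'.
have close : dist2 (vavg Y (- x)) u <= 4 * e ^+ 2.
  apply: le_trans (dist2_triangle _ (vavg W (- x)) _) _.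
  have -> : dist2 (vavg Y (- x)) (vavg W (- x)) = dist2 u (vavg W 0).
    by rewrite -[- x]add0r (dist2_vavg_shift pt XX).
  have -> : dist2 (vavg W (- x)) u = dist2 (vavg W' 0) u.
    by apply: eq_dot => i; rewrite avgE.
  by rewrite [dist2 u _]dist2C; have := dW nm; have := dW' nm; lra.
pose psi k := dot (vavg Y (- (x *+ k))) u.
have psi0 : psi 0%N = rho by rewrite /psi mulr0n oppr0 (dot_vavg_self pt XX).
have step k : (psi k.+1 - psi k) ^+ 2 <= t0 ^+ 2 / 4.
  apply: le_trans (dot_dist2 _ _ _) _.
  have -> : dist2 (vavg Y (- (x *+ k.+1))) (vavg Y (- (x *+ k))) = dist2 (vavg Y (- x)) u.
    rewrite mulrS opprD -[- (x *+ k) in X in dist2 _ X]add0r.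
    exact: (dist2_vavg_shift pt XX).
  have : dist2 (vavg Y (- x)) u * dot u u <= 4 * e ^+ 2 * 2.
    apply: ler_pM => //; rewrite ?dist2_ge0 ?dot_ge0 //.
    by rewrite (dot_vavg_self pt XX).
  by move: et; lra.
have never k : t0 < psi k.
  elim: k => [|k IH]; first by rewrite psi0; move: t0c cY t00; lra.
  rewrite ltNge; apply/negP => low.
  (* One step cannot cross the interval from [t0 / 2] to [t0]. *)
  have half : t0 / 2 <= psi k.+1.
    have sk := step k; rewrite leNgt; apply/negP => lt.
    have : t0 ^+ 2 / 4 < (psi k - psi k.+1) ^+ 2.
      have -> : t0 ^+ 2 / 4 = (t0 / 2) ^+ 2 by field.
      have p : t0 / 2 < psi k - psi k.+1 by move: lt IH; lra.
      have q : 0 < t0 / 2 by rewrite divr_gt0.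
      by rewrite ltr_pXn2r ?nnegrE ?(ltW q) // ltW // (lt_trans q).
    by rewrite -[psi k - _]opprB sqrrN ltNge sk.
  have Y0 : (0 < #|Y|)%N by rewrite -(ltr_nat R).
  have tr := moment_transfer (- (x *+ k.+1)) Y0 rho2 v0 v1 sq.
  rewrite -/(psi k.+1) -/n in tr.
  set S := n ^- 2 * _ in tr.
  have mS : m * psi k.+1 <= S.
    rewrite /psi dot_vavg (dot_vsum pt XX) subr0 -/n -invfM -expr2 mulrCA.
    rewrite ler_wpM2l ?invr_ge0 ?sqr_ge0 // mulr_sumr; apply: ler_sum => y _.
    rewrite mulr_sumr; apply: ler_sum => y' _.
    case: (phi_gap (pt y - pt y' - x *+ k.+1)) => [->|h].
      by rewrite mulr0 expr0n.
    by rewrite expr2 ler_wpM2r // (le_trans (ltW m0)).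
  have D : t0 ^+ 2 <= S - psi k.+1 ^+ 2.
    have : psi k.+1 * psi k.+1 <= t0 * psi k.+1.
      by rewrite ler_wpM2r //; move: half t00; lra.
    have : 3 * t0 * (t0 / 2) <= 3 * t0 * psi k.+1.
      by rewrite ler_wpM2l // mulr_ge0 // ltW.
    have : 4 * t0 * psi k.+1 <= m * psi k.+1.
      by rewrite ler_wpM2r //; move: half t00; lra.
    by move: mS (sqr_ge0 t0); rewrite !expr2; lra.
  have : (t0 ^+ 2) ^+ 2 <= (S - psi k.+1 ^+ 2) ^+ 2.
    by rewrite lerXn2r ?nnegrE ?sqr_ge0 // (le_trans _ D) ?sqr_ge0.
  rewrite -exprM => h; have := le_trans h tr.
  by rewrite leNgt vt.
move=> k.
have [/existsP[y /existsP[y' h]]|/existsPn none] :=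
  boolP [exists y, exists y', phi (x *+ k + (pt y - pt y')) != 0].
  by exists y, y'.
exfalso; have := never k; rewrite ltNge => /negP; apply.
rewrite /psi dot_vavg (dot_vsum pt XX) subr0 big1 ?mulr0 ?(ltW t00) // => y _.
rewrite big1 // => y' _; have /existsPn/(_ y)/negPn/eqP := none y'.
by rewrite -(phiN XX) opprD opprB addrC.
Qed.

End Walk.

From mathcomp Require Import finmap.
From mathcomp Require Import all_classical all_reals.

(** * Choice of the constants *)

Lemma pow2_ge (R : realType) (x : R) : exists b : nat, x <= 2 ^+ b.
Proof.
exists (Num.bound x); apply: ltW; exact: upper_nthrootP.
Qed.

Lemma exp_unbounded (R : realType) (x y : R) : 0 < x -> exists s : nat, y < (1 + x) ^+ s.
Proof.
move=> x0; have bern s : 1 + s%:R * x <= (1 + x) ^+ s.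
  elim: s => [|s IH]; first by rewrite mul0r addr0 expr0.
  rewrite exprS; apply: le_trans (ler_wpM2l _ IH); last by move: x0; lra.
  rewrite -natr1 -subr_ge0.
  have -> : (1 + x) * (1 + s%:R * x) - (1 + (s%:R + 1) * x) = s%:R * x ^+ 2 by ring.
  by rewrite mulr_ge0 ?sqr_ge0.
exists (Num.bound `|y / x|); apply: lt_le_trans (bern _).
have : y / x < (Num.bound `|y / x|)%:R.
  by apply: le_lt_trans (ler_norm _) _; exact: archi_boundP.
by rewrite ltr_pdivrMr //; move: x0; lra.
Qed.

(** The context of the next proof is large; facts needed are put in the goal. *)
Ltac clra := clear; lra.

(** Everything above is uniform in [K], apart from the requirement that sets
    have at least a fixed power of [K] elements, and the passages to subsets
    cost fixed powers of [2 * K]. *)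
Theorem bounded_walk (R : realType) (V : seq R) (m : R) : 0 < m -> m <= 1 ->
  (forall v, v \in V -> m <= v <= 1) ->
  exists (a : R) (C : nat), 0 < a /\
  forall (T I : finType) (G : zmodType) (X : G -> I -> R) (phi : G -> R)
    (pt : T -> G) (K : R),
    (forall a b, dot (X a) (X b) = phi (a - b)) ->
    injective pt -> 1 <= K -> phi 0 <= K ->
    (forall t t', t != t' -> phi (pt t - pt t') \in 0 :: V) ->
    (forall t t', t != t' -> phi (pt t - pt t') != 0 ->
      exists s, pt s = pt t - pt t') ->
    (forall t, m <= phi (pt t)) ->
    (forall b, phi b = 0 \/ m <= phi b) ->
    a * K ^+ C <= #|T|%:R ->
    exists t t', t != t' /\
      forall k, exists y y', phi ((pt t - pt t') *+ k + (pt y - pt y')) != 0.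
Proof.
move=> m0 m1 Vm.
have V01 v : v \in V -> 0 <= v <= 1.
  by move=> /Vm/andP[mv ->]; rewrite (le_trans (ltW m0)).
have [w0 [C0 [w01 _ LS]]] := low_spectrum V01.
have [c [a1 [C1 [c0 DS]]]] := dense_subset m0 m1 Vm.
(* [t0] is the height of the gap for [psi], [v] the variance allowed by
   [walk_homogeneous], [w] the spectral scale achieving it, [e] the stability needed
   at that scale, and [d] the parameter of [homogenize] giving [e]. *)
pose t0 : R := Num.min m c / 4.
have t00 : 0 < t0 by rewrite divr_gt0 // lt_min m0.
have t0m : 4 * t0 <= m.
  by rewrite /t0 mulrC divfK ?pnatr_eq0 // ge_min lexx.
have t0c : 4 * t0 <= c.
  by rewrite /t0 mulrC divfK ?pnatr_eq0 // ge_min lexx orbT.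
have t01 : t0 <= 1 by move: t0m m1 t00; clra.
pose v : R := t0 ^+ 4 / 20.
have v0 : 0 < v by rewrite divr_gt0 ?exprn_gt0.
have vt : 18 * v < t0 ^+ 4.
  rewrite /v; have := exprn_gt0 4 t00; clra.
have v1 : v <= 1.
  have : t0 ^+ 4 <= 1 by rewrite exprn_ile1 ?(ltW t00).
  by rewrite /v; clra.
pose w := Num.max w0 (6 / v).
have w0w : w0 <= w by rewrite le_max lexx.
have w1 : 1 <= w by exact: le_trans w0w.
have wp : 0 < w by exact: lt_le_trans w1.
have wv : 2 / w ^+ 6 <= v / 3.
  have : 6 / v <= w ^+ 6.
    apply: (@le_trans _ _ w); first by rewrite le_max lexx orbT.
    by rewrite -{1}[w]expr1 ler_weXn2l.
  rewrite ler_pdivrMr // => h; rewrite ler_pdivrMr ?exprn_gt0 //.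
  by move: h; rewrite mulrC; clra.
pose e : R := t0 * v / (1000 * w ^+ 32).
have e0 : 0 < e.
  apply: divr_gt0; first exact: mulr_gt0.
  by apply: mulr_gt0; rewrite ?ltr0n ?exprn_gt0.
have eE : e * (1000 * w ^+ 32) = t0 * v.
  by rewrite /e divfK // gt_eqF // mulr_gt0 ?exprn_gt0 ?ltr0n.
have wj j : 1 <= w ^+ j by exact: exprn_ege1.
have e_t0 : e <= t0 / 1000.
  rewrite ler_pdivlMr // mulrC -(ler_pM2r (exprn_gt0 32 wp)).
  have -> : 1000 * e * w ^+ 32 = t0 * v by rewrite -eE; ring.
  by rewrite ler_wpM2l ?(ltW t00) // (le_trans v1).
have e1 : e <= 1 by move: e_t0 t01 t00; clra.
have et : 32 * e ^+ 2 <= t0 ^+ 2.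
  have e8 : e <= t0 / 8 by move: e_t0 t00; clra.
  have : e ^+ 2 <= (t0 / 8) ^+ 2.
    by rewrite lerXn2r ?nnegrE ?(le_trans (ltW e0)) // ltW.
  have -> : (t0 / 8) ^+ 2 = t0 ^+ 2 / 64 by field.
  by have := sqr_ge0 t0; clra.
pose eta := 16 * w ^+ 16 * e.
have etaE : 1000 * (eta * w ^+ 16) = 16 * (t0 * v).
  by rewrite /eta -eE; ring.
have w0j j : 0 <= w ^+ j by rewrite exprn_ge0 // ltW.
have eta0 : 0 <= eta by apply: mulr_ge0 (ltW e0); exact: mulr_ge0.
have tv : t0 * v <= v by rewrite ler_piMl // ltW.
have eta_small : eta * w ^+ 16 <= v / 60 by move: etaE tv v0; clra.
have eta1 : 4 * eta <= v / 3.
  have : eta <= eta * w ^+ 16 by rewrite ler_peMr.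
  by move: eta_small v0; clra.
have eta2 : 2 * w ^+ 16 * eta ^+ 2 <= v / 3.
  have : (eta * w ^+ 16) * eta <= v / 60 * 1.
    apply: ler_pM => //; first by rewrite mulr_ge0 ?exprn_ge0 ?(ltW wp).
    by move: eta1 v1; clra.
  by rewrite expr2; move: v0; clra.
have total_v r : r + 2 / w ^+ 6 + 4 * eta + 2 * w ^+ 16 * eta ^+ 2 <= r + v.
  by move: wv eta1 eta2; clra.
pose d := e ^+ 2 / 32.
have d0 : 0 < d by rewrite divr_gt0 ?exprn_gt0.
have d12 : d <= 1 / 2.
  have : e ^+ 2 <= 1 by rewrite exprn_ile1 ?(ltW e0).
  by rewrite /d; clra.
have dE : 32 * d = e ^+ 2 by rewrite /d mulrC divfK ?pnatr_eq0.
(* [b] and [b1] count the factors [2 * K] by which subsets may shrink while stability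
   must still hold. *)
have [b1 b1P] := pow2_ge (2 / (c * d) + 8 / c ^+ 2 + 12 / e ^+ 2).
have p1 : 0 < 2 / (c * d) by apply: divr_gt0 => //; exact: mulr_gt0.
have p2 : 0 < 8 / c ^+ 2 by rewrite divr_gt0 ?exprn_gt0 ?ltr0n.
have p3 : 0 < 12 / e ^+ 2 by rewrite divr_gt0 ?exprn_gt0 ?ltr0n.
(* After [s] increments the density would exceed 2. *)
have [s sP] := exp_unbounded (2 / c) (mulr_gt0 (ltr0n R 2) (exprn_gt0 2 d0)).
have [s0 s0P] := pow2_ge (4 / m ^+ 4).
pose b := b1.+1; pose a0 := (4 + s0)%N.
pose B := exponent_bound b.+1 s a0.
pose A : R := 1 + 2 / c + 8 * 2 ^+ B.+1 / c ^+ 2 + C0%:R.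
have A1 : 1 <= A.
  by rewrite /A -!addrA lerDl !addr_ge0 ?divr_ge0 ?mulr_ge0 ?exprn_ge0 ?(ltW c0).
pose D := (B + 3 + C0)%N.
exists (2 ^+ B.+1 * A + `|a1|), (B.+1 + D + C1)%N; split.
  by rewrite ltr_wpDr // mulr_gt0 ?exprn_gt0 // (lt_le_trans ltr01).
move=> T I G X phi pt K XX pt_inj K1 phi0 phiV phi_diff phi_m phi_gap Tbig.
have K0 : 0 < K by exact: lt_le_trans K1.
have k0 : 0 < 2 * K by rewrite mulr_gt0.
have k1 : 1 <= 2 * K by move: K1; clra.
have Kj j : 0 < K ^+ j by rewrite exprn_gt0.
have kj j : 0 < (2 * K) ^+ j by rewrite exprn_gt0.
have kmono i j : (i <= j)%N -> (2 * K) ^+ i <= (2 * K) ^+ j.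
  by move=> ij; rewrite ler_weXn2l.
have Kmono i j : (i <= j)%N -> K ^+ i <= K ^+ j by move=> ij; rewrite ler_weXn2l.
have Tb1 : (2 * K) ^+ B.+1 * (A * K ^+ D) <= #|T|%:R.
  apply: le_trans Tbig; apply: (@le_trans _ _ (2 ^+ B.+1 * A * K ^+ (B.+1 + D + C1))).
    rewrite exprMn mulrACA -exprD ler_wpM2l ?Kmono ?leq_addr //.
    by rewrite mulr_ge0 ?exprn_ge0 // (le_trans ler01).
  by rewrite ler_wpM2r ?(ltW (Kj _)) // lerDl.
have Tb2 : a1 * K ^+ C1 <= #|T|%:R.
  apply: le_trans Tbig; apply: (@le_trans _ _ (`|a1| * K ^+ (B.+1 + D + C1))).
    apply: (@le_trans _ _ (`|a1| * K ^+ C1)); first by rewrite ler_wpM2r ?ler_norm // ltW.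
    by rewrite ler_wpM2l // Kmono // leq_addl.
  rewrite ler_wpM2r ?(ltW (Kj _)) // lerDr mulr_ge0 ?exprn_ge0 //.
  exact: le_trans ler01 A1.
have [Y1 [cY1 TY1]] := DS T I G X phi pt K XX K1 phi0 phiV phi_m Tb2.
have TY1' : #|T|%:R <= (2 * K) ^+ a0 * #|Y1|%:R.
  rewrite -(ler_pM2l (exprn_gt0 4 m0)); apply: le_trans TY1 _.
  rewrite [leRHS]mulrA; apply: ler_wpM2r => //.
  have h1 : K ^+ 4 <= (2 * K) ^+ 4.
    by rewrite lerXn2r ?nnegrE ?(ltW K0) ?(ltW k0) //; move: K0; clra.
  have h2 : 4 / m ^+ 4 <= (2 * K) ^+ s0.
    apply: le_trans s0P _; rewrite lerXn2r ?nnegrE ?(ltW k0) //.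
    by move: K1; clra.
  rewrite -ler_pdivrMl ?exprn_gt0 //.
  have -> : (m ^+ 4)^-1 * (4 * K ^+ 4) = K ^+ 4 * (4 / m ^+ 4) by ring.
  rewrite /a0 exprD; apply: ler_pM => //; first exact: ltW.
  by rewrite divr_ge0 ?exprn_ge0 // ltW.
have incr : 2 < density phi pt Y1 * (1 + 2 * d ^+ 2) ^+ s.
  rewrite ltr_pdivrMr // in sP; apply: lt_le_trans sP _.
  rewrite [leRHS]mulrC; apply: ler_wpM2l => //.
  by apply: exprn_ge0; apply: addr_ge0 => //; apply: mulr_ge0 => //; exact: sqr_ge0.
have Tb3 : K * (2 * K) ^+ B <= #|T|%:R.
  apply: le_trans Tb1; rewrite mulrC; apply: ler_pM; rewrite ?(ltW (kj _)) ?(ltW K0) //.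
    exact: kmono.
  apply: (@le_trans _ _ (K ^+ D)); last by rewrite ler_peMl // ltW.
  by rewrite -{1}[K]expr1 Kmono // /D addnAC addn3.
have [a' [Y [aB TY cY homY]]] := increment XX m0 Vm K1 phi0 phiV
  (mulr_gt0 (ltr0n R 2) (exprn_gt0 2 d0)) c0 TY1' cY1 incr Tb3.
have Tsize Z a2 : (a2 <= B.+1)%N -> #|T|%:R <= (2 * K) ^+ a2 * #|Z : {set T}|%:R ->
    A * K ^+ D <= #|Z|%:R.
  move=> a2B TZ; rewrite -(ler_pM2l (kj B.+1)); apply: le_trans Tb1 _.
  by apply: le_trans TZ _; rewrite ler_wpM2r // kmono.
have KD : K <= A * K ^+ D.
  apply: (@le_trans _ _ (K ^+ D)); last by rewrite ler_peMl // ltW.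
  by rewrite -{1}[K]expr1 Kmono // /D addnAC addn3.
have KY : K <= #|Y|%:R.
  by apply: le_trans KD (Tsize Y a' _ TY); exact: leqW.
have bb1 : 2 ^+ b1 <= 2 ^+ b :> R by rewrite ler_weXn2l ?ler1n.
have bP : 2 / (c * d) <= 2 ^+ b by move: b1P bb1 p1 p2 p3; clra.
have [Z [YZ cZ homZ]] := homogenize XX m0 Vm K1 phi0 phiV c0 d0 d12 KY cY bP homY.
pose n : R := #|Z|%:R.
have TZ : #|T|%:R <= (2 * K) ^+ a'.+1 * n.
  apply: le_trans TY _; rewrite exprSr -mulrA ler_wpM2l ?(ltW (kj _)) //.
  by apply: le_trans YZ _; rewrite ler_wpM2r // ; move: K1; clra.
have nbig : A * K ^+ D <= n by exact: (Tsize Z a'.+1).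
have ge_n (x : R) j : (j <= D)%N -> 0 <= x -> x <= A -> x * K ^+ j <= n.
  move=> jD x0 xA; apply: le_trans nbig; apply: ler_pM; rewrite ?(ltW (Kj _)) //.
  exact: Kmono.
have D2 : (2 <= D)%N by rewrite /D addnAC addn3.
have D1 : (1 <= D)%N by exact: ltnW.
have [q1 q2 q3] : [/\ 0 <= 2 / c, 0 <= 8 * 2 ^+ B.+1 / c ^+ 2 & 0 <= C0%:R :> R].
  by split=> //; rewrite divr_ge0 ?mulr_ge0 ?exprn_ge0 // ltW.
have K2n : K ^+ 2 <= n by rewrite -[leLHS]mul1r; exact: ge_n.
have Kn : K <= n by exact: le_trans KD nbig.
have n0 : 0 < n by exact: lt_le_trans Kn.
have cK : 2 * K <= c * n.
  have : 2 / c * K ^+ 1 <= n by apply: ge_n => //; rewrite /A; move: q2 q3; clra.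
  by rewrite expr1 mulrAC ler_pdivrMr // [n * c]mulrC.
have C0n : C0%:R * K ^+ C0 <= n.
  apply: ge_n => //; first by rewrite /D leq_addl.
  by rewrite /A; move: q1 q2; clra.
have big8 : 8 * (2 * K) ^+ a'.+1 / c ^+ 2 < n.
  apply: (@lt_le_trans _ _ (A * K ^+ D)) => //.
  apply: (@le_lt_trans _ _ (8 * 2 ^+ B.+1 / c ^+ 2 * K ^+ D)).
    apply: (@le_trans _ _ (8 * (2 * K) ^+ B.+1 / c ^+ 2)).
      rewrite ler_wpM2r ?invr_ge0 ?sqr_ge0 // ler_wpM2l //; exact: kmono.
    have -> : 8 * (2 * K) ^+ B.+1 / c ^+ 2 = 8 * 2 ^+ B.+1 / c ^+ 2 * K ^+ B.+1.
      by rewrite exprMn; ring.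
    by rewrite ler_wpM2l // Kmono // /D addnAC addn3 ltnS leqW // leqW // leq_addr.
  by rewrite ltr_pM2r //; rewrite /A; move: q1 q2 q3; clra.
have rho2 : density phi pt Z <= 2 by exact: (density_le2 m0 Vm K1 phi0 phiV Kn).
pose g := (2 * K) ^+ (a' + b).
have g0 : 0 < g by exact: kj.
have gb : 2 ^+ b1 <= g.
  apply: (@le_trans _ _ ((2 * K) ^+ b1)).
    by rewrite lerXn2r ?nnegrE ?(ltW k0) //; move: K1; clra.
  by apply: kmono; rewrite /b addnS leqW // leq_addl.
have g1 : 1 <= g by exact: exprn_ege1.
have ge2 : 12 / e ^+ 2 <= g by move: b1P gb p1 p2 p3; clra.
have small : 6 / g ^+ 2 + 2 * K / (g * n) <= e ^+ 2.
  have h1 : 12 <= g * e ^+ 2 by rewrite -ler_pdivrMr ?exprn_gt0.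
  have h2 : 6 / g ^+ 2 <= 6 / g.
    rewrite ler_wpM2l // lef_pV2 ?posrE ?exprn_gt0 //.
    by rewrite -{1}[g]expr1 ler_weXn2l.
  have h3 : 2 * K / (g * n) <= 2 / g.
    rewrite invfM mulrA mulrAC ler_wpM2r ?invr_ge0 ?(ltW g0) //.
    by rewrite ler_pdivrMr // ler_wpM2l.
  have h4 : 8 / g <= e ^+ 2.
    by rewrite ler_pdivrMr // mulrC; move: h1; clra.
  by move: h2 h3 h4; clra.
have hom (W : {set T}) : W \subset Z -> n <= g * #|W|%:R ->
    dist2 (vavg X pt W 0) (vavg X pt Z 0) <= e ^+ 2.
  by move=> WZ nW; rewrite -dE; exact: homZ.
have LSZ r (l : 'I_r -> R) (f : 'I_r -> T -> R) :
    spectral (kernel_on phi pt Z) l f ->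
    \sum_(i | l i <= n / w ^+ 8) l i ^+ 2 <= 2 * n ^+ 2 / w ^+ 6.
  move=> specM; apply: (LS _ (kernel_on phi pt Z) K Z r l f) => //.
  - by move=> x y; exact: kernel_on_sym.
  - exact: kernel_on_psd.
  - by move=> x y; rewrite /kernel_on => /negPf->.
  - by move=> x; rewrite /kernel_on subrr; case: ifP => // _; exact: ltW.
  - move=> x y xy; rewrite /kernel_on; case: ifP => _; first exact: phiV.
    by rewrite inE eqxx.
have sm := second_moment XX m0 Vm K1 phi0 phiV g0 e0 e1 K2n small hom w1 LSZ.
have {}sm : \sum_(x in Z) \sum_(y in Z) phi (pt x - pt y) ^+ 2 <=
    n ^+ 2 * (density phi pt Z ^+ 2 + v).
  apply: le_trans sm _; rewrite ler_wpM2l ?sqr_ge0 //; exact: total_v.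
have h0 : 0 < (2 * K) ^+ b1 by exact: kj.
have ch : 8 / c ^+ 2 <= (2 * K) ^+ b1.
  apply: (@le_trans _ _ (2 ^+ b1)); first by move: b1P p1 p2 p3; clra.
  by rewrite lerXn2r ?nnegrE ?(ltW k0) //; move: K1; clra.
have [t [t' [tZ t'Z tt' nm]]] := popular_translate pt_inj m0 Vm phi0 phiV
  phi_diff c0 cZ (kj a'.+1) h0 cK TZ ch big8.
exists t, t'; split=> //.
have gE : (2 * K) ^+ a'.+1 * (2 * K) ^+ b1 = g by rewrite -exprD /g /b addSnnS.
rewrite gE in nm.
exact: (walk_homogeneous XX pt_inj m0 m1 Vm K1 phi0 phiV phi_gap Kn cZ hom sm nm
  t00 t0m t0c (ltW v0) vt et).
Qed.

From mathcomp Require Import all_analysis.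

(** * Cosine sums and their Gram vectors *)

Section CosineSums.
Context {R : realType}.

Lemma cosDz (x : R) (z : int) : cos (x + 2 * pi * z%:~R) = cos x.
Proof.
have h (y : R) (k : nat) : cos (y + 2 * pi * k%:R) = cos y.
  have -> : 2 * pi * k%:R = (pi *+ 2) *+ k :> R by rewrite -[RHS]mulr_natr mulr2n; ring.
  exact: (periodicn (@cosD2pi R)).
case: z => k; first exact: h.
rewrite NegzE mulrNz mulrN -[in RHS](subrK (2 * pi * k.+1%:~R) x).
by rewrite h.
Qed.

(** [2 * sin h * cos (2 * h * k)] is the difference of [sin] at [2 * h * k + h]
    and at [2 * h * k - h]. *)
Lemma cos_sum_telescope (h : R) (n : nat) :
  \sum_(k < n) 2 * sin h * cos (2 * h * k%:R) = sin (2 * h * n%:R - h) + sin h.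
Proof.
elim: n => [|n IH]; first by rewrite big_ord0 mulr0 sub0r sinN addNr.
rewrite big_ord_recr /= IH -[n.+1%:R]natr1.
have -> : 2 * h * (n%:R + 1) - h = 2 * h * n%:R + h by ring.
by rewrite !sinD sinN cosN; ring.
Qed.

Lemma cos_mean (N : nat) (x : int) : (0 < N)%N ->
  N%:R^-1 * (\sum_(k < N) cos (2 * pi * x%:~R / N%:R * k%:R)) =
  (N%:Z %| x)%Z%:R :> R.
Proof.
move=> N0; have nz : N%:R != 0 :> R by rewrite pnatr_eq0 -lt0n.
pose r := (x %% N)%Z; pose q := (x %/ N)%Z.
have xE : x = q * N + r by exact: divz_eq.
have r0 : 0 <= r by apply: modz_ge0; rewrite -lt0n.
have rN : r < N by apply: ltz_pmod; rewrite ltz_nat.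
have cE (k : 'I_N) : cos (2 * pi * x%:~R / N%:R * k%:R) =
    cos (2 * (pi * r%:~R / N%:R) * k%:R) :> R.
  rewrite -(cosDz (2 * (pi * r%:~R / N%:R) * k%:R) (q * k)); congr cos.
  rewrite {1}xE rmorphD !rmorphM /=; rewrite -!pmulrn; by field.
rewrite (eq_bigr _ (fun k _ => cE k)).
have -> : (N%:Z %| x)%Z = (r == 0) by exact/dvdz_mod0P/eqP.
have [r00|rn0] := eqVneq r 0.
  rewrite r00 (eq_bigr (fun=> 1)) => [|k _]; last by rewrite mulr0 mul0r mulr0 mul0r cos0.
  by rewrite sumr_const card_ord mulVf.
set h : R := pi * r%:~R / N%:R.
have rp : 0 < r by rewrite lt_neqAle eq_sym rn0.
have Np : 0 < N%:R :> R by rewrite ltr0n.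
have hpi : 0 < h < pi.
  rewrite divr_gt0 ?mulr_gt0 ?pi_gt0 ?ltr0z //= ltr_pdivrMr // ltr_pM2l ?pi_gt0 //.
  by rewrite pmulrn ltr_int.
have sh := sin_gt0_pi hpi.
have := cos_sum_telescope h N.
have -> : 2 * h * N%:R - h = - h + 2 * pi * r%:~R by rewrite /h; field.
have -> : sin (- h + 2 * pi * r%:~R) = - sin h.
  rewrite -(cosBpihalf (- h + _)) addrAC (cosDz _ r) cosBpihalf sinN //.
rewrite addNr -mulr_sumr => /eqP; rewrite mulf_eq0 => /orP[|/eqP->].
  by rewrite mulf_eq0 pnatr_eq0 /= gt_eqF.
by rewrite mulr0.
Qed.

Variables (A : {fset int}) (s : int -> R).
Hypothesis symA : symmetric_set A.
Hypothesis sym_s : forall a : int, a \in A -> s a = s (- a).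

Definition cos_sum (x : R) : R := \sum_(a <- A) s a * cos (2 * pi * a%:~R * x).

Lemma memN a : (- a \in A) = (a \in A).
Proof.
have h b : b \in A -> - b \in A.
  by move=> bA; rewrite {1}symA; apply/imfsetP; exists b.
by apply/idP/idP => /h //; rewrite opprK.
Qed.

Lemma sumN (F : int -> R) : \sum_(a <- A) F (- a) = \sum_(a <- A) F a.
Proof.
rewrite -(big_map (fun a => - a) predT F) /=; apply: perm_big.
apply: uniq_perm; rewrite ?(map_inj_uniq oppr_inj) ?fset_uniq // => a.
by rewrite -[a in LHS]opprK (mem_map oppr_inj) memN.
Qed.

Variables (N : nat) (L Kp : R).
Hypotheses (N0 : (0 < N)%N) (L0 : 0 < L).
Hypothesis fK : forall x, - Kp <= cos_sum x.

(** The samples of [(Kp + cos_sum) / L] at the fractions [k / N], normalised to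
    be the weights of a measure on the [N]-th roots of unity. *)
Definition weight (k : 'I_N) : R := (Kp + cos_sum (k%:R / N%:R)) / (N%:R * L).

Lemma weight_ge0 k : 0 <= weight k.
Proof.
rewrite divr_ge0 ?mulr_ge0 ?(ltW L0) //.
by have := fK (k%:R / N%:R); lra.
Qed.

(** The character of frequency [a] on the [N]-th roots of unity, as a vector of
    the real [L2] space of the measure [weight]; the boolean selects its cosine
    or sine component. *)
Definition wave (a : int) : 'I_N * bool -> R := fun p =>
  Num.sqrt (weight p.1) *
  (if p.2 then cos (2 * pi * a%:~R / N%:R * p.1%:R)
   else sin (2 * pi * a%:~R / N%:R * p.1%:R)).

(** The Fourier coefficients of [(Kp + cos_sum) / L], periodised modulo [N]. *)
Definition coefficient (x : int) : R :=
  (Kp * (N%:Z %| x)%Z%:R + \sum_(a <- A) s a * (N%:Z %| x - a)%Z%:R) / L.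

(** The cosines are orthogonal by [cos_mean], and the symmetry of [A] and [s]
    identifies the contributions of [x + a] and [x - a]. *)
Lemma coefficientE x : coefficient x =
  \sum_(k < N) weight k * cos (2 * pi * x%:~R / N%:R * k%:R).
Proof.
have nz : N%:R != 0 :> R by rewrite pnatr_eq0 -lt0n.
have Lz : L != 0 by rewrite gt_eqF.
have prod (a : int) (k : 'I_N) :
  cos (2 * pi * a%:~R * (k%:R / N%:R)) * cos (2 * pi * x%:~R / N%:R * k%:R) =
  (cos (2 * pi * (x + a)%:~R / N%:R * k%:R) +
   cos (2 * pi * (x - a)%:~R / N%:R * k%:R)) / 2 :> R.
  have -> : 2 * pi * (x + a)%:~R / N%:R * k%:R =
     2 * pi * x%:~R / N%:R * k%:R + 2 * pi * a%:~R * (k%:R / N%:R) :> R.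
    by rewrite rmorphD /=; field.
  have -> : 2 * pi * (x - a)%:~R / N%:R * k%:R =
     2 * pi * x%:~R / N%:R * k%:R - 2 * pi * a%:~R * (k%:R / N%:R) :> R.
    by rewrite rmorphB /=; field.
  by rewrite cosD cosB; field.
have half : \sum_(a <- A) s a * (N%:Z %| x + a)%Z%:R = \sum_(a <- A) s a * (N%:Z %| x - a)%Z%:R :> R.
  rewrite -(sumN (fun a => s a * (N%:Z %| x - a)%Z%:R)).
  by apply: eq_big_seq => a aA; rewrite opprK -sym_s.
transitivity ((N%:R * L)^-1 * (Kp * (\sum_(k < N) cos (2 * pi * x%:~R / N%:R * k%:R)) +
   \sum_(a <- A) s a * ((\sum_(k < N) cos (2 * pi * (x + a)%:~R / N%:R * k%:R)) +
   \sum_(k < N) cos (2 * pi * (x - a)%:~R / N%:R * k%:R)) / 2)).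
  have mean y : \sum_(k < N) cos (2 * pi * y%:~R / N%:R * k%:R) =
      N%:R * (N%:Z %| y)%Z%:R :> R by rewrite -cos_mean // mulrA mulfV // mul1r.
  rewrite mean (eq_bigr (fun a => N%:R / 2 * (s a * (N%:Z %| x + a)%Z%:R) +
     N%:R / 2 * (s a * (N%:Z %| x - a)%Z%:R))) => [|a _]; last by rewrite !mean; field.
  rewrite big_split -!mulr_sumr half /coefficient /=.
  by field; rewrite Lz nz.
transitivity ((N%:R * L)^-1 * (\sum_(k < N) (Kp * cos (2 * pi * x%:~R / N%:R * k%:R) +
   cos_sum (k%:R / N%:R) * cos (2 * pi * x%:~R / N%:R * k%:R)))); last first.
  by rewrite mulr_sumr; apply: eq_bigr => k _; rewrite /weight; ring.
congr (_ * _); rewrite big_split -mulr_sumr; congr (_ + _).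
rewrite [RHS](eq_bigr (fun k : 'I_N => \sum_(a <- A) s a / 2 *
    (cos (2 * pi * (x + a)%:~R / N%:R * k%:R) + cos (2 * pi * (x - a)%:~R / N%:R * k%:R)))).
  rewrite exchange_big; apply: eq_bigr => a _ /=.
  by rewrite -mulr_sumr big_split /=; ring.
move=> k _; rewrite mulr_suml; apply: eq_bigr => a _.
by rewrite -[LHS]mulrA prod; ring.
Qed.

Lemma dot_wave a b : dot (wave a) (wave b) = coefficient (a - b).
Proof.
rewrite coefficientE /dot -(pair_bigA _ (fun k b0 => wave a (k, b0) * wave b (k, b0))) /=.
apply: eq_bigr => k _; rewrite big_bool /wave /=.
set u := 2 * pi * a%:~R / N%:R * k%:R; set v := 2 * pi * b%:~R / N%:R * k%:R.
have -> : 2 * pi * (a - b)%:~R / N%:R * k%:R = u - v.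
  by rewrite rmorphB /u /v /=; ring.
rewrite cosB -[weight k in RHS]sqr_sqrtr ?weight_ge0 //; ring.
Qed.

End CosineSums.

(** * The lower bound for cosine sums *)

Section SmallFrequencies.
Context {R : realType}.
Variables (A : {fset int}) (s : int -> R) (N D : nat) (L Kp : R).
Hypothesis A0 : 0 \notin A.
Hypothesis AD : forall a, a \in A -> (`|a| <= D)%N.
Hypothesis DN : (3 * D < N)%N.

Local Notation coef := (coefficient A s N L Kp).

Lemma not_dvdz_small (z : int) : z != 0 -> (`|z| < N)%N -> (N%:Z %| z)%Z = false.
Proof.
move=> z0 zN; rewrite dvdzE /= gtnNdvd //.
by rewrite absz_gt0.
Qed.

Lemma coefficient_period x : (N%:Z %| x)%Z -> coef x = Kp / L.
Proof.
move=> Nx; rewrite /coefficient Nx mulr1 big1_seq ?addr0 // => a /= aA.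
rewrite rpredBl // not_dvdz_small ?mulr0 //.
  by apply: contraNneq A0 => <-.
have := AD aA; clear -DN; lia.
Qed.

Lemma coefficient_none x :
  (N%:Z %| x)%Z = false -> (forall a, a \in A -> (N%:Z %| x - a)%Z = false) ->
  coef x = 0.
Proof.
move=> Nx h; rewrite /coefficient Nx mulr0 add0r big1_seq ?mul0r // => a /= aA.
by rewrite h // mulr0.
Qed.

Lemma coefficient_unique x a : (N%:Z %| x)%Z = false -> a \in A ->
  (N%:Z %| x - a)%Z -> coef x = s a / L.
Proof.
move=> Nx aA xa; rewrite /coefficient Nx mulr0 add0r (bigD1_seq a) ?fset_uniq //=.
rewrite xa mulr1 big1_seq ?addr0 // => b /andP[ba bA].
have -> : x - b = (x - a) + (a - b) by rewrite addrA subrK.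
rewrite rpredDl // not_dvdz_small ?mulr0 ?subr_eq0 1?eq_sym //.
have := AD bA; have := AD aA; clear -DN; lia.
Qed.

(** Two elements of [A] are congruent modulo [N] only if they are equal, so at
    most one term of the sum survives. *)
Lemma coefficient_values x :
  coef x = Kp / L \/ coef x = 0 \/ exists2 a, a \in A & coef x = s a / L.
Proof.
have [Nx|Nx] := boolP (N%:Z %| x)%Z; first by left; apply: coefficient_period.
move/negbTE: Nx => Nx; right.
have [/hasP[a aA xa]|/hasPn no] := boolP (has (fun a => (N%:Z %| x - a)%Z) A).
  by right; exists a; last exact: coefficient_unique.
by left; apply: coefficient_none => // a aA; apply/negbTE/no.
Qed.

Lemma coefficient_small x : x != 0 -> (`|x| <= 2 * D)%N ->
  coef x = if x \in A then s x / L else 0.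
Proof.
move=> x0 xD; have Nx : (N%:Z %| x)%Z = false.
  by apply: not_dvdz_small => //; clear -xD DN; lia.
case: ifP => xA; first by apply: coefficient_unique => //; rewrite subrr dvdz0.
apply: coefficient_none => // a aA; apply: not_dvdz_small.
  by rewrite subr_eq0; apply: contraFneq xA => ->.
have := AD aA; clear -xD DN; lia.
Qed.

End SmallFrequencies.

Lemma pos_lower_bound {R : realFieldType} (V : seq R) : (forall v, v \in V -> 0 < v) ->
  exists2 m : R, 0 < m <= 1 & forall v, v \in V -> m <= v.
Proof.
elim: V => [|v V IH] V0; first by exists 1; rewrite ?ltr01 ?lexx.
have [w wV|m /andP[m0 m1] mV] := IH; first by apply: V0; rewrite inE wV orbT.
exists (Num.min m v).
  by rewrite lt_min m0 V0 ?mem_head //= ge_min m1.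
by move=> w; rewrite inE ge_min => /orP[/eqP->|/mV ->]; rewrite ?lexx ?orbT.
Qed.

Lemma normalize_squares {R : realFieldType} (S : seq R) : 0 \notin S ->
  exists L m : R, [/\ 0 < L, 0 < m, m <= 1 & forall x, x \in S -> m <= (x / L) ^+ 2 <= 1].
Proof.
move=> S0; pose L := 1 + \sum_(x <- S) `|x|.
have sum0 (r : seq R) : 0 <= \sum_(x <- r) `|x| by apply: sumr_ge0.
have L0 : 0 < L by rewrite ltr_wpDr.
have [v|m /andP[m0 m1] mV] := @pos_lower_bound R [seq (x / L) ^+ 2 | x <- S].
  case/mapP => x xS ->; rewrite exprn_even_gt0 //= mulf_neq0 ?invr_eq0 ?(gt_eqF L0) //.
  by apply: contraNneq S0 => <-.
exists L, m; split=> // x xS; rewrite (mV _ (map_f _ xS)) /=.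
rewrite -real_normK ?num_real // expr_le1 // normrM normfV (gtr0_norm L0).
rewrite ler_pdivrMr // mul1r /L.
have : `|x| <= \sum_(y <- S) `|y|.
  by rewrite (big_rem x) //= lerDl sum0.
by move=> h; rewrite (le_trans h) // lerDr.
Qed.

(** [bounded_walk] is applied to the square of the coefficients, with
    [N = 100 * D ^ 2] where [D] bounds the frequencies. For distinct [t], [t']
    in [A], the multiple [x *+ (4 * D)] of [x = t - t'] has size between [4 * D]
    and [8 * D ^ 2]: even after a translation by some [y - y'], it is too far
    from 0, and from multiples of [N], to be congruent to 0 or to an element of
    [A]. So the conclusion of [bounded_walk] fails, and [A] is small. *)
Theorem cos_sum_bound {R : realType} (S : {fset R}) : 0 \notin S ->
  exists (b : R) (M : nat), [/\ 0 < b, (0 < M)%N &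
  forall (A : {fset int}) (s : int -> R) (Kp : R),
    0 \notin A -> symmetric_set A ->
    (forall a, a \in A -> s a \in S) ->
    (forall a, a \in A -> s a = s (- a)) ->
    (exists a, a \in A) ->
    (forall x, - Kp <= cos_sum A s x) ->
    0 < Kp /\ b * #|` A|%:R <= Kp ^+ M].
Proof.
move=> S0.
have [L [m [L0 m0 m1 mS]]] := normalize_squares S0.
pose V := [seq (x / L) ^+ 2 | x <- S].
have VP v : v \in V -> m <= v <= 1 by case/mapP => x xS ->; apply: mS.
have [a [C [a0 walk]]] := bounded_walk m0 m1 VP.
have LmP : 0 < L ^+ 2 * m by rewrite mulr_gt0 ?exprn_gt0.
exists ((L ^+ 2 * m) ^+ C.+1 / a), (2 * C.+1)%N; split=> //.
  by rewrite divr_gt0 ?exprn_gt0.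
move=> A s Kp A0 symA sS sym_s [a1 a1A] fK.
pose D := (\max_(a <- A) absz a)%N.
have AD b : b \in A -> (`|b| <= D)%N.
  by move=> bA; apply: (@leq_bigmax_seq _ _ xpredT absz b).
have D0 : (0 < D)%N.
  apply: leq_trans (AD _ a1A); rewrite absz_gt0.
  by apply: contraNneq A0 => <-.
pose N := (100 * D ^ 2)%N.
have N0 : (0 < N)%N by rewrite muln_gt0 expn_gt0 D0.
have DD : (D <= D ^ 2)%N by rewrite -[X in (X <= _)%N]expn1 leq_pexp2l.
have DN : (3 * D < N)%N by rewrite /N; clear -DD D0; lia.
pose coef := coefficient A s N L Kp.
have coefE : forall x y, dot (wave (N := N) A s L Kp x) (wave A s L Kp y) = coef (x - y).
  by move=> x y; apply: dot_wave.
have coef0 : coef 0 = Kp / L by apply: (coefficient_period s L Kp A0 AD DN); rewrite dvdz0.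
have inA t : t \in A -> t != 0 by move=> tA; apply: contraNneq A0 => <-.
have coefA t : t \in A -> coef t = s t / L.
  move=> tA; rewrite /coef (coefficient_small s L Kp AD DN) ?inA ?tA //.
  by have := AD _ tA; clear; lia.
have mK : m <= (Kp / L) ^+ 2.
  have := cauchy_schwarz (wave (N := N) A s L Kp a1) (wave A s L Kp 0).
  rewrite !coefE !subrr subr0 coef0 -expr2 coefA //; apply: le_trans.
  by case/andP: (mS _ (sS _ a1A)).
have K0 : 0 < Kp.
  have : 0 <= Kp / L.
    by have := coefE 0 0; rewrite subrr coef0 => <-; apply: dot_ge0.
  rewrite le_eqVlt => /orP[/eqP k0|]; last by rewrite pmulr_lgt0 ?invr_gt0.
  by move: mK; rewrite -k0 expr0n /= leNgt m0.
split=> //.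
pose K := (Kp / L) ^+ 2 / m.
have K1 : 1 <= K by rewrite ler_pdivlMr // mul1r.
suff : #|{: A}|%:R <= a * K ^+ C.
  move=> h; rewrite mulrAC ler_pdivrMr // cardfE.
  have KL : Kp ^+ 2 = L ^+ 2 * m * K.
    rewrite /K; field; rewrite ?(gt_eqF m0) ?(gt_eqF L0) //.
  rewrite exprM KL [X in _ <= X * _]exprMn -[leRHS]mulrA ler_pM2l ?exprn_gt0 // mulrC.
  apply: le_trans h _; rewrite ler_pM2l // exprS ler_peMl //.
  by rewrite exprn_ge0 // (le_trans ler01).
rewrite leNgt; apply/negP => big.
pose phi x := coef x ^+ 2.
have phiE : forall x y, dot (tensor_sq (wave (N := N) A s L Kp x)) (tensor_sq (wave A s L Kp y)) = phi (x - y).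
  by move=> x y; rewrite dot_tensor_sq coefE.
have diff (t t' : A) : t != t' -> val t - val t' != 0 /\ (`|val t - val t'| <= 2 * D)%N.
  move=> tt'; split; first by rewrite subr_eq0 (inj_eq val_inj).
  have := AD _ (valP t); have := AD _ (valP t'); clear; lia.
(* Differences of distinct frequencies are too small to wrap around. *)
have phi_diff (t t' : A) : t != t' ->
    phi (val t - val t') = if val t - val t' \in A then (s (val t - val t') / L) ^+ 2 else 0.
  case/diff => x0 xD; rewrite /phi /coef (coefficient_small s L Kp AD DN) //.
  by case: ifP; rewrite ?expr0n.
have [t [t' [tt' move_away]]] : exists t t' : A, t != t' /\ forall k : nat,
    exists y y' : A, phi ((val t - val t') *+ k + (val y - val y')) != 0.
  apply: (walk _ _ _ _ phi (val : A -> int) K phiE) => //.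
  - rewrite /phi coef0 /K ler_peMr ?sqr_ge0 //.
    by rewrite invf_ge1.
  - move=> t t' /phi_diff ->; case: ifP => xA; last by rewrite mem_head.
    by rewrite inE (map_f (fun x => (x / L) ^+ 2)) ?orbT //; apply: sS.
  - move=> t t' /phi_diff ->; case: ifP => xA; last by rewrite eqxx.
    by move=> _; exists [` xA]%fset.
  - by move=> t; rewrite /phi coefA ?(valP t) //; case/andP: (mS _ (sS _ (valP t))).
  - move=> x; rewrite /phi /coef.
    have [->|[->|[b bA ->]]] := coefficient_values s L Kp A0 AD DN x.
    + by right.
    + by left; rewrite expr0n.
    + by right; case/andP: (mS _ (sS _ bA)).
  - exact: ltW.
have [x0 xD] := diff _ _ tt'.
have [y [y' /negP[]]] := move_away (4 * D)%N.
set x := val t - val t' in x0 xD *.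
have kx : (4 * D <= `|x *+ (4 * D)| <= 8 * D ^ 2)%N.
  rewrite -mulr_natr abszM natz absz_nat leq_pmull ?absz_gt0 //=.
  by rewrite (leq_trans (leq_mul xD (leqnn _))) // mulnACA mulnn.
have yD : (`|val y - val y'| <= 2 * D)%N.
  have := AD _ (valP y); have := AD _ (valP y'); clear; lia.
set z := _ + _.
have zD : (2 * D <= `|z| <= 10 * D ^ 2)%N.
  rewrite /z; move: kx yD DD; set u := x *+ _; set w := _ - _; clear; lia.
rewrite /phi /coef coefficient_none ?expr0n //.
  by apply: not_dvdz_small; move: zD D0; rewrite /N; clear; lia.
move=> b bA; have := AD _ bA => bD.
by apply: not_dvdz_small; move: zD D0 bD DD; rewrite /N; clear; lia.
Qed.

Import numFieldNormedType.Exports.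

Local Open Scope complex_scope.

(** * Minimum of the exponential sum *)

(** The contributions of [a] and [- a] to the imaginary part cancel. *)
Lemma trig_sumE (R : realType) (A : {fset int}) (s : int -> R) (x : R) :
  symmetric_set A -> (forall a, a \in A -> s a = s (- a)) ->
  trig_sum A s x = (cos_sum A s x)%:C.
Proof.
move=> symA sym_s.
have split_sum (r : seq int) : \sum_(a <- r) (s a)%:C * e (a%:~R * x) =
    (\sum_(a <- r) s a * cos (2 * pi * a%:~R * x)) +i*
    (\sum_(a <- r) s a * sin (2 * pi * a%:~R * x)).
  elim: r => [|a r IH]; first by rewrite !big_nil.
  rewrite !big_cons IH /e !mulrA; apply/eqP; rewrite eq_complex /=.
  by apply/andP; split; apply/eqP; ring.
rewrite /trig_sum split_sum; congr (_ +i* _).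
have odd_sum : \sum_(a <- A) s a * sin (2 * pi * a%:~R * x) =
    - \sum_(a <- A) s a * sin (2 * pi * a%:~R * x).
  rewrite -[LHS](sumN symA) -sumrN; apply: eq_big_seq => a aA.
  by rewrite -sym_s // rmorphN mulrN mulNr sinN mulrN.
by move: odd_sum; set u := (\sum_(a <- A) _); clear; lra.
Qed.

Lemma cos_sum_continuous (R : realType) (A : {fset int}) (s : int -> R) :
  continuous (cos_sum A s).
Proof.
rewrite /cos_sum; elim: (A : seq int) => [|a r IH] x.
  under eq_fun do rewrite big_nil; exact: cvg_cst.
under eq_fun do rewrite big_cons.
apply: cvgD; last exact: IH.
apply: cvgM; first exact: cvg_cst.
apply: continuous_comp; last exact: continuous_cos.
by apply: cvgM; [exact: cvg_cst | exact: cvg_id].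
Qed.

(** By periodicity it suffices to minimise on [[0, 1]]. *)
Lemma cos_sum_min (R : realType) (A : {fset int}) (s : int -> R) :
  exists x0, forall x, cos_sum A s x0 <= cos_sum A s x.
Proof.
have [x0 _ x0P] := @EVT_min R (cos_sum A s) 0 1 ler01
  (continuous_subspaceT (@cos_sum_continuous R A s)).
exists x0 => x; set n := Num.floor x.
have -> : cos_sum A s x = cos_sum A s (x - n%:~R).
  apply: eq_bigr => a _; congr (_ * _).
  rewrite -(cosDz (2 * pi * a%:~R * (x - n%:~R)) (a * n)); congr cos.
  by rewrite rmorphM /=; ring.
apply: x0P; rewrite in_itv /= subr_ge0 lerBlDl.
have /andP[-> /ltW] := floor_itv x.
by rewrite rmorphD /= addrC.
Qed.

Lemma root_bound (R : realType) (b x y : R) (M : nat) : (0 < M)%N ->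
  0 <= b -> 0 <= x -> 0 <= y -> b * y <= x ^+ M ->
  b `^ M%:R^-1 * y `^ M%:R^-1 <= x.
Proof.
move=> M0 b0 x0 y0 h; rewrite -powRM //.
have -> : x = (x ^+ M) `^ M%:R^-1.
  by rewrite -powR_mulrn // -powRrM mulfV ?powRr1 // pnatr_eq0 -lt0n.
by apply: ge0_ler_powR; rewrite ?invr_ge0 ?nnegrE ?mulr_ge0 ?exprn_ge0.
Qed.

Theorem theorem1p2 (R : realType) (S : {fset R}) (S0 : 0 \notin S) :
  exists c c' : R, [/\ 0 < c, 0 < c' &
    forall (A : {fset int}) (s : int -> R),
      0 \notin A ->
      symmetric_set A ->
      (forall a : int, a \in A -> s a \in S) ->
      (forall a : int, a \in A -> s a = s (- a)) ->
      exists x0 : R,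
        (forall x : R, trig_sum A s x0 <= trig_sum A s x) /\
        trig_sum A s x0 <= (- (c' * #|` A|%:R `^ c))%:C].
Proof.
have [b [M [b0 M0 bound]]] := cos_sum_bound S0.
exists M%:R^-1, (b `^ M%:R^-1); split; rewrite ?invr_gt0 ?ltr0n ?powR_gt0 //.
move=> A s A0 symA sS sym_s; have [x0 x0P] := cos_sum_min A s.
exists x0; split=> [x|]; rewrite !trig_sumE // lecR //.
(* If [A] is empty, both sides vanish, since the exponent is not 0. *)
have [A00|[a aA]] := fset_0Vmem A.
  rewrite A00 cardfs0 /cos_sum big_seq_fset0.
  by rewrite powR0 ?mulr0 ?oppr0 // invr_eq0 pnatr_eq0 -lt0n.
have [||Kp0 le_pow] := bound A s (- cos_sum A s x0) A0 symA sS sym_s.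
- by exists a.
- by move=> x; rewrite opprK.
rewrite lerNr; apply: root_bound => //; exact: ltW.
Qed.
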